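(* Let $f:\mathbb{B}\to\mathbb{B}$ be a regular function, let $q_0\in\mathbb{B}$ and let $n\ge1$ be an integer. If $\partial_c^mf(q_0)=0$ for $1\le m\le n-1$, then $$|(f(q)-f(q_0))*(1-\overline{f(q_0)}*f(q))^{-*}|\le|(q-q_0)^{*n}*(1-\bar q_0*q)^{-*n}|$$ for all $q\in\mathbb{B}$. Furthermore, $$\left|\partial_c^nf*(1-\overline{f(q_0)}*f)^{-*}\right|_{|_{q_0}}\le\frac{n!}{(1-|q_0|^2)^n}.$$
   Context: $\mathbb{H}$ denotes the quaternions, $\mathbb{B}=\{q\in\mathbb{H}: |q|<1\}$, $\mathbb{S}=\{q\in\mathbb{H}: q^2=-1\}$, $L_I=\mathbb{R}+I\mathbb{R}$ for $I\in\mathbb{S}$. A function $f:\Omega\to\mathbb{H}$ on a domain $\Omega\subseteq\mathbb{H}$ is (slice) regular if for every $I\in\mathbb{S}$ its restriction to $\Omega\cap L_I$ is real differentiable and $\frac12\left(\frac{\partial}{\partial x}+I\frac{\partial}{\partial y}\right)f(x+Iy)=0$ there. On a ball $B(0,R)=\{|q|<R\}$ the regular functions are exactly the convergent power series $f(q)=\sum_n q^na_n$, $a_n\in\mathbb{H}$. Regular product: for $f(q)=\sum q^na_n$, $g(q)=\sum q^nb_n$, $f*g(q)=f(q)*g(q)=\sum_n q^n\sum_{k=0}^n a_kb_{n-k}$ (the letter $q$ always denotes the variable and other quaternions are treated as constant functions; so $\bar q_0*q=q\bar q_0$). Regular conjugate: $f^c(q)=\sum q^n\bar a_n$; symmetrization: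 $f^s=f*f^c=f^c*f$. For $f\not\equiv0$ the regular reciprocal is $f^{-*}(q)=f^s(q)^{-1}f^c(q)$, and $g*f^{-*}(q)=f^s(q)^{-1}(g*f^c)(q)$, wherever $f^s\ne0$. $g^{*n}$ denotes the $*$-product of $n$ copies of $g$, and $g^{-*n}=(g^{-*})^{*n}$. The functions $1-\bar q_0*q$ and $1-\overline{f(q_0)}*f(q)$ have reciprocals defined and regular on all of $\mathbb{B}$. Cullen derivative: $\partial_cf(x+Iy)=\frac12\left(\frac{\partial}{\partial x}-I\frac{\partial}{\partial y}\right)f(x+Iy)$, i.e. $\partial_c\left(\sum q^na_n\right)=\sum_{n\ge1} q^{n-1}na_n$; $\partial_c^n$ is its $n$th iterate. The notation $|\cdot|_{|_{q_0}}$ means the modulus of the value of the function at $q=q_0$. *)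

(* Defs.v *)
From Stdlib Require Import Reals ClassicalEpsilon.
From Coquelicot Require Import Coquelicot.

Open Scope R_scope.

(** ((a, b), (c, d)) is a + b i + c j + d k.  Coquelicot's product norm is
    sqrt (|u|^2 + |v|^2), so [norm] on [H] is the Euclidean modulus. *)
Definition H : NormedModule R_AbsRing :=
  prod_NormedModule R_AbsRing
    (prod_NormedModule R_AbsRing R_NormedModule R_NormedModule)
    (prod_NormedModule R_AbsRing R_NormedModule R_NormedModule).

Definition mkH (a b c d : R) : H := ((a, b), (c, d)).
Definition re (q : H) : R := fst (fst q).
Definition im_i (q : H) : R := snd (fst q).
Definition im_j (q : H) : R := fst (snd q).
Definition im_k (q : H) : R := snd (snd q).

Definition Hreal (x : R) : H := mkH x 0 0 0.
Definition Hone : H := Hreal 1.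

Definition Hmult (p q : H) : H :=
  mkH (re p * re q - im_i p * im_i q - im_j p * im_j q - im_k p * im_k q)
      (re p * im_i q + im_i p * re q + im_j p * im_k q - im_k p * im_j q)
      (re p * im_j q - im_i p * im_k q + im_j p * re q + im_k p * im_i q)
      (re p * im_k q + im_i p * im_j q - im_j p * im_i q + im_k p * re q).

Definition Hconj (q : H) : H := mkH (re q) (- im_i q) (- im_j q) (- im_k q).

Definition Hinv (q : H) : H := scal (/ (norm q) ^ 2) (Hconj q).

Fixpoint Hpow (q : H) (n : nat) : H :=
  match n with O => Hone | S m => Hmult q (Hpow q m) end.

Definition ball1 (q : H) : Prop := norm q < 1.

Definition sphere (I : H) : Prop := Hmult I I = opp Hone.

Definition slice (I : H) (x y : R) : H := plus (Hreal x) (scal y I).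

(** Componentwise derivative of a curve; like [Derive], it is only meaningful
    where the curve is differentiable. *)
Definition HDerive (g : R -> H) (t : R) : H :=
  mkH (Derive (fun s => re (g s)) t) (Derive (fun s => im_i (g s)) t)
      (Derive (fun s => im_j (g s)) t) (Derive (fun s => im_k (g s)) t).

Definition partial_x (I : H) (f : H -> H) (x y : R) : H :=
  HDerive (fun t => f (slice I t y)) x.
Definition partial_y (I : H) (f : H -> H) (x y : R) : H :=
  HDerive (fun t => f (slice I x t)) y.

(** Functions on a domain [Omega] (open and connected) are total functions
    whose values outside [Omega] are irrelevant. *)
Definition slice_regular (Omega : H -> Prop) (f : H -> H) : Prop :=
  forall (I : H) (x y : R), sphere I -> Omega (slice I x y) ->
    ex_filterdiff (fun p : R * R => f (slice I (fst p) (snd p)))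
      (locally (x, y)) /\
    scal (/ 2) (plus (partial_x I f x y) (Hmult I (partial_y I f x y))) = zero.

(** [q = slice (dir q) (re q) (norm (vec q))].  The unit [dir q] is arbitrary
    (here i) for real [q], where the Cullen derivative of a regular function
    does not depend on it; for non-real [q] the only other choice is
    [- dir q], with [y] changed to [- y], which gives the same value. *)
Definition vec (q : H) : H := mkH 0 (im_i q) (im_j q) (im_k q).
Definition dir (q : H) : H :=
  if Req_EM_T (norm (vec q)) 0 then mkH 0 1 0 0
  else scal (/ norm (vec q)) (vec q).

Definition cullen (f : H -> H) (q : H) : H :=
  let I := dir q in
  let x := re q in
  let y := norm (vec q) in
  scal (/ 2) (minus (partial_x I f x y) (Hmult I (partial_y I f x y))).

Fixpoint cullen_n (n : nat) (f : H -> H) : H -> H :=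
  match n with O => f | S m => cullen (cullen_n m f) end.

(** Componentwise sum of a series, only meaningful if it converges. *)
Definition HSeries (u : nat -> H) : H :=
  mkH (Series (fun n => re (u n))) (Series (fun n => im_i (u n)))
      (Series (fun n => im_j (u n))) (Series (fun n => im_k (u n))).

Definition HPSeries (a : nat -> H) (q : H) : H :=
  HSeries (fun n => Hmult (Hpow q n) (a n)).

Definition expansion (f : H -> H) (a : nat -> H) : Prop :=
  forall q, ball1 q -> is_series (fun n => Hmult (Hpow q n) (a n)) (f q).

(** The coefficients of the power series of [f] on the unit ball, arbitrary if
    there is no such series. *)
Definition coef (f : H -> H) : nat -> H :=
  epsilon (inhabits (fun _ : nat => zero)) (expansion f).

Definition star (f g : H -> H) : H -> H :=
  HPSeries (fun n => sum_n (fun k => Hmult (coef f k) (coef g (n - k))) n).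

Fixpoint star_pow (f : H -> H) (n : nat) : H -> H :=
  match n with O => fun _ => Hone | S m => star f (star_pow f m) end.

Definition reg_conj (f : H -> H) : H -> H := HPSeries (fun n => Hconj (coef f n)).

Definition symm (f : H -> H) : H -> H := star f (reg_conj f).

Definition star_inv (f : H -> H) : H -> H :=
  fun q => Hmult (Hinv (symm f q)) (reg_conj f q).

Definition one_minus (f : H -> H) : H -> H := fun q => minus Hone (f q).

Definition cst (c : H) : H -> H := fun _ => c.

(* Main.v *)
Require Import Defs.
From Stdlib Require Import Reals Factorial Lra Lia Psatz.
From Stdlib Require Import FunctionalExtensionality Classical ClassicalEpsilon.
From Coquelicot Require Import Coquelicot.

(* The function h = (f - f(q0)) * (1 - conj(f(q0)) * f)^{-*} satisfies (1 - f * conj(f(q0))) * h = f - f(q0).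
   Since (a * b)(q) = a(q) b(p) with p = a(q)^{-1} q a(q) of the same modulus as q, and since p runs through
   the whole ball when a has no zeros (even sphere by sphere), this gives |h| <= 1 from the scalar Schwarz-Pick
   inequality.  The flatness condition means f - f(q0) = (q - q0)^{*n} * k, hence h = (q - q0)^{*n} * kappa.
   The Blaschke factor of q0 has modulus tending to 1 at the boundary, so by the maximum principle each factor
   q - q0 may be replaced by 1 - q conj(q0) without losing the bound 1: g = (1 - q conj(q0))^{*n} * kappa
   satisfies |g| <= 1.  The first inequality is h = M * g with M the n-th power of the Blaschke factor; the
   second one is |g(q0)| <= 1, because the value of the left-hand side at q0 is n! kappa(q0).

   Regular functions are identified with their coefficient sequences.  A function that is merely
   differentiable on the slices has a power series by Goursat's bisection argument and Cauchy's formula. *)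

(** * Quaternions *)

Infix "*h" := Hmult (at level 40, left associativity).
Notation "p +h q" := (@plus H p q) (at level 50, left associativity).
Notation "p -h q" := (@minus H p q) (at level 50, left associativity).

(** Every [star] of the statement rests on [coef], a choice of coefficients that says nothing until
    an expansion is known to exist; hence regularity has to be turned into a power series before any
    product can be opened. The bound on the spheres |q| = r that the expansion asks for comes from
    f(B) lying in B. In h the reciprocal stands to the right of f - f(q0), so the value of f - f(q0)
    decides the point at which the reciprocal is evaluated. With c = f(q0) and c' its conjugate, the
    identity (1 - f c') * (f - c) = (f - c) * (1 - c' f) brings a denominator to the left; it holds
    because c c' is real, hence central. Series and integrals are estimated coordinate by
    coordinate, which loses constant factors. A lost constant later disappears in a limit or, in the
    maximum principle, when N-th roots are taken. *)

Lemma H_ext (p q : H) :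
  re p = re q -> im_i p = im_i q -> im_j p = im_j q -> im_k p = im_k q -> p = q.
Proof.
  destruct p as [[a b] [c d]], q as [[a' b'] [c' d']].
  unfold re, im_i, im_j, im_k; cbn; intros; subst; reflexivity.
Qed.

Lemma coord_plus (p q : H) :
  re (p +h q) = re p + re q /\
  im_i (p +h q) = im_i p + im_i q /\
  im_j (p +h q) = im_j p + im_j q /\
  im_k (p +h q) = im_k p + im_k q.
Proof. repeat split. Qed.

Lemma coord_opp (p : H) :
  re (opp p : H) = - re p /\
  im_i (opp p : H) = - im_i p /\
  im_j (opp p : H) = - im_j p /\
  im_k (opp p : H) = - im_k p.
Proof. repeat split. Qed.

Lemma coord_scal (x : R) (p : H) :
  re (scal x p : H) = x * re p /\
  im_i (scal x p : H) = x * im_i p /\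
  im_j (scal x p : H) = x * im_j p /\
  im_k (scal x p : H) = x * im_k p.
Proof. repeat split. Qed.

Lemma coord_zero :
  re (zero : H) = 0 /\ im_i (zero : H) = 0 /\ im_j (zero : H) = 0 /\ im_k (zero : H) = 0.
Proof. repeat split. Qed.

Lemma coord_mkH (a b c d : R) :
  re (mkH a b c d) = a /\
  im_i (mkH a b c d) = b /\
  im_j (mkH a b c d) = c /\
  im_k (mkH a b c d) = d.
Proof. repeat split. Qed.

Lemma coord_conj (p : H) :
  re (Hconj p) = re p /\
  im_i (Hconj p) = - im_i p /\
  im_j (Hconj p) = - im_j p /\
  im_k (Hconj p) = - im_k p.
Proof. repeat split. Qed.

Lemma coord_real (x : R) :
  re (Hreal x) = x /\ im_i (Hreal x) = 0 /\ im_j (Hreal x) = 0 /\ im_k (Hreal x) = 0.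
Proof. repeat split. Qed.

Lemma coord_one :
  re Hone = 1 /\ im_i Hone = 0 /\ im_j Hone = 0 /\ im_k Hone = 0.
Proof. repeat split. Qed.

Lemma coord_mult (p q : H) :
  re (p *h q) = re p * re q - im_i p * im_i q - im_j p * im_j q - im_k p * im_k q /\
  im_i (p *h q) = re p * im_i q + im_i p * re q + im_j p * im_k q - im_k p * im_j q /\
  im_j (p *h q) = re p * im_j q - im_i p * im_k q + im_j p * re q + im_k p * im_i q /\
  im_k (p *h q) = re p * im_k q + im_i p * im_j q - im_j p * im_i q + im_k p * re q.
Proof. repeat split. Qed.

(** The ascription restates each equation for the operation [e] exactly as it occurs in the goal,
    where the implicit algebraic structure may be another, convertible, path to that of [H]. *)
Ltac rewrite_coord c e L :=
  match c with
  | re => rewrite (proj1 L : re e = _)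
  | im_i => rewrite (proj1 (proj2 L) : im_i e = _)
  | im_j => rewrite (proj1 (proj2 (proj2 L)) : im_j e = _)
  | im_k => rewrite (proj2 (proj2 (proj2 L)) : im_k e = _)
  end.

Ltac coord :=
  unfold minus;
  repeat match goal with
  | |- context [?c (@plus ?G ?p ?q)] => rewrite_coord c (@plus G p q) (coord_plus p q)
  | |- context [?c (@opp ?G ?p)] => rewrite_coord c (@opp G p) (coord_opp p)
  | |- context [?c (@scal ?K ?G ?x ?p)] => rewrite_coord c (@scal K G x p) (coord_scal x p)
  | |- context [?c (@zero ?G)] => rewrite_coord c (@zero G) coord_zero
  | |- context [?c (mkH ?x ?y ?z ?t)] => rewrite_coord c (mkH x y z t) (coord_mkH x y z t)
  | |- context [?c (Hconj ?p)] => rewrite_coord c (Hconj p) (coord_conj p)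
  | |- context [?c (Hreal ?x)] => rewrite_coord c (Hreal x) (coord_real x)
  | |- context [?c Hone] => rewrite_coord c Hone coord_one
  | |- context [?c (?p *h ?q)] => rewrite_coord c (p *h q) (coord_mult p q)
  end.

(* [ring] compares atoms up to conversion, which is cheap only for variables. *)
Ltac coord_ring :=
  coord;
  repeat match goal with
  | |- context [re ?p] => generalize (re p)
  | |- context [im_i ?p] => generalize (im_i p)
  | |- context [im_j ?p] => generalize (im_j p)
  | |- context [im_k ?p] => generalize (im_k p)
  end; intros; ring.
Ltac quat := apply H_ext; first [coord_ring | coord].

Lemma Hmult_assoc (p q r : H) : p *h (q *h r) = p *h q *h r.
Proof. quat. Qed.
Lemma Hmult_plus_l (p q r : H) : (p +h q) *h r = p *h r +h q *h r.
Proof. quat. Qed.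
Lemma Hmult_plus_r (p q r : H) : p *h (q +h r) = p *h q +h p *h r.
Proof. quat. Qed.
Lemma Hmult_one_l (p : H) : Hone *h p = p.
Proof. quat. Qed.
Lemma Hmult_one_r (p : H) : p *h Hone = p.
Proof. quat. Qed.
Lemma Hmult_zero_l (p : H) : (zero : H) *h p = zero.
Proof. quat. Qed.
Lemma Hmult_zero_r (p : H) : p *h (zero : H) = zero.
Proof. quat. Qed.
Lemma Hmult_scal_l (x : R) (p q : H) : scal x p *h q = scal x (p *h q).
Proof. quat. Qed.
Lemma Hmult_scal_r (x : R) (p q : H) : p *h scal x q = scal x (p *h q).
Proof. quat. Qed.
Lemma Hmult_real_l (x : R) (p : H) : Hreal x *h p = scal x p.
Proof. quat. Qed.
Lemma Hconj_mult (p q : H) : Hconj (p *h q) = Hconj q *h Hconj p.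
Proof. quat. Qed.
Lemma Hconj_conj (p : H) : Hconj (Hconj p) = p.
Proof. quat. Qed.
Lemma Hconj_plus (p q : H) : Hconj (p +h q) = Hconj p +h Hconj q.
Proof. quat. Qed.

(** * Modulus, inverses and powers *)

Lemma norm_sqr (p : H) :
  norm p ^ 2 = re p ^ 2 + im_i p ^ 2 + im_j p ^ 2 + im_k p ^ 2.
Proof.
  destruct p as [[a b] [c d]].
  change (sqrt (sqrt (Rabs a ^ 2 + Rabs b ^ 2) ^ 2 + sqrt (Rabs c ^ 2 + Rabs d ^ 2) ^ 2) ^ 2
          = a ^ 2 + b ^ 2 + c ^ 2 + d ^ 2).
  assert (A : forall x y, 0 <= x -> 0 <= y -> sqrt (x + y) ^ 2 = x + y)
    by (intros; apply pow2_sqrt; lra).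
  rewrite A by apply pow2_ge_0. rewrite !A by apply pow2_ge_0.
  rewrite !pow2_abs. ring.
Qed.

Lemma norm_nonneg (p : H) : 0 <= norm p.
Proof. apply norm_ge_0. Qed.

Lemma norm_eq_sqr (p : H) (x : R) :
  0 <= x -> re p ^ 2 + im_i p ^ 2 + im_j p ^ 2 + im_k p ^ 2 = x ^ 2 -> norm p = x.
Proof.
  intros Hx E. rewrite <- norm_sqr in E.
  apply Rsqr_inj; try assumption; try apply norm_nonneg. unfold Rsqr. lra.
Qed.

Lemma norm_le_sqr (p : H) (x : R) :
  0 <= x -> re p ^ 2 + im_i p ^ 2 + im_j p ^ 2 + im_k p ^ 2 <= x ^ 2 -> norm p <= x.
Proof.
  intros Hx E. rewrite <- norm_sqr in E.
  apply Rsqr_incr_0_var; try assumption. unfold Rsqr. lra.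
Qed.

Lemma norm_Hmult (p q : H) : norm (p *h q) = norm p * norm q.
Proof.
  apply norm_eq_sqr.
  - apply Rmult_le_pos; apply norm_nonneg.
  - rewrite Rpow_mult_distr, !norm_sqr. coord. ring.
Qed.

Lemma norm_Hreal (x : R) : norm (Hreal x) = Rabs x.
Proof. apply norm_eq_sqr. apply Rabs_pos. rewrite pow2_abs. coord. ring. Qed.

Lemma norm_Hone : norm Hone = 1.
Proof. unfold Hone. rewrite norm_Hreal. apply Rabs_R1. Qed.

Lemma norm_Hconj (p : H) : norm (Hconj p) = norm p.
Proof. apply norm_eq_sqr. apply norm_nonneg. rewrite norm_sqr. coord. ring. Qed.

Lemma norm_scal_H (x : R) (p : H) : norm (scal x p : H) = Rabs x * norm p.
Proof. rewrite <- Hmult_real_l, norm_Hmult, norm_Hreal. reflexivity. Qed.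

Lemma norm_plus_le (p q : H) : norm (p +h q) <= norm p + norm q.
Proof. apply (@norm_triangle R_AbsRing H). Qed.

Lemma norm_minus_ge (p q : H) : norm p - norm q <= norm (p -h q).
Proof.
  assert (E : p = (p -h q) +h q) by quat.
  rewrite E at 1. pose proof (norm_plus_le (p -h q) q). lra.
Qed.

Lemma norm_zero_H : norm (zero : H) = 0.
Proof. apply (@norm_zero R_AbsRing H). Qed.

Lemma norm_eq0 (p : H) : norm p = 0 -> p = zero.
Proof. apply (@norm_eq_zero R_AbsRing H). Qed.

Lemma norm_pos (p : H) : p <> zero -> 0 < norm p.
Proof.
  intros Hp. destruct (norm_nonneg p) as [h | h]; [exact h | ].
  exfalso; apply Hp; apply norm_eq0; auto.
Qed.

Lemma Hpow_norm (q : H) (n : nat) : norm (Hpow q n) = norm q ^ n.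
Proof.
  induction n as [| n IH]; cbn [Hpow pow]. apply norm_Hone.
  rewrite norm_Hmult, IH. reflexivity.
Qed.

Lemma Hmult_conj_r (p : H) : p *h Hconj p = Hreal (norm p ^ 2).
Proof. rewrite norm_sqr. quat. Qed.

Lemma Hmult_conj_l (p : H) : Hconj p *h p = Hreal (norm p ^ 2).
Proof. rewrite norm_sqr. quat. Qed.

Lemma Hinv_r (p : H) : p <> zero -> p *h Hinv p = Hone.
Proof.
  intros Hp. unfold Hinv. rewrite Hmult_scal_r, Hmult_conj_r.
  apply norm_pos in Hp. quat. field. lra.
Qed.

Lemma Hinv_l (p : H) : p <> zero -> Hinv p *h p = Hone.
Proof.
  intros Hp. unfold Hinv. rewrite Hmult_scal_l, Hmult_conj_l.
  apply norm_pos in Hp. quat. field. lra.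
Qed.

Lemma norm_Hinv (p : H) : p <> zero -> norm (Hinv p) = / norm p.
Proof.
  intros Hp. pose proof (norm_pos p Hp) as h.
  apply Rmult_eq_reg_l with (norm p); [| lra].
  rewrite <- norm_Hmult, Hinv_r, norm_Hone by assumption. field. lra.
Qed.

Lemma Hmult_integral (p q : H) : p *h q = zero -> p = zero \/ q = zero.
Proof.
  intros E. assert (F : norm p * norm q = 0) by (rewrite <- norm_Hmult, E; apply norm_zero_H).
  apply Rmult_integral in F. destruct F as [F | F]; [left | right]; apply norm_eq0; exact F.
Qed.

Lemma Hpow_comm (p q : H) (n : nat) : p *h q = q *h p -> p *h Hpow q n = Hpow q n *h p.
Proof.
  intros E. induction n as [| n IH]; cbn [Hpow].
  - rewrite Hmult_one_l, Hmult_one_r. reflexivity.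
  - rewrite Hmult_assoc, E, <- Hmult_assoc, IH, Hmult_assoc. reflexivity.
Qed.

Lemma Hpow_plus (q : H) (m n : nat) : Hpow q (m + n) = Hpow q m *h Hpow q n.
Proof.
  induction m as [| m IH]; cbn [Hpow Nat.add].
  - rewrite Hmult_one_l. reflexivity.
  - rewrite IH, Hmult_assoc. reflexivity.
Qed.

Lemma Hpow_real (x : R) (n : nat) : Hpow (Hreal x) n = Hreal (x ^ n).
Proof. induction n as [| n IH]; cbn [Hpow pow]; [reflexivity |]. rewrite IH. quat. Qed.

Lemma coord_le_norm (p : H) :
  Rabs (re p) <= norm p /\ Rabs (im_i p) <= norm p /\
  Rabs (im_j p) <= norm p /\ Rabs (im_k p) <= norm p.
Proof.
  pose proof (norm_sqr p) as E. pose proof (norm_nonneg p) as h.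
  repeat split; (apply Rsqr_incr_0_var; [| exact h]); rewrite <- Rsqr_abs;
    unfold Rsqr; nra.
Qed.

(** Four squares of size at most x^2 add up to at most (2 x)^2. This is the origin of the factor 2
    in all later estimates of series and integrals. *)
Lemma norm_le_coord (p : H) (x : R) :
  Rabs (re p) <= x -> Rabs (im_i p) <= x -> Rabs (im_j p) <= x -> Rabs (im_k p) <= x ->
  norm p <= 2 * x.
Proof.
  intros h1 h2 h3 h4.
  assert (0 <= x) by (pose proof (Rabs_pos (re p)); lra).
  assert (A : forall y, Rabs y <= x -> y ^ 2 <= x ^ 2)
    by (intros y hy; rewrite <- (pow2_abs y); pose proof (Rabs_pos y); nra).
  apply norm_le_sqr; [lra |].
  apply A in h1; apply A in h2; apply A in h3; apply A in h4. nra.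
Qed.

(** * Series of quaternions *)

Lemma coord_sum_n (u : nat -> H) (n : nat) :
  re (sum_n u n) = sum_n (fun k => re (u k)) n /\
  im_i (sum_n u n) = sum_n (fun k => im_i (u k)) n /\
  im_j (sum_n u n) = sum_n (fun k => im_j (u k)) n /\
  im_k (sum_n u n) = sum_n (fun k => im_k (u k)) n.
Proof.
  induction n as [| n IH]; [rewrite !sum_O; auto |].
  rewrite !sum_Sn. destruct IH as (h1 & h2 & h3 & h4).
  coord. rewrite h1, h2, h3, h4. auto.
Qed.

(** A ball of the product uniform structure is the product of the coordinate balls of the same
    radius, so convergence in [H] is convergence of the four coordinates. *)
Lemma is_series_coord (u : nat -> H) (l : H) :
  is_series u l <->
  is_series (fun n => re (u n)) (re l) /\ is_series (fun n => im_i (u n)) (im_i l) /\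
  is_series (fun n => im_j (u n)) (im_j l) /\ is_series (fun n => im_k (u n)) (im_k l).
Proof.
  unfold is_series. split.
  - intros L.
    assert (P : forall pr : H -> R, (forall (p : H) (e : posreal) q, ball p e q -> ball (pr p) e (pr q)) ->
      filterlim (fun n => pr (sum_n u n)) eventually (locally (pr l))).
    { intros pr hp. apply filterlim_locally. intros e.
      assert (L' := proj1 (filterlim_locally _ _) L e).
      revert L'. apply filter_imp. intros n. apply hp. }
    repeat split; (eapply filterlim_ext; [intros n; apply (coord_sum_n u n) | apply P]);
      intros p e q [[] []]; assumption.
  - intros (h1 & h2 & h3 & h4). apply filterlim_locally. intros e.
    assert (h1' := proj1 (filterlim_locally _ _) h1 e).
    assert (h2' := proj1 (filterlim_locally _ _) h2 e).
    assert (h3' := proj1 (filterlim_locally _ _) h3 e).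
    assert (h4' := proj1 (filterlim_locally _ _) h4 e).
    generalize (filter_and _ _ (filter_and _ _ h1' h2') (filter_and _ _ h3' h4')).
    apply filter_imp. intros n [[k1 k2] [k3 k4]].
    destruct (coord_sum_n u n) as (e1 & e2 & e3 & e4).
    assert (m1 : ball (re l) e (re (sum_n u n))) by (rewrite e1; exact k1).
    assert (m2 : ball (im_i l) e (im_i (sum_n u n))) by (rewrite e2; exact k2).
    assert (m3 : ball (im_j l) e (im_j (sum_n u n))) by (rewrite e3; exact k3).
    assert (m4 : ball (im_k l) e (im_k (sum_n u n))) by (rewrite e4; exact k4).
    split; split; assumption.
Qed.

Lemma HSeries_unique (u : nat -> H) (l : H) : is_series u l -> HSeries u = l.
Proof.
  intros L. apply is_series_coord in L. destruct L as (h1 & h2 & h3 & h4).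
  unfold HSeries. apply H_ext; coord; apply is_series_unique; assumption.
Qed.

Lemma is_series_unique_H (u : nat -> H) (l l' : H) : is_series u l -> is_series u l' -> l = l'.
Proof. intros h h'. apply HSeries_unique in h, h'. congruence. Qed.

Lemma ex_series_geom_dominated (v : nat -> R) (C x : R) :
  0 <= x < 1 -> (forall n, Rabs (v n) <= C * x ^ n) -> ex_series (fun n => Rabs (v n)).
Proof.
  intros hx hv. apply (@ex_series_le R_AbsRing R_CompleteNormedModule) with (fun n => C * x ^ n).
  - intros n. change (Rabs (Rabs (v n)) <= C * x ^ n). rewrite Rabs_Rabsolu. apply hv.
  - apply (@ex_series_scal_l R_AbsRing). exists (/ (1 - x)). apply is_series_geom.
    rewrite Rabs_pos_eq; lra.
Qed.

Lemma is_series_geom_dominated (u : nat -> H) (C x : R) :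
  0 <= x < 1 -> (forall n, norm (u n) <= C * x ^ n) -> is_series u (HSeries u).
Proof.
  intros hx hu. apply is_series_coord. unfold HSeries; coord.
  repeat split; apply Series_correct; apply ex_series_Rabs;
    apply ex_series_geom_dominated with C x; try assumption; intros n;
    (eapply Rle_trans; [apply (coord_le_norm (u n)) | apply hu]).
Qed.

Lemma is_series_terms_bounded (u : nat -> H) (l : H) :
  is_series u l -> exists M, forall n, norm (u n) <= M.
Proof.
  intros L. apply is_series_coord in L. destruct L as (h1 & h2 & h3 & h4).
  assert (B : forall (v : nat -> R) (x : R), is_series v x -> exists M, forall n, Rabs (v n) <= M).
  { intros v x hv. assert (Z : is_lim_seq v 0) by (apply ex_series_lim_0; exists x; exact hv).
    destruct (filterlim_bounded v) as [M hM].
    - exists 0. exact Z.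
    - exists M. exact hM. }
  destruct (B _ _ h1) as [M1 k1], (B _ _ h2) as [M2 k2], (B _ _ h3) as [M3 k3], (B _ _ h4) as [M4 k4].
  exists (2 * (Rabs M1 + Rabs M2 + Rabs M3 + Rabs M4)). intros n.
  pose proof (Rle_abs M1). pose proof (Rle_abs M2). pose proof (Rle_abs M3). pose proof (Rle_abs M4).
  pose proof (Rabs_pos M1). pose proof (Rabs_pos M2). pose proof (Rabs_pos M3). pose proof (Rabs_pos M4).
  specialize (k1 n); specialize (k2 n); specialize (k3 n); specialize (k4 n).
  apply norm_le_coord; lra.
Qed.

(* A crude bound (the sharp constant is 1) obtained coordinatewise. *)
Lemma norm_HSeries_le (u : nat -> H) (C x : R) :
  0 <= x < 1 -> (forall n, norm (u n) <= C * x ^ n) -> norm (HSeries u) <= 2 * (C / (1 - x)).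
Proof.
  intros hx hu.
  assert (A : forall v : nat -> R, (forall n, Rabs (v n) <= norm (u n)) -> Rabs (Series v) <= C / (1 - x)).
  { intros v hv.
    assert (hv' : forall n, Rabs (v n) <= C * x ^ n) by (intros n; eapply Rle_trans; [apply hv | apply hu]).
    eapply Rle_trans; [apply Series_Rabs; apply ex_series_geom_dominated with C x; assumption |].
    apply Rle_trans with (Series (fun n => C * x ^ n)).
    - apply Series_le.
      + intros n; split; [apply Rabs_pos | apply hv'].
      + apply (@ex_series_scal_l R_AbsRing). exists (/ (1 - x)). apply is_series_geom.
          rewrite Rabs_pos_eq; lra.
    - rewrite Series_scal_l, Series_geom by (rewrite Rabs_pos_eq; lra). unfold Rdiv. lra. }
  unfold HSeries. apply norm_le_coord; coord; apply A; intros n; apply (coord_le_norm (u n)).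
Qed.

(** Multiplication by a fixed quaternion, on either side, acts on coordinates by a real 4 x 4
    matrix; this treats one row of such a matrix. *)
Lemma is_series_coord_combination (u : nat -> H) (l : H) (x1 x2 x3 x4 : R) (v : nat -> R) (m : R) :
  is_series u l ->
  (forall n, v n = x1 * re (u n) + x2 * im_i (u n) + x3 * im_j (u n) + x4 * im_k (u n)) ->
  m = x1 * re l + x2 * im_i l + x3 * im_j l + x4 * im_k l ->
  is_series v m.
Proof.
  intros L hv ->. apply is_series_coord in L. destruct L as (h1 & h2 & h3 & h4).
  eapply is_series_ext; [intros n; symmetry; apply hv |].
  pose proof (@is_series_scal_l R_AbsRing R_NormedModule x1 _ _ h1) as k1.
  pose proof (@is_series_scal_l R_AbsRing R_NormedModule x2 _ _ h2) as k2.
  pose proof (@is_series_scal_l R_AbsRing R_NormedModule x3 _ _ h3) as k3.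
  pose proof (@is_series_scal_l R_AbsRing R_NormedModule x4 _ _ h4) as k4.
  exact (is_series_plus _ _ _ _ (is_series_plus _ _ _ _ (is_series_plus _ _ _ _ k1 k2) k3) k4).
Qed.

Lemma is_series_Hmult_l (c : H) (u : nat -> H) (l : H) :
  is_series u l -> is_series (fun n => c *h u n) (c *h l).
Proof.
  intros L. apply is_series_coord. coord. repeat split.
  - apply (is_series_coord_combination _ _ (re c) (- im_i c) (- im_j c) (- im_k c) _ _ L); intros;
      coord; ring.
  - apply (is_series_coord_combination _ _ (im_i c) (re c) (- im_k c) (im_j c) _ _ L); intros; coord; ring.
  - apply (is_series_coord_combination _ _ (im_j c) (im_k c) (re c) (- im_i c) _ _ L); intros; coord; ring.
  - apply (is_series_coord_combination _ _ (im_k c) (- im_j c) (im_i c) (re c) _ _ L); intros; coord; ring.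
Qed.

Lemma is_series_Hmult_r (c : H) (u : nat -> H) (l : H) :
  is_series u l -> is_series (fun n => u n *h c) (l *h c).
Proof.
  intros L. apply is_series_coord. coord. repeat split.
  - apply (is_series_coord_combination _ _ (re c) (- im_i c) (- im_j c) (- im_k c) _ _ L); intros;
      coord; ring.
  - apply (is_series_coord_combination _ _ (im_i c) (re c) (im_k c) (- im_j c) _ _ L); intros; coord; ring.
  - apply (is_series_coord_combination _ _ (im_j c) (- im_k c) (re c) (im_i c) _ _ L); intros; coord; ring.
  - apply (is_series_coord_combination _ _ (im_k c) (im_j c) (- im_i c) (re c) _ _ L); intros; coord; ring.
Qed.

(** * Coefficient sequences *)

(* The coefficients of the regular product. *)
Definition conv (a b : nat -> H) : nat -> H :=
  fun n => sum_n (fun k => a k *h b (n - k)%nat) n.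
Definition splus (a b : nat -> H) : nat -> H := fun n => a n +h b n.
Definition sconj (a : nat -> H) : nat -> H := fun n => Hconj (a n).
Definition tail (a : nat -> H) : nat -> H := fun n => a (S n).
(* The coefficients of c + q d. *)
Definition lin (c d : H) : nat -> H :=
  fun n => match n with O => c | S O => d | _ => zero end.
Definition one : nat -> H := lin Hone zero.

Ltac quat_conv :=
  repeat match goal with |- context [conv ?a ?b ?n] => generalize (conv a b n); intro end; quat.

Lemma conv_0 (a b : nat -> H) : conv a b 0 = a 0%nat *h b 0%nat.
Proof. unfold conv. rewrite sum_O. reflexivity. Qed.

Lemma conv_S (a b : nat -> H) (n : nat) :
  conv a b (S n) = a 0%nat *h b (S n) +h conv (tail a) b n.
Proof.
  unfold conv, sum_n. rewrite sum_Sn_m by lia. rewrite <- sum_n_m_S. reflexivity.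
Qed.

(** Splits off the last term where [conv_S] splits off the first. Exchanging the two factors
    reverses the sum, so inductions on conjugates or on commutation peel the two sides at opposite
    ends. *)
Lemma conv_S_r (a b : nat -> H) (n : nat) :
  conv a b (S n) = conv a (tail b) n +h a (S n) *h b 0%nat.
Proof.
  unfold conv. rewrite sum_Sn, Nat.sub_diag. f_equal.
  apply sum_n_ext_loc. intros k hk. unfold tail. do 2 f_equal. lia.
Qed.

Lemma conv_splus_l (a b c : nat -> H) : conv (splus a b) c = splus (conv a c) (conv b c).
Proof.
  apply functional_extensionality. intros n. revert a b.
  induction n as [| n IH]; intros a b; unfold splus.
  - rewrite !conv_0. apply Hmult_plus_l.
  - rewrite !conv_S. change (tail (fun k => a k +h b k)) with (splus (tail a) (tail b)).
    rewrite IH. unfold splus. quat_conv.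
Qed.

Lemma conv_splus_r (a b c : nat -> H) : conv a (splus b c) = splus (conv a b) (conv a c).
Proof.
  apply functional_extensionality. intros n. revert a.
  induction n as [| n IH]; intros a; unfold splus.
  - rewrite !conv_0. apply Hmult_plus_r.
  - rewrite !conv_S. change (fun k => b k +h c k) with (splus b c).
    rewrite IH. unfold splus. quat_conv.
Qed.

Lemma conv_scale_l (c : H) (a b : nat -> H) (n : nat) :
  conv (fun k => c *h a k) b n = c *h conv a b n.
Proof.
  revert a; induction n as [| n IH]; intros a.
  - rewrite !conv_0. symmetry; apply Hmult_assoc.
  - rewrite !conv_S. change (tail (fun k => c *h a k)) with (fun k => c *h tail a k).
    rewrite IH. quat_conv.
Qed.

Lemma tail_conv (a b : nat -> H) :
  tail (conv a b) = splus (fun n => a 0%nat *h tail b n) (conv (tail a) b).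
Proof. apply functional_extensionality. intros n. apply conv_S. Qed.

Lemma conv_assoc (a b c : nat -> H) : conv (conv a b) c = conv a (conv b c).
Proof.
  apply functional_extensionality. intros n. revert a b c.
  induction n as [| n IH]; intros a b c.
  - rewrite !conv_0. symmetry; apply Hmult_assoc.
  - rewrite (conv_S (conv a b)), (conv_S a (conv b c)), (conv_S b c), conv_0, tail_conv, conv_splus_l.
    unfold splus. rewrite conv_scale_l, IH. quat_conv.
Qed.

Lemma conv_lin_0 (c d : H) (b : nat -> H) : conv (lin c d) b 0 = c *h b 0%nat.
Proof. apply conv_0. Qed.

Lemma conv_zero_l (b : nat -> H) (n : nat) : conv (fun _ => zero) b n = zero.
Proof.
  induction n as [| n IH].
  - rewrite conv_0. apply Hmult_zero_l.
  - rewrite conv_S. change (tail (fun _ => zero)) with (fun _ : nat => zero : H). rewrite IH. quat_conv.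
Qed.

Lemma conv_lin_S (c d : H) (b : nat -> H) (n : nat) :
  conv (lin c d) b (S n) = c *h b (S n) +h d *h b n.
Proof.
  rewrite conv_S. f_equal. destruct n as [| n]; [apply conv_0 |].
  rewrite conv_S. change (tail (tail (lin c d))) with (fun _ : nat => zero : H).
  rewrite conv_zero_l. change (tail (lin c d) 0%nat) with d. quat_conv.
Qed.

Lemma conv_const_l (c : H) (b : nat -> H) : conv (lin c zero) b = fun n => c *h b n.
Proof.
  apply functional_extensionality. intros [| n].
  - apply conv_0.
  - rewrite conv_lin_S, Hmult_zero_l. quat_conv.
Qed.

Lemma conv_one_l (b : nat -> H) : conv one b = b.
Proof.
  unfold one. rewrite conv_const_l. apply functional_extensionality. intros n. apply Hmult_one_l.
Qed.

Lemma sconj_conv (a b : nat -> H) : sconj (conv a b) = conv (sconj b) (sconj a).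
Proof.
  apply functional_extensionality. intros n. revert b.
  induction n as [| n IH]; intros b.
  - unfold sconj at 1. rewrite !conv_0. apply Hconj_mult.
  - change (sconj (conv a b) (S n)) with (Hconj (conv a b (S n))).
    rewrite conv_S_r, conv_S, Hconj_plus, Hconj_mult.
    change (Hconj (conv a (tail b) n)) with (sconj (conv a (tail b)) n). rewrite IH.
    apply (@plus_comm H).
Qed.

Lemma sconj_sconj (a : nat -> H) : sconj (sconj a) = a.
Proof. apply functional_extensionality. intros n. apply Hconj_conj. Qed.

Lemma sconj_one : sconj one = one.
Proof.
  apply functional_extensionality. intros [| [| n]]; unfold sconj; cbn [one lin]; quat_conv.
Qed.

(** Conjugation reverses products and thereby reduces this to [conv_const_l]. *)
Lemma conv_const_r (c : H) (b : nat -> H) : conv b (lin c zero) = fun n => b n *h c.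
Proof.
  rewrite <- (sconj_sconj (conv b _)), sconj_conv.
  assert (E : sconj (lin c zero) = lin (Hconj c) zero).
  { apply functional_extensionality. intros [| [| n]]; unfold sconj; cbn [lin]; quat_conv. }
  rewrite E, conv_const_l. apply functional_extensionality. intros n. unfold sconj. quat_conv.
Qed.

Lemma conv_one_r (b : nat -> H) : conv b one = b.
Proof.
  unfold one. rewrite conv_const_r. apply functional_extensionality. intros n. apply Hmult_one_r.
Qed.

Lemma conv_comm (a b : nat -> H) :
  (forall m n, a m *h b n = b n *h a m) -> conv a b = conv b a.
Proof.
  intros hab. apply functional_extensionality. intros n. revert a hab.
  induction n as [| n IH]; intros a hab.
  - rewrite !conv_0. apply hab.
  - rewrite conv_S, conv_S_r, IH, hab by (intros; apply hab). quat_conv.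
Qed.

(** * Power series converging on the unit ball *)

Lemma ratio_lt_1 (x y : R) : 0 <= x < y -> 0 <= x / y < 1.
Proof.
  intros h. split.
  - apply Rmult_le_pos; [lra |]. left; apply Rinv_0_lt_compat; lra.
  - apply Rmult_lt_reg_r with y; [lra |]. field_simplify; lra.
Qed.

(* Equivalently, the power series with coefficients a converges on the unit ball. *)
Definition tame (a : nat -> H) : Prop :=
  forall r, 0 <= r < 1 -> exists M, forall n, norm (a n) * r ^ n <= M.

(** Boundedness at a radius s between r and 1 becomes geometric decay of ratio r / s at the radius
    r. *)
Lemma tame_geom (a : nat -> H) (r : R) :
  tame a -> 0 <= r < 1 ->
  exists C x, 0 <= C /\ 0 <= x < 1 /\ forall n, norm (a n) * r ^ n <= C * x ^ n.
Proof.
  intros ha hr. set (s := (1 + r) / 2).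
  assert (hs : 0 < s < 1) by (unfold s; lra).
  assert (hrs : r < s) by (unfold s; lra).
  destruct (ha s) as [M hM]; [lra |].
  assert (hx : 0 <= r / s < 1) by (apply ratio_lt_1; lra).
  exists M, (r / s). split; [| split; [exact hx |]].
  - apply Rle_trans with (2 := hM 0%nat). apply Rmult_le_pos; [apply norm_nonneg |]. apply pow_le; lra.
  - intros n. replace (r ^ n) with (s ^ n * (r / s) ^ n).
    + rewrite <- Rmult_assoc. apply Rmult_le_compat_r; [apply pow_le; lra | apply hM].
    + rewrite <- Rpow_mult_distr. f_equal. field; lra.
Qed.

Lemma tame_terms (a : nat -> H) (q : H) :
  tame a -> norm q < 1 ->
  exists C x, 0 <= C /\ 0 <= x < 1 /\ forall n, norm (Hpow q n *h a n) <= C * x ^ n.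
Proof.
  intros ha hq. destruct (tame_geom a (norm q) ha) as (C & x & hC & hx & h).
  { split; [apply norm_nonneg | exact hq]. }
  exists C, x. repeat split; try assumption; try lra. intros n.
  rewrite norm_Hmult, Hpow_norm, Rmult_comm. apply h.
Qed.

Lemma tame_eval (a : nat -> H) (q : H) :
  tame a -> norm q < 1 -> is_series (fun n => Hpow q n *h a n) (HPSeries a q).
Proof.
  intros ha hq. destruct (tame_terms a q ha hq) as (C & x & _ & hx & h).
  apply is_series_geom_dominated with C x; assumption.
Qed.

(** The real points r suffice: the terms r^n a_n of a convergent series are bounded. The closure
    properties of [tame] are obtained from this by exhibiting sums. *)
Lemma tame_of_series (a : nat -> H) :
  (forall q : H, norm q < 1 -> exists l : H, is_series (fun n => Hpow q n *h a n) l) -> tame a.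
Proof.
  intros h r hr. destruct (h (Hreal r)) as [l hl].
  { rewrite norm_Hreal, Rabs_pos_eq; lra. }
  destruct (is_series_terms_bounded _ _ hl) as [M hM]. exists M. intros n. specialize (hM n).
  rewrite norm_Hmult, Hpow_norm, norm_Hreal, Rabs_pos_eq in hM by lra. lra.
Qed.

Lemma is_series_plus_H (u v : nat -> H) (l m : H) :
  is_series u l -> is_series v m -> is_series (fun n => u n +h v n) (l +h m).
Proof. apply (@is_series_plus R_AbsRing H). Qed.

Lemma is_series_scal_H (x : R) (u : nat -> H) (l : H) :
  is_series u l -> is_series (fun n => scal x (u n) : H) (scal x l).
Proof. apply (@is_series_scal_l R_AbsRing H). Qed.

Lemma is_series_scal_cauchy (v : nat -> R) (V : R) (w : nat -> H) (W : H) (C D x y : R) :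
  0 <= x < 1 -> 0 <= y < 1 ->
  (forall n, Rabs (v n) <= C * x ^ n) -> (forall n, norm (w n) <= D * y ^ n) ->
  is_series v V -> is_series w W ->
  is_series (fun n => sum_n (fun k => scal (v k) (w (n - k)%nat) : H) n) (scal V W : H).
Proof.
  intros hx hy hv hw sv sw. apply is_series_coord in sw. destruct sw as (h1 & h2 & h3 & h4).
  assert (P : forall (z : nat -> R) (Z : R), (forall n, Rabs (z n) <= norm (w n)) -> is_series z Z ->
     is_series (fun n => sum_n (fun k => v k * z (n - k)%nat) n) (V * Z)).
  { intros z Z hz sz. eapply is_series_ext; [intros n; symmetry; apply sum_n_Reals |].
    apply is_series_mult; try assumption.
    - apply ex_series_geom_dominated with C x; assumption.
    - apply ex_series_geom_dominated with D y; try assumption.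
      intros n. eapply Rle_trans; [apply hz | apply hw]. }
  apply is_series_coord. coord.
  repeat split; (eapply is_series_ext; [| apply P; [| eassumption]; intros n; apply (coord_le_norm (w n))]);
    intros n; symmetry; apply (coord_sum_n (fun k => scal (v k) (w (n - k)%nat) : H) n).
Qed.

Lemma sum_n_plus_H (u v : nat -> H) (n : nat) :
  sum_n (fun k => u k +h v k) n = sum_n u n +h sum_n v n.
Proof. apply (@sum_n_plus H). Qed.

Lemma sum_n_Hmult_l (c : H) (u : nat -> H) (n : nat) :
  sum_n (fun k => c *h u k) n = c *h sum_n u n.
Proof.
  induction n as [| n IH]; [rewrite !sum_O; reflexivity |].
  rewrite !sum_Sn, IH. symmetry; apply Hmult_plus_r.
Qed.

(* The n-th term is the Cauchy product of [k |-> q^k a_k] with [m |-> (u |-> q^m u b_m)];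
   splitting [u] into its four coordinates gives four real-by-vector Cauchy products. *)
Lemma is_series_conv (a b : nat -> H) (q : H) :
  tame a -> tame b -> norm q < 1 ->
  is_series (fun n => Hpow q n *h conv a b n)
    (HSeries (fun m => Hpow q m *h HPSeries a q *h b m)).
Proof.
  intros ha hb hq.
  destruct (tame_terms a q ha hq) as (C & x & hC & hx & hu).
  destruct (tame_terms b q hb hq) as (D & y & hD & hy & hv).
  pose proof (tame_eval a q ha hq) as su.
  set (u := fun n => Hpow q n *h a n) in *. set (U := HPSeries a q) in *.
  assert (W : forall e : H, norm e = 1 ->
     (forall n, norm (Hpow q n *h e *h b n) <= D * y ^ n) /\
     is_series (fun n => Hpow q n *h e *h b n) (HSeries (fun n => Hpow q n *h e *h b n))).
  { intros e he.
    assert (hw : forall n, norm (Hpow q n *h e *h b n) <= D * y ^ n).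
    { intros n. specialize (hv n). rewrite norm_Hmult in hv |- *. rewrite norm_Hmult, he. lra. }
    split; [exact hw |]. apply is_series_geom_dominated with D y; assumption. }
  set (e1 := mkH 1 0 0 0). set (e2 := mkH 0 1 0 0). set (e3 := mkH 0 0 1 0). set (e4 := mkH 0 0 0 1).
  assert (n1 : norm e1 = 1) by (apply norm_eq_sqr; [lra |]; unfold e1; coord; ring).
  assert (n2 : norm e2 = 1) by (apply norm_eq_sqr; [lra |]; unfold e2; coord; ring).
  assert (n3 : norm e3 = 1) by (apply norm_eq_sqr; [lra |]; unfold e3; coord; ring).
  assert (n4 : norm e4 = 1) by (apply norm_eq_sqr; [lra |]; unfold e4; coord; ring).
  assert (split4 : forall p r s : H, p *h r *h s =
     scal (re r) (p *h e1 *h s) +h scal (im_i r) (p *h e2 *h s) +h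
     scal (im_j r) (p *h e3 *h s) +h scal (im_k r) (p *h e4 *h s)).
  { intros p r s. unfold e1, e2, e3, e4. quat. }
  destruct (W e1 n1) as [b1 w1], (W e2 n2) as [b2 w2], (W e3 n3) as [b3 w3], (W e4 n4) as [b4 w4].
  destruct (proj1 (is_series_coord u U) su) as (u1 & u2 & u3 & u4).
  assert (c : forall n, Rabs (re (u n)) <= C * x ^ n /\ Rabs (im_i (u n)) <= C * x ^ n /\
     Rabs (im_j (u n)) <= C * x ^ n /\ Rabs (im_k (u n)) <= C * x ^ n).
  { intros n. destruct (coord_le_norm (u n)) as (g1 & g2 & g3 & g4).
    repeat split; (eapply Rle_trans; [eassumption | apply hu]). }
  assert (c1 := fun n => proj1 (c n)). assert (c2 := fun n => proj1 (proj2 (c n))).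
  assert (c3 := fun n => proj1 (proj2 (proj2 (c n)))). assert (c4 := fun n => proj2 (proj2 (proj2 (c n)))).
  pose proof (is_series_scal_cauchy _ _ _ _ C D x y hx hy c1 b1 u1 w1) as s1.
  pose proof (is_series_scal_cauchy _ _ _ _ C D x y hx hy c2 b2 u2 w2) as s2.
  pose proof (is_series_scal_cauchy _ _ _ _ C D x y hx hy c3 b3 u3 w3) as s3.
  pose proof (is_series_scal_cauchy _ _ _ _ C D x y hx hy c4 b4 u4 w4) as s4.
  pose proof (is_series_plus_H _ _ _ _ (is_series_plus_H _ _ _ _ (is_series_plus_H _ _ _ _ s1 s2) s3)
    s4) as s.
  assert (E : HSeries (fun m => Hpow q m *h U *h b m) =
     scal (re U) (HSeries (fun n => Hpow q n *h e1 *h b n)) +h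
     scal (im_i U) (HSeries (fun n => Hpow q n *h e2 *h b n)) +h
     scal (im_j U) (HSeries (fun n => Hpow q n *h e3 *h b n)) +h
     scal (im_k U) (HSeries (fun n => Hpow q n *h e4 *h b n))).
  { apply HSeries_unique.
    eapply is_series_ext; [intros n; symmetry; apply split4 |].
    apply is_series_plus_H; [apply is_series_plus_H; [apply is_series_plus_H |] |];
      apply is_series_scal_H; assumption. }
  rewrite E. eapply is_series_ext; [| exact s].
  intros n. cbv beta. rewrite <- !sum_n_plus_H. unfold conv. rewrite <- sum_n_Hmult_l.
  apply sum_n_ext_loc. intros k hk. rewrite <- split4. unfold u.
  (* The power q^(n-k) comes first because the Cauchy product places q^k a_k between q^(n-k) and
     b_(n-k). *)
  assert (En : Hpow q n = Hpow q (n - k) *h Hpow q k) by (rewrite <- Hpow_plus; f_equal; lia).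
  rewrite En.
  rewrite !Hmult_assoc. reflexivity.
Qed.

Lemma tame_conv (a b : nat -> H) : tame a -> tame b -> tame (conv a b).
Proof.
  intros ha hb. apply tame_of_series. intros q hq. eexists. apply is_series_conv; assumption.
Qed.

(** The condition carries every power of q through the value of a: q^m a(q) = a(q) p^m. Stated
    without an inverse, it also covers a(q) = 0, where any p will do, and a real value a(q), where p
    = q is allowed. *)
Lemma eval_conv (a b : nat -> H) (q p : H) :
  tame a -> tame b -> norm q < 1 -> norm p < 1 ->
  q *h HPSeries a q = HPSeries a q *h p ->
  HPSeries (conv a b) q = HPSeries a q *h HPSeries b p.
Proof.
  intros ha hb hq hp E. unfold HPSeries at 1.
  rewrite (HSeries_unique _ _ (is_series_conv a b q ha hb hq)).
  apply HSeries_unique.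
  assert (P : forall m, Hpow q m *h HPSeries a q = HPSeries a q *h Hpow p m).
  { induction m as [| m IH]; cbn [Hpow].
    - rewrite Hmult_one_l, Hmult_one_r. reflexivity.
    - rewrite <- Hmult_assoc, IH, !Hmult_assoc, E. reflexivity. }
  apply is_series_ext with (fun m => HPSeries a q *h (Hpow p m *h b m)).
  - intros m. rewrite P, Hmult_assoc. reflexivity.
  - apply is_series_Hmult_l. apply tame_eval; assumption.
Qed.

Lemma conjugate_exists (alpha q : H) : exists p, norm p = norm q /\ q *h alpha = alpha *h p.
Proof.
  destruct (classic (alpha = zero)) as [-> | ha].
  - exists q. rewrite Hmult_zero_l, Hmult_zero_r. auto.
  - exists (Hinv alpha *h q *h alpha). split.
    + rewrite !norm_Hmult, norm_Hinv by exact ha. apply norm_pos in ha. field; lra.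
    + rewrite !Hmult_assoc, Hinv_r, Hmult_one_l by exact ha. reflexivity.
Qed.

Lemma is_series_lin (c d q : H) : is_series (fun n => Hpow q n *h lin c d n) (c +h q *h d).
Proof.
  unfold is_series.
  apply filterlim_ext_loc with (fun _ : nat => c +h q *h d); [| apply filterlim_const].
  exists 1%nat. intros n hn. induction hn as [| n hn IH].
  - rewrite sum_Sn, sum_O. cbn [Hpow lin]. quat.
  - rewrite sum_Sn, <- IH. destruct n as [| n]; [lia |]. cbn [lin]. quat.
Qed.

Lemma eval_lin (c d q : H) : HPSeries (lin c d) q = c +h q *h d.
Proof. apply HSeries_unique, is_series_lin. Qed.

Lemma tame_lin (c d : H) : tame (lin c d).
Proof. apply tame_of_series. intros q _. eexists. apply is_series_lin. Qed.

Lemma tame_splus (a b : nat -> H) : tame a -> tame b -> tame (splus a b).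
Proof.
  intros ha hb. apply tame_of_series. intros q hq. exists (HPSeries a q +h HPSeries b q).
  eapply is_series_ext; [intros n; symmetry; apply Hmult_plus_r |].
  apply is_series_plus_H; apply tame_eval; assumption.
Qed.

Lemma eval_splus (a b : nat -> H) (q : H) :
  tame a -> tame b -> norm q < 1 -> HPSeries (splus a b) q = HPSeries a q +h HPSeries b q.
Proof.
  intros ha hb hq. apply HSeries_unique.
  eapply is_series_ext; [intros n; symmetry; apply Hmult_plus_r |].
  apply is_series_plus_H; apply tame_eval; assumption.
Qed.

Lemma tame_norm_le (a b : nat -> H) (c : R) :
  0 <= c -> (forall n, norm (a n) <= c * norm (b n)) -> tame b -> tame a.
Proof.
  intros hc hab hb r hr. destruct (hb r hr) as [M hM]. exists (c * M). intros n.
  specialize (hab n). specialize (hM n). assert (0 <= r ^ n) by (apply pow_le; lra). nra.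
Qed.

Lemma tame_sconj (a : nat -> H) : tame a -> tame (sconj a).
Proof.
  apply tame_norm_le with 1; [lra |]. intros n. unfold sconj. rewrite norm_Hconj. lra.
Qed.

(** * Uniqueness of coefficients; functions and their expansions *)

Lemma PSeries_coord_unique (u v : nat -> R) (delta : R) (n : nat) :
  0 < delta ->
  (forall x, Rabs x < delta -> exists l, is_series (fun n => x ^ n * u n) l /\ is_series (fun n => x ^
    n * v n) l) ->
  u n = v n.
Proof.
  intros hd h.
  (* Convergence at the single point delta / 2 bounds the terms there, so the radius of convergence
     is at least delta / 2. *)
  assert (R0 : forall w : nat -> R, (exists l : R, is_series (fun n => (delta / 2) ^ n * w n) l) ->
    Rbar_lt 0 (CV_radius w)).
  { intros w [l hl]. apply Rbar_lt_le_trans with (delta / 2); [cbn; lra |].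
    apply CV_radius_bounded.
    destruct (filterlim_bounded (fun n => (delta / 2) ^ n * w n)) as [M hM].
    - exists 0. apply ex_series_lim_0. exists l. exact hl.
    - exists M. intros k. rewrite Rmult_comm. apply hM. }
  destruct (h (delta / 2)) as [l [hu hv]]; [rewrite Rabs_pos_eq; lra |].
  apply PSeries_ext_recip.
  - apply R0. exists l; exact hu.
  - apply R0. exists l; exact hv.
  - exists (mkposreal delta hd). intros x hx.
    assert (hx' : Rabs x < delta).
    { change (Rabs (x - 0) < delta) in hx. rewrite Rminus_0_r in hx. exact hx. }
    destruct (h x hx') as [m [hu' hv']]. unfold PSeries.
    rewrite (is_series_unique (fun k => u k * x ^ k) m), (is_series_unique (fun k => v k * x ^ k) m);
      [reflexivity | |].
    + eapply is_series_ext; [| exact hv']. intros k; apply Rmult_comm.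
    + eapply is_series_ext; [| exact hu']. intros k; apply Rmult_comm.
Qed.

(** At real points the powers are real scalars, so the claim splits into four real power series.
    Only a real interval around 0 is used: it is common to all slices, which will identify the
    coefficients found on different slices. *)
Lemma power_series_unique (a b : nat -> H) (delta : R) :
  0 < delta ->
  (forall x, Rabs x < delta -> exists l : H,
     is_series (fun n => Hpow (Hreal x) n *h a n) l /\ is_series (fun n => Hpow (Hreal x) n *h b n) l) ->
  a = b.
Proof.
  intros hd h. apply functional_extensionality. intros n.
  assert (h' : forall x, Rabs x < delta -> exists l : H,
     is_series (fun n => scal (x ^ n) (a n) : H) l /\ is_series (fun n => scal (x ^ n) (b n) : H) l).
  { intros x hx. destruct (h x hx) as [l [h1 h2]]. exists l.
    split; [eapply is_series_ext; [| exact h1] | eapply is_series_ext; [| exact h2]];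
      intros k; cbv beta; rewrite Hpow_real; apply Hmult_real_l. }
  assert (P : forall pr : H -> R,
     (forall (u : nat -> H) (l : H), is_series u l -> is_series (fun k => pr (u k)) (pr l)) ->
     (forall x (p : H), pr (scal x p) = x * pr p) -> pr (a n) = pr (b n)).
  { intros pr hs hl. apply (PSeries_coord_unique (fun k => pr (a k)) (fun k => pr (b k)) delta n hd).
    intros x hx. destruct (h' x hx) as [l [h1 h2]]. exists (pr l). apply hs in h1, h2.
    split; [eapply is_series_ext; [| exact h1] | eapply is_series_ext; [| exact h2]]; intros k; apply hl. }
  apply H_ext; apply P; try reflexivity; intros u l L; apply is_series_coord in L; apply L.
Qed.

Lemma expansion_tame (f : H -> H) (a : nat -> H) : expansion f a -> tame a.
Proof. intros ha. apply tame_of_series. intros q hq. exists (f q). apply ha, hq. Qed.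

Lemma expansion_eval (f : H -> H) (a : nat -> H) (q : H) :
  expansion f a -> norm q < 1 -> HPSeries a q = f q.
Proof. intros ha hq. apply HSeries_unique, ha, hq. Qed.

Lemma tame_expansion (a : nat -> H) : tame a -> expansion (HPSeries a) a.
Proof. intros ha q hq. apply tame_eval; assumption. Qed.

Lemma expansion_unique (f : H -> H) (a b : nat -> H) : expansion f a -> expansion f b -> a = b.
Proof.
  intros ha hb. apply power_series_unique with 1; [lra |]. intros x hx. exists (f (Hreal x)).
  split; [apply ha | apply hb]; unfold ball1; rewrite norm_Hreal; exact hx.
Qed.

(** The existence of one expansion makes the choice in [coef] an expansion as well, and uniqueness
    then determines it. *)
Lemma coef_expansion (f : H -> H) (a : nat -> H) : expansion f a -> coef f = a.
Proof.
  intros ha. apply expansion_unique with f; [| exact ha].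
  unfold coef. apply epsilon_spec. exists a. exact ha.
Qed.

Lemma expansion_ext (f g : H -> H) (a : nat -> H) :
  (forall q, ball1 q -> f q = g q) -> expansion f a -> expansion g a.
Proof. intros E ha q hq. rewrite <- E by exact hq. apply ha, hq. Qed.

Lemma expansion_star (f g : H -> H) (a b : nat -> H) :
  expansion f a -> expansion g b -> expansion (star f g) (conv a b).
Proof.
  intros ha hb. unfold star. rewrite (coef_expansion f a ha), (coef_expansion g b hb).
  apply tame_expansion. apply tame_conv; eapply expansion_tame; eassumption.
Qed.

(** * Slice derivatives of power series *)

Lemma sphere_spec (I : H) : sphere I -> re I = 0 /\ norm I = 1.
Proof.
  intros hI. unfold sphere in hI.
  pose proof (f_equal re hI) as e1. pose proof (f_equal im_i hI) as e2.
  pose proof (f_equal im_j hI) as e3. pose proof (f_equal im_k hI) as e4.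
  revert e1 e2 e3 e4. coord. intros e1 e2 e3 e4.
  assert (h0 : re I = 0).
  (* The imaginary coordinates of I I are 2 re(I) times those of I. If re(I) were nonzero, I would
     be real, and a real square is not -1. *)
  { destruct (Req_dec (re I) 0) as [h | h]; [exact h | exfalso].
    assert (im_i I = 0) by (apply (Rmult_eq_reg_l (re I)); [lra | exact h]).
    assert (im_j I = 0) by (apply (Rmult_eq_reg_l (re I)); [lra | exact h]).
    assert (im_k I = 0) by (apply (Rmult_eq_reg_l (re I)); [lra | exact h]).
    nra. }
  split; [exact h0 |]. apply norm_eq_sqr; [lra |]. rewrite h0 in *. nra.
Qed.

Lemma norm_slice (I : H) (x y : R) : sphere I -> norm (slice I x y) = sqrt (x ^ 2 + y ^ 2).
Proof.
  intros hI. destruct (sphere_spec I hI) as [h0 h1].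
  apply norm_eq_sqr; [apply sqrt_pos |].
  rewrite pow2_sqrt by nra. pose proof (norm_sqr I) as e. rewrite h1, h0 in e.
  unfold slice. coord. rewrite h0. nra.
Qed.

Lemma norm_slice_le (I : H) (x y : R) : sphere I -> norm (slice I x y) <= Rabs x + Rabs y.
Proof.
  intros hI. unfold slice. eapply Rle_trans; [apply norm_plus_le |].
  rewrite norm_Hreal, norm_scal_H, (proj2 (sphere_spec I hI)). lra.
Qed.

Lemma slice_comm (I : H) (x y u v : R) : slice I x y *h slice I u v = slice I u v *h slice I x y.
Proof. unfold slice. quat. Qed.

Lemma slice_minus (I : H) (x y u v : R) : slice I x y -h slice I u v = slice I (x - u) (y - v).
Proof. unfold slice. quat. Qed.

Lemma slice_decomposition (q : H) : sphere (dir q) /\ q = slice (dir q) (re q) (norm (vec q)).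
Proof.
  unfold dir. pose proof (norm_sqr (vec q)) as e. unfold vec in e at 2 3 4 5. revert e. coord. intros e.
  destruct (Req_EM_T (norm (vec q)) 0) as [h | h].
  - split; [unfold sphere; quat |]. rewrite h in *. unfold slice.
    assert (im_i q = 0) by nra. assert (im_j q = 0) by nra. assert (im_k q = 0) by nra.
    apply H_ext; coord; lra.
  - split.
    + unfold sphere. rewrite Hmult_scal_l, Hmult_scal_r.
      assert (E : vec q *h vec q = scal (- norm (vec q) ^ 2) Hone) by (rewrite e; unfold vec; quat).
      rewrite E. quat. field; exact h.
    + unfold slice. generalize dependent (norm (vec q)). intros y _ hy. unfold vec.
      apply H_ext; coord; field; exact hy.
Qed.

Definition der (a : nat -> H) : nat -> H := fun n => scal (INR (S n)) (a (S n)).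

(** With p = x / y, each of the n + 1 terms of 1 + p + ... + p^n is at least p^n, whence (n + 1) p^n
    <= 1 / (1 - p). *)
Lemma linear_times_geom (x y : R) :
  0 <= x < y -> exists C, 0 <= C /\ forall n, INR (S n) * x ^ n <= C * y ^ n.
Proof.
  intros hxy. set (p := x / y).
  assert (hp : 0 <= p < 1) by (apply ratio_lt_1; exact hxy).
  exists (/ (1 - p)). split; [left; apply Rinv_0_lt_compat; lra |].
  assert (B : forall n, INR (S n) * p ^ n * (1 - p) <= 1 - p ^ S n).
  { induction n as [| n IH]; [cbn; lra |].
    assert (hn : 0 <= p ^ S n <= 1).
    { split; [apply pow_le; lra |]. rewrite <- (pow1 (S n)). apply pow_incr; lra. }
    rewrite S_INR. set (m := INR (S n)) in *. change (p ^ S (S n)) with (p * p ^ S n).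
    change (p ^ S n) with (p * p ^ n) in *. nra. }
  intros n. specialize (B n).
  replace (x ^ n) with (p ^ n * y ^ n) by (rewrite <- Rpow_mult_distr; f_equal; unfold p; field; lra).
  rewrite <- Rmult_assoc. apply Rmult_le_compat_r; [apply pow_le; lra |].
  apply Rmult_le_reg_r with (1 - p); [lra |]. rewrite Rinv_l by lra.
  assert (0 <= p ^ S n) by (apply pow_le; lra). lra.
Qed.

Lemma tame_der (a : nat -> H) : tame a -> tame (der a).
Proof.
  intros ha r hr. set (s := (1 + r) / 2). assert (hs : r < s < 1) by (unfold s; lra).
  destruct (linear_times_geom r s) as (C & hC & h); [lra |].
  destruct (ha s) as [M hM]; [lra |].
  exists (C * (M / s)). intros n. unfold der. rewrite norm_scal_H, Rabs_pos_eq by apply pos_INR.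
  specialize (h n). specialize (hM (S n)). cbn [pow] in hM.
  pose proof (norm_nonneg (a (S n))) as hn.
  assert (E : norm (a (S n)) * s ^ n <= M / s).
  { apply Rmult_le_reg_r with s; [lra |]. replace (M / s * s) with M by (field; lra). lra. }
  apply Rle_trans with (norm (a (S n)) * (C * s ^ n)); nra.
Qed.

(** The second-order Taylor remainder of q^n at z, for h commuting with z. At n = 0 the factor
    [INR n] removes the spurious power [pred 0]. *)
Definition pow_remainder (z h : H) (n : nat) : H :=
  Hpow (z +h h) n -h Hpow z n -h scal (INR n) (h *h Hpow z (pred n)).

(** The remainders satisfy R_(n+1) = (z + h) R_n + n h h z^(n-1), and n^2 + n <= (n + 1)^2. The
    factor r^2 on the left avoids the exponent n - 2. *)
Lemma pow_remainder_bound (z h : H) (r : R) (n : nat) :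
  z *h h = h *h z -> norm z <= r -> norm (z +h h) <= r ->
  norm (pow_remainder z h n) * r ^ 2 <= INR n ^ 2 * r ^ n * norm h ^ 2.
Proof.
  intros E hz hzh. assert (hr : 0 <= r) by (pose proof (norm_nonneg z); lra).
  induction n as [| n IH].
  - assert (E0 : pow_remainder z h 0 = zero) by (unfold pow_remainder; cbn [Hpow pred INR]; quat).
    rewrite E0, norm_zero_H. cbn; lra.
  - assert (R : pow_remainder z h (S n) =
       (z +h h) *h pow_remainder z h n +h scal (INR n) (h *h (h *h Hpow z (pred n)))).
    { unfold pow_remainder. rewrite S_INR. destruct n as [| n]; [cbn [Hpow pred INR]; quat |].
      cbn [pred]. change (Hpow (z +h h) (S (S n))) with ((z +h h) *h Hpow (z +h h) (S n)).
      change (Hpow z (S (S n))) with (z *h Hpow z (S n)).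
      change (Hpow z (S n)) with (z *h Hpow z n).
      assert (E' : z *h (h *h Hpow z n) = h *h (z *h Hpow z n)) by (rewrite !Hmult_assoc, E; reflexivity).
      generalize dependent (Hpow z n). generalize (Hpow (z +h h) (S n)). generalize (INR (S n)).
      intros m X Z E'.
      assert (D : forall u v : H, u = v -> scal m (u -h v) = zero) by (intros u v ->; quat).
      apply D in E'.
      transitivity (((z +h h) *h (X -h z *h Z -h scal m (h *h Z)) +h scal m (h *h (h *h Z))) +h
                    scal m (z *h (h *h Z) -h h *h (z *h Z))); [quat |].
      rewrite E'. quat. }
    rewrite R. clear R.
    set (e := pow_remainder z h n) in *.
    assert (B : norm (scal (INR n) (h *h (h *h Hpow z (pred n))) : H) * r ^ 2
                <= INR n * r ^ S n * norm h ^ 2).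
    { destruct n as [| n]; [rewrite norm_scal_H; cbn [INR]; rewrite Rabs_R0; lra |].
      rewrite norm_scal_H, !norm_Hmult, Hpow_norm, Rabs_pos_eq by apply pos_INR. cbn [pred].
      assert (P : norm z ^ n <= r ^ n) by (apply pow_incr; split; [apply norm_nonneg | exact hz]).
      replace (INR (S n) * r ^ S (S n) * norm h ^ 2) with (INR (S n) * (norm h * (norm h * r ^ n)) * r
        ^ 2) by (cbn [pow]; ring).
      apply Rmult_le_compat_r; [nra |]. apply Rmult_le_compat_l; [apply pos_INR |].
      apply Rmult_le_compat_l; [apply norm_nonneg |]. apply Rmult_le_compat_l;
        [apply norm_nonneg | exact P]. }
    apply Rle_trans with (r * (norm e * r ^ 2) + INR n * r ^ S n * norm h ^ 2).
    + apply Rle_trans with ((norm ((z +h h) *h e) + norm (scal (INR n) (h *h (h *h Hpow z (pred n))) :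
        H)) * r ^ 2).
      * apply Rmult_le_compat_r; [nra | apply norm_plus_le].
      * rewrite norm_Hmult. pose proof (norm_nonneg e). assert (norm (z +h h) * (norm e * r ^ 2) <=
          r * (norm e * r ^ 2)).
        { apply Rmult_le_compat_r; [| exact hzh]. nra. }
        lra.
    + apply Rle_trans with (r * (INR n ^ 2 * r ^ n * norm h ^ 2) + INR n * r ^ S n * norm h ^ 2).
      * apply Rplus_le_compat_r. apply Rmult_le_compat_l; assumption.
      * rewrite S_INR. cbn [pow]. set (X := norm h * (norm h * 1)).
        assert (0 <= r * r ^ n * X).
        { unfold X. pose proof (norm_nonneg h). apply Rmult_le_pos; [| nra].
          apply Rmult_le_pos; [exact hr | apply pow_le; exact hr]. }
        pose proof (pos_INR n). nra.
Qed.

Lemma is_series_cons (u : nat -> H) (l : H) :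
  is_series (fun n => u (S n)) l -> is_series u (u 0%nat +h l).
Proof.
  intros h. apply is_series_coord in h. destruct h as (h1 & h2 & h3 & h4).
  assert (D : forall (v : nat -> R) (m : R), is_series (fun n => v (S n)) m -> is_series v (v 0%nat + m)).
  { intros v m hm. apply is_series_decr_1.
    assert (E : m = plus (v 0%nat + m) (opp (v 0%nat))) by (change (m = v 0%nat + m + - v 0%nat); lra).
    rewrite E in hm. exact hm. }
  apply is_series_coord. coord. repeat split; apply D; assumption.
Qed.

(** The power remainders are summed against the coefficients. Along r < s1 < s2 < t < 1, each of the
    first two enlargements of the radius absorbs one factor of n^2, and the last one leaves the
    summable ratio s2 / t. As h commutes with z, both lie in one slice and the derivative acts as h
    times [der a]. *)
Lemma eval_taylor2 (a : nat -> H) (r : R) :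
  tame a -> 0 < r < 1 ->
  exists C, 0 <= C /\ forall z h : H, z *h h = h *h z -> norm z <= r -> norm (z +h h) <= r ->
    norm (HPSeries a (z +h h) -h HPSeries a z -h h *h HPSeries (der a) z) <= C * norm h ^ 2.
Proof.
  intros ha hr.
  set (s1 := (1 + r) / 2). set (s2 := (1 + s1) / 2). set (t := (1 + s2) / 2).
  assert (hs1 : r < s1 < 1) by (unfold s1; lra).
  assert (hs2 : s1 < s2 < 1) by (unfold s2; lra).
  assert (ht : s2 < t < 1) by (unfold t; lra).
  destruct (linear_times_geom r s1) as (C1 & hC1 & b1); [lra |].
  destruct (linear_times_geom s1 s2) as (C2 & hC2 & b2); [lra |].
  destruct (ha t) as [M hM]; [lra |].
  assert (hM0 : 0 <= M).
  { eapply Rle_trans; [| apply (hM 0%nat)]. apply Rmult_le_pos; [apply norm_nonneg | cbn; lra]. }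
  assert (hx : 0 <= s2 / t < 1) by (apply ratio_lt_1; lra).
  exists (2 * ((C1 * C2 * M / r ^ 2) / (1 - s2 / t))).
  assert (hr2 : 0 < r ^ 2) by nra.
  split.
  { apply Rmult_le_pos; [lra |]. apply Rmult_le_pos; [| left; apply Rinv_0_lt_compat; lra].
    apply Rmult_le_pos; [| left; apply Rinv_0_lt_compat; lra]. apply Rmult_le_pos; [nra | lra]. }
  intros z h E hz hzh.
  assert (L : is_series (fun n => pow_remainder z h n *h a n)
                (HPSeries a (z +h h) -h HPSeries a z -h h *h HPSeries (der a) z)).
  { assert (N : forall u v (l m : H), is_series u l -> is_series v m ->
      is_series (fun n => u n -h v n) (l -h m))
      by (apply (@is_series_minus R_AbsRing H)).
    eapply is_series_ext; [| apply N; [apply N |]].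
    2: { apply (tame_eval a (z +h h)); [exact ha | lra]. }
    2: { apply (tame_eval a z); [exact ha | lra]. }
    (* The derivative series starts at n = 1; [T] has an additional zero term at n = 0 that aligns
       it with the other two series. *)
    2: { pose (T := fun n => scal (INR n) (h *h Hpow z (pred n) *h a n) : H).
         replace (h *h HPSeries (der a) z) with (T 0%nat +h h *h HPSeries (der a) z).
         - apply (is_series_cons T). unfold T. cbn [pred]. eapply is_series_ext;
             [| apply is_series_Hmult_l, (tame_eval (der a) z); [apply tame_der, ha | lra]].
           intros n. cbv beta. unfold der. generalize (Hpow z n). intros; quat.
         - unfold T. cbn [INR]. generalize (HPSeries (der a) z). intros; quat. }
    intros n. cbv beta. unfold pow_remainder. generalize (Hpow z (pred n)) (Hpow z n) (Hpow (z +h h) n).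
    intros. quat. }
  rewrite <- (HSeries_unique _ _ L).
  replace (2 * (C1 * C2 * M / r ^ 2 / (1 - s2 / t)) * norm h ^ 2)
    with (2 * ((C1 * C2 * M / r ^ 2 * norm h ^ 2) / (1 - s2 / t))) by (field; repeat split; lra).
  apply norm_HSeries_le; [exact hx |].
  intros n. rewrite norm_Hmult.
  pose proof (pow_remainder_bound z h r n E hz hzh) as B.
  assert (B1 : INR n ^ 2 * r ^ n <= C1 * C2 * s2 ^ n).
  { specialize (b1 n). specialize (b2 n). rewrite S_INR in b1, b2. pose proof (pos_INR n).
    assert (0 <= r ^ n) by (apply pow_le; lra). assert (0 <= s1 ^ n) by (apply pow_le; lra).
    assert (INR n * r ^ n <= C1 * s1 ^ n) by nra.
    assert (INR n * s1 ^ n <= C2 * s2 ^ n) by nra.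
    replace (INR n ^ 2 * r ^ n) with (INR n * (INR n * r ^ n)) by ring.
    apply Rle_trans with (INR n * (C1 * s1 ^ n)); [apply Rmult_le_compat_l; assumption |].
    replace (INR n * (C1 * s1 ^ n)) with (C1 * (INR n * s1 ^ n)) by ring.
    rewrite Rmult_assoc. apply Rmult_le_compat_l; assumption. }
  assert (B2 : s2 ^ n * norm (a n) <= M * (s2 / t) ^ n).
  { specialize (hM n).
    replace (s2 ^ n) with (t ^ n * (s2 / t) ^ n) by (rewrite <- Rpow_mult_distr; f_equal; field; lra).
    replace (t ^ n * (s2 / t) ^ n * norm (a n)) with (norm (a n) * t ^ n * (s2 / t) ^ n) by ring.
    apply Rmult_le_compat_r; [apply pow_le; lra | exact hM]. }
  apply Rmult_le_reg_r with (r ^ 2); [exact hr2 |].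
  replace (C1 * C2 * M / r ^ 2 * norm h ^ 2 * (s2 / t) ^ n * r ^ 2)
    with (C1 * C2 * norm h ^ 2 * (M * (s2 / t) ^ n)) by (field; lra).
  pose proof (norm_nonneg (a n)). pose proof (norm_nonneg h).
  apply Rle_trans with (C1 * C2 * norm h ^ 2 * (s2 ^ n * norm (a n))).
  - replace (norm (pow_remainder z h n) * norm (a n) * r ^ 2)
      with (norm (pow_remainder z h n) * r ^ 2 * norm (a n)) by ring.
    replace (C1 * C2 * norm h ^ 2 * (s2 ^ n * norm (a n)))
      with (C1 * C2 * s2 ^ n * norm h ^ 2 * norm (a n)) by ring.
    apply Rmult_le_compat_r; [assumption |]. eapply Rle_trans; [exact B |].
    apply Rmult_le_compat_r; [nra | exact B1].
  - apply Rmult_le_compat_l; [| exact B2]. apply Rmult_le_pos; nra.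
Qed.

(* Differentiability of f on the slice of I at x + y I, with derivative h |-> h d. *)
Definition slice_diff (f : H -> H) (I : H) (x y : R) (d : H) : Prop :=
  forall eps, 0 < eps -> exists delta, 0 < delta /\ forall x' y',
    Rabs (x' - x) < delta -> Rabs (y' - y) < delta ->
    norm (f (slice I x' y') -h f (slice I x y) -h slice I (x' - x) (y' - y) *h d)
      <= eps * (Rabs (x' - x) + Rabs (y' - y)).

Lemma expansion_slice_diff (f : H -> H) (a : nat -> H) (I : H) (x y : R) :
  expansion f a -> sphere I -> ball1 (slice I x y) ->
  slice_diff f I x y (HPSeries (der a) (slice I x y)).
Proof.
  intros hf hI hq eps heps. unfold ball1 in hq.
  pose proof (norm_nonneg (slice I x y)) as h0.
  set (r := (1 + norm (slice I x y)) / 2). assert (hr : norm (slice I x y) < r < 1) by (unfold r; lra).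
  destruct (eval_taylor2 a r) as (C & hC & hT); [apply (expansion_tame f), hf | lra |].
  (* The increment h will satisfy |h| < 2 dl: the first bound keeps z + h within the radius r, the
     second gives C |h| <= eps. *)
  set (dl := Rmin ((r - norm (slice I x y)) / 2) (eps / (2 * (C + 1)))).
  assert (hdl : 0 < dl).
  { unfold dl. apply Rmin_pos; [lra |]. apply Rmult_lt_0_compat; [lra |]. apply Rinv_0_lt_compat; lra. }
  exists dl. split; [exact hdl |]. intros x' y' hx hy.
  assert (d1 : dl <= (r - norm (slice I x y)) / 2) by apply Rmin_l.
  assert (d2 : dl * (2 * (C + 1)) <= eps).
  { apply Rle_trans with (eps / (2 * (C + 1)) * (2 * (C + 1))).
    - apply Rmult_le_compat_r; [lra | apply Rmin_r].
    - right; field; lra. }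
  set (h := slice I (x' - x) (y' - y)).
  assert (E : slice I x' y' = slice I x y +h h) by (unfold h, slice; quat).
  assert (hh : norm h <= Rabs (x' - x) + Rabs (y' - y)) by (apply norm_slice_le; exact hI).
  pose proof (norm_plus_le (slice I x y) h) as tr. pose proof (norm_nonneg h).
  assert (hzh : norm (slice I x y +h h) <= r) by lra.
  rewrite E, <- (expansion_eval f a (slice I x y) hf hq).
  rewrite <- (expansion_eval f a (slice I x y +h h) hf) by lra.
  eapply Rle_trans; [apply hT |].
  - apply slice_comm.
  - lra.
  - exact hzh.
  - apply Rle_trans with ((C * (2 * dl)) * norm h).
    + replace (C * norm h ^ 2) with (C * norm h * norm h) by ring.
      apply Rmult_le_compat_r; [assumption |]. apply Rmult_le_compat_l; lra.
    + assert (0 <= C * (2 * dl)) by (apply Rmult_le_pos; lra).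
      apply Rmult_le_compat; [assumption | assumption | nra | exact hh].
Qed.

Lemma Derive_of_bound (g : R -> R) (t d : R) :
  (forall eps, 0 < eps -> exists delta, 0 < delta /\ forall t', Rabs (t' - t) < delta ->
     Rabs (g t' - g t - (t' - t) * d) <= eps * Rabs (t' - t)) ->
  Derive g t = d.
Proof.
  intros h. apply is_derive_unique, is_derive_Reals. intros eps heps.
  destruct (h (eps / 2)) as (dl & hdl & k); [lra |]. exists (mkposreal dl hdl).
  intros u hu hu'. cbn in hu'. specialize (k (t + u)).
  replace (t + u - t) with u in k by ring. specialize (k hu').
  replace ((g (t + u) - g t) / u - d) with ((g (t + u) - g t - u * d) * / u) by (field; exact hu).
  rewrite Rabs_mult, Rabs_inv. pose proof (Rabs_pos_lt u hu).
  apply Rmult_lt_reg_r with (Rabs u); [assumption |]. rewrite Rmult_assoc, Rinv_l by lra. nra.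
Qed.

Lemma HDerive_of_bound (g : R -> H) (t : R) (d : H) :
  (forall eps, 0 < eps -> exists delta, 0 < delta /\ forall t', Rabs (t' - t) < delta ->
     norm (g t' -h g t -h scal (t' - t) d) <= eps * Rabs (t' - t)) ->
  HDerive g t = d.
Proof.
  intros h. unfold HDerive.
  assert (P : forall pr : H -> R, (forall p, Rabs (pr p) <= norm p) ->
     (forall p q : H, pr (p +h q) = pr p + pr q) -> (forall x (p : H), pr (scal x p) = x * pr p) ->
     (forall p : H, pr (opp p) = - pr p) -> Derive (fun s => pr (g s)) t = pr d).
  { intros pr h1 h2 h3 h4. apply Derive_of_bound. intros eps heps.
    destruct (h eps heps) as (dl & hdl & k). exists dl. split; [exact hdl |].
    intros t' ht'. eapply Rle_trans; [| apply k; exact ht'].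
    eapply Rle_trans; [| apply h1]. unfold minus. right. f_equal.
    rewrite !h2, !h4, h3. ring. }
  apply H_ext; coord; apply P; intros; try (apply coord_le_norm); reflexivity.
Qed.

Lemma slice_diff_partials (f : H -> H) (I : H) (x y : R) (d : H) :
  sphere I -> slice_diff f I x y d ->
  partial_x I f x y = d /\ partial_y I f x y = I *h d.
Proof.
  intros hI hf. split; apply HDerive_of_bound; intros eps heps;
    destruct (hf eps heps) as (dl & hdl & k); exists dl; (split; [exact hdl |]); intros t ht.
  - specialize (k t y ht). rewrite Rminus_diag, Rabs_R0, Rplus_0_r in k. specialize (k hdl).
    replace (scal (t - x) d : H) with (slice I (t - x) 0 *h d); [exact k |]. unfold slice. quat.
  - specialize (k x t). rewrite Rminus_diag, Rabs_R0, Rplus_0_l in k. specialize (k hdl ht).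
    replace (scal (t - y) (I *h d) : H) with (slice I 0 (t - y) *h d); [exact k |]. unfold slice. quat.
Qed.

Lemma locally_2d_box (x y : R) (P : R * R -> Prop) :
  locally (x, y) P <->
  exists delta, 0 < delta /\ forall x' y', Rabs (x' - x) < delta -> Rabs (y' - y) < delta -> P (x', y').
Proof.
  split.
  - intros [e he]. exists e. split; [apply cond_pos |]. intros x' y' hx hy. apply he. split; assumption.
  - intros (dl & hdl & h). exists (mkposreal dl hdl). intros [x' y'] [h1 h2]. apply h; assumption.
Qed.

Lemma norm_pair_bounds (u v : R) :
  norm ((u, v) : prod_NormedModule R_AbsRing R_NormedModule R_NormedModule) <= Rabs u + Rabs v /\
  Rabs u + Rabs v <= 2 * norm ((u, v) : prod_NormedModule R_AbsRing R_NormedModule R_NormedModule).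
Proof.
  change (norm ((u, v) : prod_NormedModule R_AbsRing R_NormedModule R_NormedModule))
    with (sqrt (Rabs u ^ 2 + Rabs v ^ 2)).
  pose proof (Rabs_pos u). pose proof (Rabs_pos v).
  assert (P : 0 <= Rabs u ^ 2 + Rabs v ^ 2) by nra.
  pose proof (sqrt_pos (Rabs u ^ 2 + Rabs v ^ 2)). pose proof (pow2_sqrt _ P).
  set (s := sqrt (Rabs u ^ 2 + Rabs v ^ 2)) in *. clearbody s.
  pose proof (pow2_ge_0 (Rabs u - Rabs v)).
  split; apply Rsqr_incr_0_var; unfold Rsqr; nra.
Qed.

Lemma slice_diff_filterdiff (f : H -> H) (I : H) (x y : R) (d : H) :
  sphere I -> slice_diff f I x y d ->
  ex_filterdiff (fun p : R * R => f (slice I (fst p) (snd p))) (locally (x, y)).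
Proof.
  intros hI hf. exists (fun p : R * R => slice I (fst p) (snd p) *h d). split.
  - split.
    + intros [u v] [u' v']. cbn [fst snd]. change (plus (u, v) (u', v')) with (u + u', v + v').
      cbn [fst snd]. unfold slice. quat.
    + intros k [u v]. change (scal k (u, v)) with (k * u, k * v). cbn [fst snd]. unfold slice. quat.
    (* The summand 1 keeps the constant positive when d = 0. *)
    + exists (2 * norm d + 1). pose proof (norm_nonneg d). split; [lra |]. intros [u v]. cbn [fst snd].
      rewrite norm_Hmult. pose proof (norm_slice_le I u v hI).
      destruct (norm_pair_bounds u v) as [_ b].
      set (N := norm ((u, v) : prod_NormedModule R_AbsRing R_NormedModule R_NormedModule)) in *.
      change (Rabs u + Rabs v <= 2 * N) in b.
      change (norm (slice I u v) * norm d <= (2 * norm d + 1) * N).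
      assert (0 <= N) by apply norm_ge_0.
      apply Rle_trans with (2 * N * norm d); [apply Rmult_le_compat_r; lra | lra].
  - intros p hp.
    assert (ep : p = (x, y)).
    { symmetry. apply is_filter_lim_locally_unique. exact hp. }
    subst p. intros eps. destruct (hf (eps / 2)) as (dl & hdl & k).
    { pose proof (cond_pos eps). lra. }
    apply locally_2d_box. exists dl. split; [exact hdl |]. intros x' y' hx hy. cbn [fst snd].
    specialize (k x' y' hx hy).
    change (minus (x', y') (x, y)) with (x' - x, y' - y). cbn [fst snd].
    eapply Rle_trans; [exact k |]. destruct (norm_pair_bounds (x' - x) (y' - y)) as [_ b].
    pose proof (cond_pos eps).
    set (N := norm ((x' - x, y' - y) : prod_NormedModule R_AbsRing R_NormedModule R_NormedModule)) in *.
    change (Rabs (x' - x) + Rabs (y' - y) <= 2 * N) in b.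
    change (eps / 2 * (Rabs (x' - x) + Rabs (y' - y)) <= eps * N).
    replace (eps * N) with (eps / 2 * (2 * N)) by field. apply Rmult_le_compat_l; lra.
Qed.

(** The differential is a priori only real linear, (u, v) |-> u Lx + v Ly. The Cauchy-Riemann
    equation gives Ly = I Lx, so it is left multiplication of d = Lx by u + v I. *)
Lemma filterdiff_slice_diff (f : H -> H) (I : H) (x y : R) :
  sphere I ->
  ex_filterdiff (fun p : R * R => f (slice I (fst p) (snd p))) (locally (x, y)) ->
  scal (/ 2) (partial_x I f x y +h I *h partial_y I f x y) = (zero : H) ->
  exists d, slice_diff f I x y d.
Proof.
  intros hI [l [hl hd]] CR.
  specialize (hd (x, y) (fun P hP => hP)).
  set (Lx := l (1, 0)). set (Ly := l (0, 1)).
  assert (E : forall u v, l (u, v) = scal u Lx +h scal v Ly).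
  { intros u v. unfold Lx, Ly. rewrite <- !(linear_scal _ hl), <- (linear_plus _ hl). f_equal.
    change (@eq (R * R) (u, v) (u * 1 + v * 0, u * 0 + v * 1)).
    rewrite !Rmult_0_r, !Rmult_1_r, Rplus_0_l, Rplus_0_r. reflexivity. }
  assert (D : forall eps, 0 < eps -> exists delta, 0 < delta /\ forall x' y',
     Rabs (x' - x) < delta -> Rabs (y' - y) < delta ->
     norm (f (slice I x' y') -h f (slice I x y) -h (scal (x' - x) Lx +h scal (y' - y) Ly))
       <= eps * (Rabs (x' - x) + Rabs (y' - y))).
  { intros eps heps. specialize (hd (mkposreal eps heps)). apply locally_2d_box in hd.
    destruct hd as (dl & hdl & k). exists dl. split; [exact hdl |]. intros x' y' hx hy.
    specialize (k x' y' hx hy). cbn [fst snd pos] in k.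
    change (minus (x', y') (x, y)) with (x' - x, y' - y) in k. rewrite E in k.
    eapply Rle_trans; [exact k |]. apply Rmult_le_compat_l; [lra |]. apply norm_pair_bounds. }
  assert (Px : partial_x I f x y = Lx).
  { apply HDerive_of_bound. intros eps heps. destruct (D eps heps) as (dl & hdl & k).
    exists dl. split; [exact hdl |]. intros t ht. specialize (k t y ht).
    rewrite Rminus_diag, Rabs_R0, Rplus_0_r in k. specialize (k hdl).
    replace (scal (t - x) Lx : H) with (scal (t - x) Lx +h scal 0 Ly); [exact k | quat]. }
  assert (Py : partial_y I f x y = Ly).
  { apply HDerive_of_bound. intros eps heps. destruct (D eps heps) as (dl & hdl & k).
    exists dl. split; [exact hdl |]. intros t ht. specialize (k x t).
    rewrite Rminus_diag, Rabs_R0, Rplus_0_l in k. specialize (k hdl ht).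
    replace (scal (t - y) Ly : H) with (scal 0 Lx +h scal (t - y) Ly); [exact k | quat]. }
  rewrite Px, Py in CR.
  (* Multiplying Lx + I Ly = 0 by I on the left turns it into I Lx - Ly = 0. *)
  assert (Ey : Ly = I *h Lx).
  { assert (A : I *h (scal (/ 2) (Lx +h I *h Ly)) = zero) by (rewrite CR; quat).
    assert (B : scal (/ 2) (I *h Lx -h Ly) = (zero : H)).
    { rewrite <- A, Hmult_scal_r, Hmult_plus_r, Hmult_assoc, hI. quat. }
    transitivity (I *h Lx -h scal 2 (scal (/ 2) (I *h Lx -h Ly) : H)).
    - apply H_ext; coord; field.
    - rewrite B. quat. }
  exists Lx. intros eps heps. destruct (D eps heps) as (dl & hdl & k).
  exists dl. split; [exact hdl |]. intros x' y' hx hy. specialize (k x' y' hx hy).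
  rewrite Ey in k.
  replace (slice I (x' - x) (y' - y) *h Lx) with (scal (x' - x) Lx +h scal (y' - y) (I *h Lx)); [exact k |].
  unfold slice. quat.
Qed.

Lemma half_minus_II (I d : H) : sphere I -> scal (/ 2) (d -h I *h (I *h d)) = (d : H).
Proof.
  intros hI. rewrite Hmult_assoc, hI. apply H_ext; coord; field.
Qed.

Lemma half_plus_II (I d : H) : sphere I -> scal (/ 2) (d +h I *h (I *h d)) = (zero : H).
Proof. intros hI. rewrite Hmult_assoc, hI. quat. Qed.

Lemma expansion_slice_regular (f : H -> H) (a : nat -> H) : expansion f a -> slice_regular ball1 f.
Proof.
  intros hf I x y hI hq.
  pose proof (expansion_slice_diff f a I x y hf hI hq) as hd.
  split; [eapply slice_diff_filterdiff; eassumption |].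
  destruct (slice_diff_partials f I x y _ hI hd) as [-> ->]. apply half_plus_II, hI.
Qed.

(** On a slice through q the partial derivatives are d and I d, and (d - I I d) / 2 = d for
    whichever unit [dir] selects. *)
Lemma expansion_cullen (f : H -> H) (a : nat -> H) : expansion f a -> expansion (cullen f) (der a).
Proof.
  intros hf q hq. destruct (slice_decomposition q) as [hI E].
  assert (hq' : ball1 (slice (dir q) (re q) (norm (vec q)))) by (rewrite <- E; exact hq).
  pose proof (expansion_slice_diff f a _ _ _ hf hI hq') as hd.
  unfold cullen. destruct (slice_diff_partials f _ _ _ _ hI hd) as [-> ->].
  rewrite half_minus_II by exact hI. rewrite <- E.
  apply tame_eval; [apply tame_der, (expansion_tame f), hf | exact hq].
Qed.

Fixpoint der_n (n : nat) (a : nat -> H) : nat -> H :=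
  match n with O => a | S m => der (der_n m a) end.

Lemma expansion_cullen_n (f : H -> H) (a : nat -> H) (n : nat) :
  expansion f a -> expansion (cullen_n n f) (der_n n a).
Proof. intros hf. induction n as [| n IH]; [exact hf |]. apply expansion_cullen, IH. Qed.

(** * Goursat's theorem *)

(** [good n a c] is meant for the rectangle with lower left corner (a, c) and sides w / 2^n and h /
    2^n. Dependent choice produces a nested sequence of such rectangles, and completeness a common
    point. *)
Lemma nested_bisection (good : nat -> R -> R -> Prop) (w h a0 c0 : R) :
  0 <= w -> 0 <= h -> good 0%nat a0 c0 ->
  (forall n a c, good n a c -> exists a' c', good (S n) a' c' /\
     (a' = a \/ a' = a + w / 2 ^ S n) /\ (c' = c \/ c' = c + h / 2 ^ S n)) ->
  exists x y, forall n, exists a c, good n a c /\ a <= x <= a + w / 2 ^ n /\ c <= y <= c + h / 2 ^ n.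
Proof.
  intros hw hh h0 step.
  set (T := fun n => {p : R * R | good n (fst p) (snd p)}).
  assert (next : forall n (s : T n), {s' : T (S n) |
     (fst (proj1_sig s') = fst (proj1_sig s) \/ fst (proj1_sig s') = fst (proj1_sig s) + w / 2 ^ S n) /\
     (snd (proj1_sig s') = snd (proj1_sig s) \/ snd (proj1_sig s') = snd (proj1_sig s) + h / 2 ^ S n)}).
  { intros n [p hp]. apply constructive_indefinite_description.
    destruct (step n (fst p) (snd p) hp) as (a' & c' & hg & ha & hc).
    exists (exist _ (a', c') hg). split; assumption. }
  set (s := nat_rect T (exist _ (a0, c0) h0) (fun n t => proj1_sig (next n t))).
  set (a := fun n => fst (proj1_sig (s n))). set (c := fun n => snd (proj1_sig (s n))).
  assert (hg : forall n, good n (a n) (c n)) by (intros n; exact (proj2_sig (s n))).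
  assert (ha : forall n, a (S n) = a n \/ a (S n) = a n + w / 2 ^ S n)
    by (intros n; exact (proj1 (proj2_sig (next n (s n))))).
  assert (hc : forall n, c (S n) = c n \/ c (S n) = c n + h / 2 ^ S n)
    by (intros n; exact (proj2 (proj2_sig (next n (s n))))).
  clearbody a c. clear s next T step h0.
  assert (L : forall (u : nat -> R) (v : R), 0 <= v ->
     (forall n, u (S n) = u n \/ u (S n) = u n + v / 2 ^ S n) ->
     exists x, forall n, u n <= x <= u n + v / 2 ^ n).
  { intros u v hv hu.
    assert (hp : forall n, 0 <= v / 2 ^ S n /\ v / 2 ^ n = 2 * (v / 2 ^ S n)).
    { intros n. assert (0 < 2 ^ n) by (apply pow_lt; lra). cbn [pow]. split; [| field; lra].
      apply Rmult_le_pos; [lra |]. left; apply Rinv_0_lt_compat; lra. }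
    assert (inc : forall n k, u n <= u (n + k)%nat /\ u (n + k)%nat + v / 2 ^ (n + k) <= u n + v / 2 ^ n).
    { intros n k. induction k as [| k IH]; [rewrite Nat.add_0_r; lra |].
      rewrite Nat.add_succ_r. specialize (hp (n + k)%nat). specialize (hu (n + k)%nat).
      destruct hu as [-> | ->]; lra. }
    assert (pos : forall n, 0 <= v / 2 ^ n) by (intros n; specialize (hp n); lra).
    assert (ub : forall k n, u k <= u n + v / 2 ^ n).
    { intros k n. pose proof (pos n). pose proof (pos k). destruct (Nat.le_ge_cases k n) as [l | l].
      - replace n with (k + (n - k))%nat at 1 by lia. pose proof (proj1 (inc k (n - k)%nat)). lra.
      - pose proof (proj2 (inc n (k - n)%nat)) as i. replace (n + (k - n))%nat with k in i by lia. lra. }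
    (* The left ends increase and stay below every right end; their supremum lies in all the
       intervals. *)
    destruct (completeness (fun z => exists k, z = u k)) as [x [hx1 hx2]].
    - exists (u 0%nat + v / 2 ^ 0). intros z [k ->]. apply ub.
    - exists (u 0%nat). exists 0%nat. reflexivity.
    - exists x. intros n. split; [apply hx1; exists n; reflexivity |].
      apply hx2. intros z [k ->]. apply ub. }
  destruct (L a w hw ha) as [x hx]. destruct (L c h hh hc) as [y hy].
  exists x, y. intros n. exists (a n), (c n). auto.
Qed.

(** The bisection argument of Goursat, freed from integrals. If the value had modulus eta > 0,
    additivity would leave a quarter with at least eta / 4, then a nested sequence with values at
    least eta / 4^n. Near the common point these values are o((size)^2), a contradiction since
    size^2 also decreases like 1 / 4^n. *)
Lemma additive_rectangle_function_zero (Phi : R -> R -> R -> R -> R) (x0 x1 y0 y1 : R) :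
  x0 <= x1 -> y0 <= y1 ->
  (forall a m b c d, x0 <= a <= m -> m <= b <= x1 -> y0 <= c <= d -> d <= y1 ->
     Phi a b c d = Phi a m c d + Phi m b c d) ->
  (forall a b c m d, x0 <= a <= b -> b <= x1 -> y0 <= c <= m -> m <= d <= y1 ->
     Phi a b c d = Phi a b c m + Phi a b m d) ->
  (forall x y, x0 <= x <= x1 -> y0 <= y <= y1 -> forall eps, 0 < eps -> exists delta, 0 < delta /\
     forall a b c d, x0 <= a <= x -> x <= b <= x1 -> y0 <= c <= y -> y <= d <= y1 ->
       b - a < delta -> d - c < delta -> Rabs (Phi a b c d) <= eps * ((b - a) + (d - c)) ^ 2) ->
  Phi x0 x1 y0 y1 = 0.
Proof.
  intros hx hy addx addy loc.
  destruct (Req_dec (Phi x0 x1 y0 y1) 0) as [h0 | h0]; [exact h0 | exfalso].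
  set (eta := Rabs (Phi x0 x1 y0 y1)). assert (heta : 0 < eta) by (apply Rabs_pos_lt; exact h0).
  set (w := x1 - x0). set (h := y1 - y0).
  set (good := fun n a c => x0 <= a /\ a + w / 2 ^ n <= x1 /\ y0 <= c /\ c + h / 2 ^ n <= y1 /\
     eta / 4 ^ n <= Rabs (Phi a (a + w / 2 ^ n) c (c + h / 2 ^ n))).
  assert (pw : forall v n, 0 <= v -> 0 <= v / 2 ^ n).
  { intros v n hv. apply Rmult_le_pos; [exact hv |]. left; apply Rinv_0_lt_compat, pow_lt; lra. }
  destruct (nested_bisection good w h x0 y0) as (x & y & B).
  - unfold w; lra.
  - unfold h; lra.
  - unfold good. cbn [pow]. replace (x0 + w / 1) with x1 by (unfold w; field).
    replace (y0 + h / 1) with y1 by (unfold h; field). repeat split; try lra. fold eta. lra.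
  - intros n a c (g1 & g2 & g3 & g4 & g5).
    set (w' := w / 2 ^ S n). set (h' := h / 2 ^ S n).
    assert (p2 : 0 < 2 ^ n) by (apply pow_lt; lra).
    assert (p4 : 0 < 4 ^ n) by (apply pow_lt; lra).
    assert (ew : w / 2 ^ n = w' + w') by (unfold w'; cbn [pow]; field; lra).
    assert (eh : h / 2 ^ n = h' + h') by (unfold h'; cbn [pow]; field; lra).
    assert (hw' : 0 <= w') by (apply pw; unfold w; lra).
    assert (hh' : 0 <= h') by (apply pw; unfold h; lra).
    set (eta' := eta / 4 ^ S n). assert (ee : eta / 4 ^ n = 4 * eta') by (unfold eta'; cbn [pow]; field; lra).
    rewrite ew, eh, ee in g5. rewrite ew in g2. rewrite eh in g4.
    assert (S : eta' <= Rabs (Phi a (a + w') c (c + h')) \/ eta' <= Rabs (Phi (a + w') (a + w' + w') c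
      (c + h')) \/
                eta' <= Rabs (Phi a (a + w') (c + h') (c + h' + h')) \/
                eta' <= Rabs (Phi (a + w') (a + w' + w') (c + h') (c + h' + h'))).
    { rewrite (addx a (a + w') (a + (w' + w')) c (c + (h' + h'))) in g5 by lra.
      rewrite (addy a (a + w') c (c + h') (c + (h' + h'))) in g5 by lra.
      rewrite (addy (a + w') (a + (w' + w')) c (c + h') (c + (h' + h'))) in g5 by lra.
      rewrite <- !Rplus_assoc in g5.
      set (X1 := Phi a (a + w') c (c + h')) in *. set (X2 := Phi (a + w') (a + w' + w') c (c + h')) in *.
      set (X3 := Phi a (a + w') (c + h') (c + h' + h')) in *.
      set (X4 := Phi (a + w') (a + w' + w') (c + h') (c + h' + h')) in *.
      pose proof (Rabs_triang (X1 + X3 + X2) X4). pose proof (Rabs_triang (X1 + X3) X2).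
      pose proof (Rabs_triang X1 X3). lra. }
    destruct S as [S | [S | [S | S]]].
    + exists a, c. unfold good. fold w' h' eta'. repeat split; try lra; auto.
    + exists (a + w'), c. unfold good. fold w' h' eta'. repeat split; try lra; auto.
    + exists a, (c + h'). unfold good. fold w' h' eta'. repeat split; try lra; auto.
    + exists (a + w'), (c + h'). unfold good. fold w' h' eta'. repeat split; try lra; auto.
  - assert (hxy : x0 <= x <= x1 /\ y0 <= y <= y1).
    { destruct (B 0%nat) as (a & c & (g1 & g2 & g3 & g4 & _) & ha & hc). lra. }
    (* Chosen so that e (w + h)^2 < eta, which contradicts the lower bound once the common factor
       4^n is removed; the summand 1 admits w + h = 0. *)
    set (e := eta / ((w + h) ^ 2 + 1)). assert (pe : 0 < (w + h) ^ 2 + 1)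
      by (pose proof (pow2_ge_0 (w + h)); lra).
    destruct (loc x y) with (eps := e) as (dl & hdl & k); [lra | lra | |].
    { unfold e. apply Rdiv_lt_0_compat; lra. }
    assert (N : exists n, (w + h) / 2 ^ n < dl).
    { destruct (Pow_x_infinity 2) with (b := (w + h) / dl + 1) as [n hn]; [rewrite Rabs_pos_eq; lra |].
      exists n. specialize (hn n (Nat.le_refl n)). rewrite Rabs_pos_eq in hn by (apply pow_le; lra).
      assert (0 < 2 ^ n) by (apply pow_lt; lra).
      apply Rmult_lt_reg_r with (2 ^ n); [assumption |].
      replace ((w + h) / 2 ^ n * 2 ^ n) with ((w + h) / dl * dl) by (field; lra).
      rewrite (Rmult_comm dl). apply Rmult_lt_compat_r; lra. }
    destruct N as [n hn]. destruct (B n) as (a & c & (g1 & g2 & g3 & g4 & g5) & ha & hc).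
    assert (0 <= w / 2 ^ n) by (apply pw; unfold w; lra).
    assert (0 <= h / 2 ^ n) by (apply pw; unfold h; lra).
    assert (sp : (w + h) / 2 ^ n = w / 2 ^ n + h / 2 ^ n) by (unfold Rdiv; ring).
    specialize (k a (a + w / 2 ^ n) c (c + h / 2 ^ n)).
    assert (k' : Rabs (Phi a (a + w / 2 ^ n) c (c + h / 2 ^ n)) <= e * (w / 2 ^ n + h / 2 ^ n) ^ 2).
    { replace (w / 2 ^ n + h / 2 ^ n) with (a + w / 2 ^ n - a + (c + h / 2 ^ n - c)) by ring.
      apply k; lra. }
    assert (p2 : 0 < 2 ^ n) by (apply pow_lt; lra).
    assert (e4 : 4 ^ n = 2 ^ n * 2 ^ n) by (rewrite <- Rpow_mult_distr; f_equal; lra).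
    assert (F : eta * ((w + h) ^ 2 + 1) <= eta * (w + h) ^ 2); [| nra].
    apply Rmult_le_reg_r with (/ (4 ^ n * ((w + h) ^ 2 + 1))).
    { apply Rinv_0_lt_compat. apply Rmult_lt_0_compat; [apply pow_lt; lra | lra]. }
    replace (eta * ((w + h) ^ 2 + 1) * / (4 ^ n * ((w + h) ^ 2 + 1))) with (eta / 4 ^ n)
      by (field; split; [lra | apply pow_nonzero; lra]).
    replace (eta * (w + h) ^ 2 * / (4 ^ n * ((w + h) ^ 2 + 1))) with (e * (w / 2 ^ n + h / 2 ^ n) ^ 2)
      by (rewrite e4; unfold e; field; split; lra).
    lra.
Qed.

Lemma RInt_near_constant (f : R -> R) (a b k M : R) :
  a <= b -> ex_RInt f a b -> (forall t, a <= t <= b -> Rabs (f t - k) <= M) ->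
  Rabs (RInt f a b - (b - a) * k) <= (b - a) * M.
Proof.
  intros hab hf hM.
  replace (RInt f a b - (b - a) * k) with (RInt (fun t => f t - k) a b).
  - apply abs_RInt_le_const; try assumption. apply (@ex_RInt_minus R_NormedModule);
      [exact hf | apply ex_RInt_const].
  - rewrite <- (RInt_const a b k : RInt (fun _ => k) a b = (b - a) * k).
    apply (@RInt_minus R_CompleteNormedModule); [exact hf | apply ex_RInt_const].
Qed.

Definition circulation (P Q : R -> R -> R) (a b c d : R) : R :=
  RInt (fun t => P t c) a b - RInt (fun t => P t d) a b
  + (RInt (Q b) c d - RInt (Q a) c d).

(* The terms [chi x'] and [psi y'] do not contribute to the circulation around a rectangle, so
   the differentiability of the form [P dx + Q dy] is only needed modulo such terms. *)
Lemma goursat (P Q : R -> R -> R) (x0 x1 y0 y1 : R) :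
  x0 <= x1 -> y0 <= y1 ->
  (forall x y, x0 <= x <= x1 -> y0 <= y <= y1 -> continuous (fun t => P t y) x) ->
  (forall x y, x0 <= x <= x1 -> y0 <= y <= y1 -> continuous (Q x) y) ->
  (forall x y, x0 <= x <= x1 -> y0 <= y <= y1 ->
     exists (b : R) (chi psi : R -> R), forall eps, 0 < eps -> exists delta, 0 < delta /\
       forall x' y', x0 <= x' <= x1 -> y0 <= y' <= y1 ->
         Rabs (x' - x) < delta -> Rabs (y' - y) < delta ->
         Rabs (P x' y' - chi x' - b * (y' - y)) <= eps * (Rabs (x' - x) + Rabs (y' - y)) /\
         Rabs (Q x' y' - psi y' - b * (x' - x)) <= eps * (Rabs (x' - x) + Rabs (y' - y))) ->
  circulation P Q x0 x1 y0 y1 = 0.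
Proof.
  intros hx hy cP cQ hd.
  assert (iP : forall a b y, x0 <= a <= b -> b <= x1 -> y0 <= y <= y1 -> ex_RInt (fun t => P t y) a b).
  { intros a b y h1 h2 h3. apply (@ex_RInt_continuous R_CompleteNormedModule).
    intros z hz. rewrite Rmin_left, Rmax_right in hz by lra. apply cP; lra. }
  assert (iQ : forall c d x, y0 <= c <= d -> d <= y1 -> x0 <= x <= x1 -> ex_RInt (Q x) c d).
  { intros c d x h1 h2 h3. apply (@ex_RInt_continuous R_CompleteNormedModule).
    intros z hz. rewrite Rmin_left, Rmax_right in hz by lra. apply cQ; lra. }
  assert (CH : forall f a m b, ex_RInt f a m -> ex_RInt f m b -> RInt f a m + RInt f m b = RInt f a b)
    by (intros f a m b; apply (@RInt_Chasles R_CompleteNormedModule)).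
  apply additive_rectangle_function_zero; try assumption.
  - intros a m b c d h1 h2 h3 h4. unfold circulation.
    rewrite <- (CH (fun t => P t c) a m b), <- (CH (fun t => P t d) a m b) by (apply iP; lra). ring.
  - intros a b c m d h1 h2 h3 h4. unfold circulation.
    rewrite <- (CH (Q a) c m d), <- (CH (Q b) c m d) by (apply iQ; lra). ring.
  - intros x y h1 h2 eps heps. destruct (hd x y h1 h2) as (b0 & chi & psi & k).
    destruct (k (eps / 2)) as (dl & hdl & k'); [lra |]. exists dl. split; [exact hdl |].
    intros a b c d ha hb hc hd' hab hcd. set (s := (b - a) + (d - c)).
    assert (K : forall x' y', a <= x' <= b -> c <= y' <= d ->
       Rabs (P x' y' - chi x' - b0 * (y' - y)) <= eps / 2 * s /\
       Rabs (Q x' y' - psi y' - b0 * (x' - x)) <= eps / 2 * s).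
    { intros x' y' hx' hy'.
      assert (A1 : Rabs (x' - x) <= b - a) by (apply Rabs_le; lra).
      assert (A2 : Rabs (y' - y) <= d - c) by (apply Rabs_le; lra).
      destruct (k' x' y') as [K1 K2]; [lra | lra | lra | lra |].
      assert (eps / 2 * (Rabs (x' - x) + Rabs (y' - y)) <= eps / 2 * s)
        by (apply Rmult_le_compat_l; [lra | unfold s; lra]).
      split; lra. }
    (* The term [chi t] takes the same value on the lower and the upper side, so the difference of
       the two integrands is close to the constant b0 (c - d). *)
    assert (KP : Rabs (RInt (fun t => P t c) a b - RInt (fun t => P t d) a b - (b - a) * (b0 * (c - d)))
                 <= (b - a) * (eps * s)).
    { replace (RInt (fun t => P t c) a b - RInt (fun t => P t d) a b) with (RInt (fun t => P t c - P t d) a b)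
        by (apply (@RInt_minus R_CompleteNormedModule); apply iP; lra).
      apply RInt_near_constant; [lra | apply (@ex_RInt_minus R_NormedModule); apply iP; lra |].
      intros t ht. destruct (K t c ht) as [K1 _]; [lra |]. destruct (K t d ht) as [K2 _]; [lra |].
      replace (P t c - P t d - b0 * (c - d)) with
        ((P t c - chi t - b0 * (c - y)) - (P t d - chi t - b0 * (d - y))) by ring.
      eapply Rle_trans; [apply Rabs_triang |]. rewrite Rabs_Ropp. lra. }
    assert (KQ : Rabs (RInt (Q b) c d - RInt (Q a) c d - (d - c) * (b0 * (b - a)))
                 <= (d - c) * (eps * s)).
    { replace (RInt (Q b) c d - RInt (Q a) c d) with (RInt (fun t => Q b t - Q a t) c d)
        by (apply (@RInt_minus R_CompleteNormedModule); apply iQ; lra).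
      apply RInt_near_constant; [lra | apply (@ex_RInt_minus R_NormedModule); apply iQ; lra |].
      intros t ht. destruct (K b t) as [_ K1]; [lra | lra |]. destruct (K a t) as [_ K2]; [lra | lra |].
      replace (Q b t - Q a t - b0 * (b - a)) with
        ((Q b t - psi t - b0 * (b - x)) - (Q a t - psi t - b0 * (a - x))) by ring.
      eapply Rle_trans; [apply Rabs_triang |]. rewrite Rabs_Ropp. lra. }
    unfold circulation.
    set (U := RInt (fun t => P t c) a b - RInt (fun t => P t d) a b) in *.
    set (V := RInt (Q b) c d - RInt (Q a) c d) in *.
    (* The two main terms are opposite because the same b0 occurs in P and in Q: this is where
       closedness of the form enters. *)
    replace (U + V) with ((U - (b - a) * (b0 * (c - d))) + (V - (d - c) * (b0 * (b - a)))) by ring.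
    eapply Rle_trans; [apply Rabs_triang |].
    replace (eps * s ^ 2) with ((b - a) * (eps * s) + (d - c) * (eps * s)) by (unfold s; ring).
    lra.
Qed.

(** * Integration over circles *)

Definition Hcont (g : R -> H) : Prop :=
  forall x eps, 0 < eps -> exists delta, 0 < delta /\ forall x',
    Rabs (x' - x) < delta -> norm (g x' -h g x) <= eps.

Lemma continuous_of_bound (g : R -> R) (x : R) :
  (forall eps, 0 < eps -> exists delta, 0 < delta /\ forall x',
    Rabs (x' - x) < delta -> Rabs (g x' - g x) <= eps) ->
  continuous g x.
Proof.
  intros h. apply filterlim_locally. intros eps.
  destruct (h (eps / 2)) as (dl & hdl & k); [pose proof (cond_pos eps); lra |].
  exists (mkposreal dl hdl). intros y hy. change (Rabs (g y - g x) < eps).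
  pose proof (cond_pos eps). specialize (k y hy). lra.
Qed.

(** Stands for any of the four coordinates, so that an argument about integrals is given once for
    all of them. *)
Definition lipschitz_linear (pr : H -> R) : Prop :=
  (forall p, Rabs (pr p) <= norm p) /\ (forall p q : H, pr (p +h q) = pr p + pr q) /\
  (forall x (p : H), pr (scal x p) = x * pr p) /\ (forall p : H, pr (opp p) = - pr p).

Lemma coord_lipschitz_linear :
  lipschitz_linear re /\ lipschitz_linear im_i /\ lipschitz_linear im_j /\ lipschitz_linear im_k.
Proof. repeat split; intros; apply coord_le_norm. Qed.

Lemma Hcont_coord (g : R -> H) (pr : H -> R) (x : R) :
  lipschitz_linear pr -> Hcont g -> continuous (fun t => pr (g t)) x.
Proof.
  intros (h1 & h2 & _ & h4) hg. apply continuous_of_bound. intros eps heps.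
  destruct (hg x eps heps) as (dl & hdl & k). exists dl. split; [exact hdl |]. intros x' hx'.
  replace (pr (g x') - pr (g x)) with (pr (g x' -h g x)) by (unfold minus; rewrite h2, h4; ring).
  eapply Rle_trans; [apply h1 | apply k, hx'].
Qed.

Lemma Hcont_const (c : H) : Hcont (fun _ => c).
Proof.
  intros x eps heps. exists 1. split; [lra |]. intros x' _.
  replace (c -h c) with (zero : H) by quat. rewrite norm_zero_H. lra.
Qed.

Lemma Hcont_plus (g k : R -> H) : Hcont g -> Hcont k -> Hcont (fun t => g t +h k t).
Proof.
  intros hg hk x eps heps.
  destruct (hg x (eps / 2)) as (d1 & p1 & b1); [lra |].
  destruct (hk x (eps / 2)) as (d2 & p2 & b2); [lra |].
  exists (Rmin d1 d2). split; [apply Rmin_pos; assumption |]. intros x' hx'.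
  replace (g x' +h k x' -h (g x +h k x)) with ((g x' -h g x) +h (k x' -h k x)) by quat.
  eapply Rle_trans; [apply norm_plus_le |].
  specialize (b1 x' (Rlt_le_trans _ _ _ hx' (Rmin_l _ _))).
  specialize (b2 x' (Rlt_le_trans _ _ _ hx' (Rmin_r _ _))). lra.
Qed.

Lemma Hcont_mult (g k : R -> H) : Hcont g -> Hcont k -> Hcont (fun t => g t *h k t).
Proof.
  intros hg hk x eps heps.
  set (A := norm (g x) + 1). set (B := norm (k x) + 1).
  assert (hA : 0 < A) by (unfold A; pose proof (norm_nonneg (g x)); lra).
  assert (hB : 0 < B) by (unfold B; pose proof (norm_nonneg (k x)); lra).
  destruct (hg x 1) as (d0 & p0 & b0); [lra |].
  destruct (hg x (eps / (2 * B))) as (d1 & p1 & b1); [apply Rdiv_lt_0_compat; lra |].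
  destruct (hk x (eps / (2 * A))) as (d2 & p2 & b2); [apply Rdiv_lt_0_compat; lra |].
  exists (Rmin d0 (Rmin d1 d2)). split; [repeat apply Rmin_pos; assumption |]. intros x' hx'.
  pose proof (Rmin_l d0 (Rmin d1 d2)). pose proof (Rmin_r d0 (Rmin d1 d2)).
  pose proof (Rmin_l d1 d2). pose proof (Rmin_r d1 d2).
  assert (c0 := b0 x' ltac:(lra)). assert (c1 := b1 x' ltac:(lra)). assert (c2 := b2 x' ltac:(lra)).
  replace (g x' *h k x' -h g x *h k x) with (g x' *h (k x' -h k x) +h (g x' -h g x) *h k x) by quat.
  eapply Rle_trans; [apply norm_plus_le |]. rewrite !norm_Hmult.
  assert (n1 : norm (g x') <= A).
  { replace (g x') with (g x +h (g x' -h g x)) by quat. pose proof (norm_plus_le (g x) (g x' -h g x)).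
    unfold A; lra. }
  assert (norm (g x') * norm (k x' -h k x) <= A * (eps / (2 * A)))
    by (apply Rmult_le_compat; try apply norm_nonneg; assumption).
  assert (norm (g x' -h g x) * norm (k x) <= eps / (2 * B) * B)
    by (apply Rmult_le_compat; try apply norm_nonneg; [assumption | unfold B; lra]).
  replace (A * (eps / (2 * A))) with (eps / 2) in * by (field; lra).
  replace (eps / (2 * B) * B) with (eps / 2) in * by (field; lra). lra.
Qed.

Lemma Hcont_slice (I : H) (u v : R -> R) :
  sphere I -> (forall t, continuous u t) -> (forall t, continuous v t) -> Hcont (fun t => slice I (u t)
    (v t)).
Proof.
  intros hI hu hv x eps heps. assert (he2 : 0 < eps / 2) by lra.
  destruct (proj1 (filterlim_locally _ _) (hu x) (mkposreal _ he2)) as [d1 b1].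
  destruct (proj1 (filterlim_locally _ _) (hv x) (mkposreal _ he2)) as [d2 b2].
  exists (Rmin d1 d2). split; [apply Rmin_pos; apply cond_pos |]. intros x' hx'.
  assert (c1 : Rabs (u x' - u x) < eps / 2) by exact (b1 x' (Rlt_le_trans _ _ _ hx' (Rmin_l _ _))).
  assert (c2 : Rabs (v x' - v x) < eps / 2) by exact (b2 x' (Rlt_le_trans _ _ _ hx' (Rmin_r _ _))).
  rewrite slice_minus. eapply Rle_trans; [apply norm_slice_le, hI |]. lra.
Qed.

Lemma Hcont_pow (g : R -> H) (n : nat) : Hcont g -> Hcont (fun t => Hpow (g t) n).
Proof.
  intros hg. induction n as [| n IH]; cbn [Hpow]; [apply Hcont_const | apply Hcont_mult; assumption].
Qed.

Definition HInt (g : R -> H) : H :=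
  mkH (RInt (fun t => re (g t)) 0 (2 * PI)) (RInt (fun t => im_i (g t)) 0 (2 * PI))
      (RInt (fun t => im_j (g t)) 0 (2 * PI)) (RInt (fun t => im_k (g t)) 0 (2 * PI)).

Lemma Hcont_ex_RInt (g : R -> H) (pr : H -> R) (a b : R) :
  lipschitz_linear pr -> Hcont g -> ex_RInt (fun t => pr (g t)) a b.
Proof.
  intros hpr hg. apply (@ex_RInt_continuous R_CompleteNormedModule). intros z _.
  apply Hcont_coord; assumption.
Qed.

Lemma RInt_coord_combination (g : R -> H) (x1 x2 x3 x4 : R) (v : R -> R) :
  Hcont g ->
  (forall t, v t = x1 * re (g t) + x2 * im_i (g t) + x3 * im_j (g t) + x4 * im_k (g t)) ->
  RInt v 0 (2 * PI) = x1 * re (HInt g) + x2 * im_i (HInt g) + x3 * im_j (HInt g) + x4 * im_k (HInt g).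
Proof.
  intros hg hv. apply is_RInt_unique.
  destruct coord_lipschitz_linear as (l1 & l2 & l3 & l4).
  pose proof (fun pr l => RInt_correct _ _ _ (Hcont_ex_RInt g pr 0 (2 * PI) l hg)) as C.
  pose proof (@is_RInt_scal R_NormedModule _ _ _ x1 _ (C _ l1)) as k1.
  pose proof (@is_RInt_scal R_NormedModule _ _ _ x2 _ (C _ l2)) as k2.
  pose proof (@is_RInt_scal R_NormedModule _ _ _ x3 _ (C _ l3)) as k3.
  pose proof (@is_RInt_scal R_NormedModule _ _ _ x4 _ (C _ l4)) as k4.
  eapply is_RInt_ext; [intros t _; symmetry; apply hv |].
  exact (is_RInt_plus _ _ _ _ _ _ (is_RInt_plus _ _ _ _ _ _ (is_RInt_plus _ _ _ _ _ _ k1 k2) k3) k4).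
Qed.

Lemma HInt_mult_l (c : H) (g : R -> H) : Hcont g -> HInt (fun t => c *h g t) = c *h HInt g.
Proof.
  intros hg. unfold HInt at 1. apply H_ext; coord.
  - rewrite (RInt_coord_combination g (re c) (- im_i c) (- im_j c) (- im_k c)); [ring | exact hg |];
      intros; coord; ring.
  - rewrite (RInt_coord_combination g (im_i c) (re c) (- im_k c) (im_j c)); [ring | exact hg |];
      intros; coord; ring.
  - rewrite (RInt_coord_combination g (im_j c) (im_k c) (re c) (- im_i c)); [ring | exact hg |];
      intros; coord; ring.
  - rewrite (RInt_coord_combination g (im_k c) (- im_j c) (im_i c) (re c)); [ring | exact hg |];
      intros; coord; ring.
Qed.

Lemma HInt_mult_r (c : H) (g : R -> H) : Hcont g -> HInt (fun t => g t *h c) = HInt g *h c.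
Proof.
  intros hg. unfold HInt at 1. apply H_ext; coord.
  - rewrite (RInt_coord_combination g (re c) (- im_i c) (- im_j c) (- im_k c)); [ring | exact hg |];
      intros; coord; ring.
  - rewrite (RInt_coord_combination g (im_i c) (re c) (im_k c) (- im_j c)); [ring | exact hg |];
      intros; coord; ring.
  - rewrite (RInt_coord_combination g (im_j c) (- im_k c) (re c) (im_i c)); [ring | exact hg |];
      intros; coord; ring.
  - rewrite (RInt_coord_combination g (im_k c) (im_j c) (- im_i c) (re c)); [ring | exact hg |];
      intros; coord; ring.
Qed.

Lemma HInt_plus (g k : R -> H) : Hcont g -> Hcont k -> HInt (fun t => g t +h k t) = HInt g +h HInt k.
Proof.
  intros hg hk. destruct coord_lipschitz_linear as (l1 & l2 & l3 & l4).
  assert (A : forall u v : R -> R, ex_RInt u 0 (2 * PI) -> ex_RInt v 0 (2 * PI) ->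
     RInt (fun t => u t + v t) 0 (2 * PI) = RInt u 0 (2 * PI) + RInt v 0 (2 * PI))
    by (intros; apply (@RInt_plus R_CompleteNormedModule); assumption).
  unfold HInt. apply H_ext; coord; rewrite <- A by (apply Hcont_ex_RInt; assumption);
    apply RInt_ext; intros; coord; reflexivity.
Qed.

Lemma HInt_ext (g k : R -> H) : (forall t, g t = k t) -> HInt g = HInt k.
Proof. intros E. apply functional_extensionality in E. subst; reflexivity. Qed.

Lemma norm_HInt_le (g : R -> H) (M : R) :
  Hcont g -> (forall t, norm (g t) <= M) -> norm (HInt g) <= 4 * PI * M.
Proof.
  intros hg hM. replace (4 * PI * M) with (2 * ((2 * PI - 0) * M)) by ring.
  destruct coord_lipschitz_linear as (l1 & l2 & l3 & l4). pose proof PI_RGT_0.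
  assert (A : forall pr, lipschitz_linear pr -> Rabs (RInt (fun t => pr (g t)) 0 (2 * PI)) <=
    (2 * PI - 0) * M).
  { intros pr l. apply abs_RInt_le_const; [lra | apply Hcont_ex_RInt; assumption |].
    intros t _. eapply Rle_trans; [apply l | apply hM]. }
  unfold HInt. apply norm_le_coord; coord; apply A; assumption.
Qed.

Lemma is_derive_bound (g : R -> R) (x l : R) :
  is_derive g x l -> forall eps, 0 < eps -> exists delta, 0 < delta /\ forall x',
    Rabs (x' - x) < delta -> Rabs (g x' - g x - (x' - x) * l) <= eps * Rabs (x' - x).
Proof.
  intros [_ hd] eps heps. specialize (hd x (fun P hP => hP) (mkposreal eps heps)).
  destruct hd as [dl k]. exists dl. split; [apply cond_pos |]. intros x' hx'. exact (k x' hx').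
Qed.

Definition circle (I : H) (r t : R) : H := slice I (r * cos t) (r * sin t).

Lemma norm_circle (I : H) (r t : R) : sphere I -> 0 <= r -> norm (circle I r t) = r.
Proof.
  intros hI hr. unfold circle. rewrite norm_slice by exact hI.
  replace ((r * cos t) ^ 2 + (r * sin t) ^ 2) with (r ^ 2).
  - apply sqrt_pow2, hr.
  - pose proof (sin2_cos2 t) as e. unfold Rsqr in e. nra.
Qed.

Lemma continuous_mult_cos_sin (r t : R) :
  continuous (fun t => r * cos t) t /\ continuous (fun t => r * sin t) t.
Proof.
  split.
  - apply (ex_derive_continuous (fun t : R => r * cos t) t). auto_derive. exact Logic.I.
  - apply (ex_derive_continuous (fun t : R => r * sin t) t). auto_derive. exact Logic.I.
Qed.

Lemma Hcont_circle (I : H) (r : R) : sphere I -> Hcont (circle I r).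
Proof.
  intros hI. apply Hcont_slice; [exact hI | |]; intros t; apply continuous_mult_cos_sin.
Qed.

Lemma circle_derivative (I : H) (r t : R) : sphere I -> 0 <= r <= 1 ->
  forall eps, 0 < eps -> exists delta, 0 < delta /\ forall t', Rabs (t' - t) < delta ->
    norm (circle I r t' -h circle I r t -h scal (t' - t) (I *h circle I r t)) <= eps * Rabs (t' - t) /\
    Rabs (r * cos t' - r * cos t) <= 2 * Rabs (t' - t) /\ Rabs (r * sin t' - r * sin t) <= 2 * Rabs (t' - t).
Proof.
  intros hI hr eps heps.
  (* The error eps / 2 serves each of the two coordinates; the error 1, added to derivatives of
     modulus at most 1, gives the Lipschitz constant 2. *)
  assert (he : 0 < Rmin 1 (eps / 2)) by (apply Rmin_pos; lra).
  pose proof (Rmin_l 1 (eps / 2)). pose proof (Rmin_r 1 (eps / 2)).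
  destruct (is_derive_bound cos t (- sin t) (is_derive_cos t) _ he) as (d1 & p1 & b1).
  destruct (is_derive_bound sin t (cos t) (is_derive_sin t) _ he) as (d2 & p2 & b2).
  exists (Rmin d1 d2). split; [apply Rmin_pos; assumption |]. intros t' ht'.
  assert (c1 := b1 t' (Rlt_le_trans _ _ _ ht' (Rmin_l _ _))).
  assert (c2 := b2 t' (Rlt_le_trans _ _ _ ht' (Rmin_r _ _))).
  set (e := Rmin 1 (eps / 2)) in *. set (s := Rabs (t' - t)) in *.
  assert (hs : 0 <= s) by apply Rabs_pos.
  set (uc := cos t' - cos t - (t' - t) * - sin t) in *. set (us := sin t' - sin t - (t' - t) * cos t) in *.
  assert (rc : forall x, Rabs x <= e * s -> Rabs (r * x) <= e * s).
  { intros x hx. rewrite Rabs_mult, (Rabs_pos_eq r) by lra. pose proof (Rabs_pos x). nra. }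
  split; [| split].
  - replace (circle I r t' -h circle I r t -h scal (t' - t) (I *h circle I r t))
      with (slice I (r * uc) (r * us)).
    + eapply Rle_trans; [apply norm_slice_le, hI |]. apply rc in c1, c2.
      assert (e * s <= eps / 2 * s) by (apply Rmult_le_compat_r; assumption). lra.
    + unfold circle, slice, uc, us. rewrite Hmult_plus_r, Hmult_scal_r, hI. quat.
  - replace (r * cos t' - r * cos t) with (r * uc - (t' - t) * (r * sin t)) by (unfold uc; ring).
    eapply Rle_trans; [apply Rabs_triang |]. rewrite Rabs_Ropp, (Rabs_mult (t' - t)). fold s.
    assert (Rabs (r * sin t) <= 1).
    { rewrite Rabs_mult, (Rabs_pos_eq r) by lra. pose proof (SIN_bound t).
      assert (Rabs (sin t) <= 1) by (apply Rabs_le; lra). pose proof (Rabs_pos (sin t)). nra. }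
    apply rc in c1. nra.
  - replace (r * sin t' - r * sin t) with (r * us + (t' - t) * (r * cos t)) by (unfold us; ring).
    eapply Rle_trans; [apply Rabs_triang |]. rewrite (Rabs_mult (t' - t)). fold s.
    assert (Rabs (r * cos t) <= 1).
    { rewrite Rabs_mult, (Rabs_pos_eq r) by lra. pose proof (COS_bound t).
      assert (Rabs (cos t) <= 1) by (apply Rabs_le; lra). pose proof (Rabs_pos (cos t)). nra. }
    apply rc in c2. nra.
Qed.

(** * Cauchy's formula on a slice *)

(* The point at time t of the contraction of the circle of radius r to a + b I. *)
Definition contraction (I : H) (a b r t s : R) : H :=
  slice I (a + t * (r * cos s - a)) (b + t * (r * sin s - b)).

Lemma contraction_1 (I : H) (a b r s : R) : contraction I a b r 1 s = circle I r s.
Proof. unfold contraction, circle. f_equal; ring. Qed.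

Lemma norm_contraction (I : H) (a b r t s : R) :
  sphere I -> norm (slice I a b) <= r -> 0 <= t <= 1 -> norm (contraction I a b r t s) <= r.
Proof.
  intros hI hz ht. assert (hr : 0 <= r) by (pose proof (norm_nonneg (slice I a b)); lra).
  replace (contraction I a b r t s) with (scal (1 - t) (slice I a b) +h scal t (circle I r s))
    by (unfold contraction, circle, slice; quat).
  eapply Rle_trans; [apply norm_plus_le |].
  rewrite !norm_scal_H, norm_circle, !Rabs_pos_eq by (try assumption; lra). nra.
Qed.

Lemma contraction_diff_s (I : H) (a b r t s s' : R) :
  contraction I a b r t s' = contraction I a b r t s +h scal t (circle I r s' -h circle I r s).
Proof. unfold contraction, circle, slice; quat. Qed.

Lemma contraction_diff_t (I : H) (a b r t t' s : R) :
  contraction I a b r t' s = contraction I a b r t s +h scal (t' - t) (circle I r s -h slice I a b).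
Proof. unfold contraction, circle, slice; quat. Qed.

Lemma slice_coord_le (I : H) (a b : R) : sphere I -> Rabs a <= norm (slice I a b) /\ Rabs b <=
  norm (slice I a b).
Proof.
  intros hI. rewrite norm_slice by exact hI.
  split; rewrite <- sqrt_Rsqr_abs; apply sqrt_le_1_alt; unfold Rsqr; nra.
Qed.

Lemma contraction_lipschitz (I : H) (a b r t s : R) :
  sphere I -> 0 <= r <= 1 -> norm (slice I a b) <= 1 -> 0 <= t <= 1 ->
  exists delta, 0 < delta /\ forall t' s', Rabs (s' - s) < delta ->
    Rabs (a + t' * (r * cos s' - a) - (a + t * (r * cos s - a))) <= 2 * (Rabs (t' - t) + Rabs (s' - s)) /\
    Rabs (b + t' * (r * sin s' - b) - (b + t * (r * sin s - b))) <= 2 * (Rabs (t' - t) + Rabs (s' - s)).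
Proof.
  intros hI hr hz ht.
  destruct (slice_coord_le I a b hI) as [ha hb].
  destruct (circle_derivative I r s hI hr 1) as (dl & p & h); [lra |].
  exists dl. split; [exact p |]. intros t' s' hs'. destruct (h s' hs') as (_ & c1 & c2).
  assert (B : forall u v v' : R, Rabs u <= 1 -> Rabs v' <= 1 -> Rabs (v' - v) <= 2 * Rabs (s' - s) ->
     Rabs (u + t' * (v' - u) - (u + t * (v - u))) <= 2 * (Rabs (t' - t) + Rabs (s' - s))).
  { intros u v v' hu hv' hv.
    replace (u + t' * (v' - u) - (u + t * (v - u))) with ((t' - t) * (v' - u) + t * (v' - v)) by ring.
    eapply Rle_trans; [apply Rabs_triang |]. rewrite !Rabs_mult, (Rabs_pos_eq t) by lra.
    assert (Rabs (v' - u) <= 2).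
    { eapply Rle_trans; [apply Rabs_triang |]. rewrite Rabs_Ropp. lra. }
    pose proof (Rabs_pos (t' - t)). pose proof (Rabs_pos (v' - v)).
    rewrite Rmult_plus_distr_l. apply Rplus_le_compat; nra. }
  assert (T : forall x, -1 <= x <= 1 -> Rabs (r * x) <= 1).
  { intros x hx. rewrite Rabs_mult, (Rabs_pos_eq r) by lra.
    assert (Rabs x <= 1) by (apply Rabs_le; lra). pose proof (Rabs_pos x). nra. }
  split; apply B; try lra; apply T; [apply COS_bound | apply SIN_bound].
Qed.

Lemma contraction_taylor (f : H -> H) (I : H) (a b r t s : R) (d : H) :
  sphere I -> 0 <= r <= 1 -> norm (slice I a b) <= 1 -> 0 <= t <= 1 ->
  slice_diff f I (a + t * (r * cos s - a)) (b + t * (r * sin s - b)) d ->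
  forall eps, 0 < eps -> exists delta, 0 < delta /\ forall t' s',
    Rabs (t' - t) < delta -> Rabs (s' - s) < delta ->
    norm (f (contraction I a b r t' s') -h f (contraction I a b r t s) -h
          (contraction I a b r t' s' -h contraction I a b r t s) *h d)
      <= eps * (Rabs (t' - t) + Rabs (s' - s)).
Proof.
  intros hI hr hz ht hd eps heps.
  destruct (contraction_lipschitz I a b r t s hI hr hz ht) as (d2 & p2 & L).
  (* Each of the two coordinates of the contraction moves by at most 2 (|t' - t| + |s' - s|), which
     accounts for both divisions by 4. *)
  destruct (hd (eps / 4)) as (d1 & p1 & b1); [lra |].
  exists (Rmin (d1 / 4) d2). split; [apply Rmin_pos; lra |]. intros t' s' ht' hs'.
  pose proof (Rmin_l (d1 / 4) d2). pose proof (Rmin_r (d1 / 4) d2).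
  destruct (L t' s') as [B1 B2]; [lra |].
  unfold contraction at 3 4. rewrite slice_minus.
  eapply Rle_trans; [apply b1; lra |].
  replace (eps * (Rabs (t' - t) + Rabs (s' - s))) with (eps / 4 * (4 * (Rabs (t' - t) + Rabs (s' -
    s)))) by field.
  apply Rmult_le_compat_l; lra.
Qed.

Lemma slice_diff_continuous (f : H -> H) (I : H) (x y : R) (d : H) :
  sphere I -> slice_diff f I x y d ->
  forall eps, 0 < eps -> exists delta, 0 < delta /\ forall x' y',
    Rabs (x' - x) < delta -> Rabs (y' - y) < delta -> norm (f (slice I x' y') -h f (slice I x y)) <= eps.
Proof.
  intros hI hd eps heps. destruct (hd 1 Rlt_0_1) as (dl & p & h).
  set (c := 2 * (1 + norm d)). assert (hc : 0 < c) by (unfold c; pose proof (norm_nonneg d); lra).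
  exists (Rmin dl (eps / c)). split; [apply Rmin_pos; [exact p | apply Rdiv_lt_0_compat; lra] |].
  intros x' y' hx hy. pose proof (Rmin_l dl (eps / c)). pose proof (Rmin_r dl (eps / c)).
  assert (h' := h x' y' ltac:(lra) ltac:(lra)).
  replace (f (slice I x' y') -h f (slice I x y)) with
    ((f (slice I x' y') -h f (slice I x y) -h slice I (x' - x) (y' - y) *h d) +h slice I (x' - x) (y' -
      y) *h d) by quat.
  eapply Rle_trans; [apply norm_plus_le |]. rewrite norm_Hmult.
  set (u := Rabs (x' - x) + Rabs (y' - y)) in *.
  assert (hu : u <= 2 * (eps / c)) by (unfold u; lra).
  assert (hn : norm (slice I (x' - x) (y' - y)) * norm d <= u * norm d)
    by (apply Rmult_le_compat_r; [apply norm_nonneg | apply norm_slice_le, hI]).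
  apply Rle_trans with (u * (1 + norm d)); [lra |].
  replace eps with (2 * (eps / c) * (1 + norm d)) by (unfold c; field; unfold c in hc; lra).
  apply Rmult_le_compat_r; [pose proof (norm_nonneg d); lra | exact hu].
Qed.

Lemma contraction_continuous (f : H -> H) (I : H) (a b r t s : R) :
  sphere I -> 0 <= r < 1 -> norm (slice I a b) <= r -> 0 <= t <= 1 ->
  (forall x y, ball1 (slice I x y) -> exists d, slice_diff f I x y d) ->
  forall eps, 0 < eps -> exists delta, 0 < delta /\ forall t' s',
    Rabs (t' - t) < delta -> Rabs (s' - s) < delta ->
    norm (f (contraction I a b r t' s') -h f (contraction I a b r t s)) <= eps.
Proof.
  intros hI hr hz ht hf eps heps.
  destruct (hf (a + t * (r * cos s - a)) (b + t * (r * sin s - b))) as [d hd].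
  { unfold ball1. pose proof (norm_contraction I a b r t s hI hz ht). unfold contraction in *. lra. }
  destruct (contraction_lipschitz I a b r t s hI ltac:(lra) ltac:(lra) ht) as (d2 & p2 & L).
  destruct (slice_diff_continuous f I _ _ d hI hd eps heps) as (d1 & p1 & b1).
  exists (Rmin (d1 / 4) d2). split; [apply Rmin_pos; lra |]. intros t' s' ht' hs'.
  pose proof (Rmin_l (d1 / 4) d2). pose proof (Rmin_r (d1 / 4) d2).
  destruct (L t' s') as [B1 B2]; [lra |].
  apply b1; lra.
Qed.

(* w / (w - z) for w = r e^{Is} and z = a + b I. *)
Definition cauchy_kernel (I : H) (a b r s : R) : H :=
  circle I r s *h slice I ((r * cos s - a) / ((r * cos s - a) ^ 2 + (r * sin s - b) ^ 2))
                          (- (r * sin s - b) / ((r * cos s - a) ^ 2 + (r * sin s - b) ^ 2)).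

(** All the factors lie in the commutative plane of I, and |w - z| >= r - |z| > 0 gives both the
    nonvanishing of the denominator and the bound. *)
Lemma cauchy_kernel_spec (I : H) (a b r s : R) :
  sphere I -> norm (slice I a b) < r ->
  cauchy_kernel I a b r s *h (circle I r s -h slice I a b) = circle I r s /\
  slice I a b *h cauchy_kernel I a b r s = cauchy_kernel I a b r s *h slice I a b /\
  0 < (r * cos s - a) ^ 2 + (r * sin s - b) ^ 2 /\
  norm (cauchy_kernel I a b r s) <= r / (r - norm (slice I a b)).
Proof.
  intros hI hz. pose proof (norm_nonneg (slice I a b)) as h0.
  assert (E : circle I r s -h slice I a b = slice I (r * cos s - a) (r * sin s - b)) by (unfold circle;
    apply slice_minus).
  assert (n1 : r - norm (slice I a b) <= norm (circle I r s -h slice I a b)).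
  { rewrite <- (norm_circle I r s hI) at 1 by lra. apply norm_minus_ge. }
  set (x := r * cos s - a) in *. set (y := r * sin s - b) in *.
  assert (hD : 0 < x ^ 2 + y ^ 2).
  { rewrite E, (norm_slice I x y hI) in n1.
    destruct (Rle_lt_dec (x ^ 2 + y ^ 2) 0) as [k | k]; [| exact k].
    rewrite (sqrt_neg_0 _ k) in n1. lra. }
  assert (K : cauchy_kernel I a b r s *h (circle I r s -h slice I a b) = circle I r s).
  { unfold cauchy_kernel. fold x y. rewrite E, <- Hmult_assoc.
    assert (P : slice I (x / (x ^ 2 + y ^ 2)) (- y / (x ^ 2 + y ^ 2)) *h slice I x y = Hone).
    { unfold slice. rewrite !Hmult_plus_l, !Hmult_plus_r, !Hmult_scal_l, !Hmult_scal_r, hI.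
      apply H_ext; coord; field; lra. }
    rewrite P. apply Hmult_one_r. }
  split; [exact K |]. split; [| split; [exact hD |]].
  - unfold cauchy_kernel, circle. rewrite Hmult_assoc, (slice_comm I a b), <- !Hmult_assoc,
      (slice_comm I a b).
    reflexivity.
  - assert (N : norm (cauchy_kernel I a b r s) * norm (circle I r s -h slice I a b) = r).
    { rewrite <- norm_Hmult, K. apply norm_circle; [exact hI | lra]. }
    apply Rmult_le_reg_r with (r - norm (slice I a b)); [lra |].
    replace (r / (r - norm (slice I a b)) * (r - norm (slice I a b))) with r by (field; lra).
    pose proof (norm_nonneg (cauchy_kernel I a b r s)). nra.
Qed.

Lemma Hcont_cauchy_kernel (I : H) (a b r : R) :
  sphere I -> norm (slice I a b) < r -> Hcont (cauchy_kernel I a b r).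
Proof.
  intros hI hz. apply Hcont_mult; [apply Hcont_circle, hI |].
  apply Hcont_slice; [exact hI | |]; intros t.
  - apply (ex_derive_continuous (fun s : R => (r * cos s - a) / ((r * cos s - a) ^ 2 + (r * sin s - b)
      ^ 2)) t).
    auto_derive. pose proof (cauchy_kernel_spec I a b r t hI hz) as (_ & _ & h & _). cbn [pow] in h.
      repeat split; lra.
  - apply (ex_derive_continuous (fun s : R => - (r * sin s - b) / ((r * cos s - a) ^ 2 + (r * sin s -
      b) ^ 2)) t).
    auto_derive. pose proof (cauchy_kernel_spec I a b r t hI hz) as (_ & _ & h & _). cbn [pow] in h.
      repeat split; lra.
Qed.

Lemma Hcont_contraction (f : H -> H) (I : H) (a b r t : R) :
  sphere I -> 0 <= r < 1 -> norm (slice I a b) <= r -> 0 <= t <= 1 ->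
  (forall x y, ball1 (slice I x y) -> exists d, slice_diff f I x y d) ->
  Hcont (fun s => f (contraction I a b r t s)).
Proof.
  intros hI hr hz ht hf s eps heps.
  destruct (contraction_continuous f I a b r t s hI hr hz ht hf eps heps) as (dl & p & h).
  exists dl. split; [exact p |]. intros s' hs'. apply h; [| exact hs'].
  rewrite Rminus_diag, Rabs_R0. exact p.
Qed.

(* With gamma the contraction and K the Cauchy kernel, the form K f(gamma) ds - (I f(gamma) / t) dt is closed;
   as K does not depend on t, letting t -> 0 turns its integral over t = 1 into Cauchy's formula. *)
Lemma cauchy_form_closed (f : H -> H) (I : H) (a b r tau t s : R) (pr : H -> R) (d : H) :
  sphere I -> 0 <= r <= 1 -> norm (slice I a b) < r -> 0 < tau <= t -> t <= 1 -> lipschitz_linear pr ->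
  slice_diff f I (a + t * (r * cos s - a)) (b + t * (r * sin s - b)) d ->
  exists (b0 : R) (chi psi : R -> R), forall eps, 0 < eps -> exists delta, 0 < delta /\
    forall t' s', tau <= t' <= 1 -> Rabs (t' - t) < delta -> Rabs (s' - s) < delta ->
      Rabs (pr (scal (/ t') (opp I *h f (contraction I a b r t' s')) : H) - chi t' - b0 * (s' - s))
        <= eps * (Rabs (t' - t) + Rabs (s' - s)) /\
      Rabs (pr (cauchy_kernel I a b r s' *h f (contraction I a b r t' s')) - psi s' - b0 * (t' - t))
        <= eps * (Rabs (t' - t) + Rabs (s' - s)).
Proof.
  intros hI hr hz ht ht1 (pr1 & pr2 & pr3 & pr4) hd.
  set (g := contraction I a b r). set (w := circle I r). set (K := cauchy_kernel I a b r).
  set (f0 := f (g t s)).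
  (* The common mixed derivative. Since d(gamma)/ds = t I w, the s-derivative of -I f(gamma) / t is
     -I I w d = w d; since d(gamma)/dt = w - z, the t-derivative of K f(gamma) is K (w - z) d = w
     d. *)
  exists (pr (w s *h d)).
  (* These two functions replace f(gamma) by its first-order expansion along s' = s and along t' =
     t, but keep the factors 1 / t' and K exact; neither factor is ever differentiated. *)
  exists (fun t' => pr (scal (/ t') (opp I *h (f0 +h (g t' s -h g t s) *h d)) : H)).
  exists (fun s' => pr (K s' *h (f0 +h (g t s' -h g t s) *h d))).
  intros eps heps.
  set (kap := r / (r - norm (slice I a b)) + 1). set (nd := norm d + 1).
  assert (hn : 0 < nd) by (unfold nd; pose proof (norm_nonneg d); lra).
  pose proof (norm_nonneg (slice I a b)) as hz0.
  assert (hk : 0 < kap).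
  { unfold kap. assert (0 < r / (r - norm (slice I a b))) by (apply Rdiv_lt_0_compat; lra). lra. }
  (* The Taylor error of f(gamma) is multiplied by 1 / t' <= 1 / tau in the first form and by |K| <=
     kap in the second. *)
  set (e1 := Rmin (eps * tau / 2) (eps / (2 * kap))).
  assert (he1 : 0 < e1).
  { unfold e1. apply Rmin_pos; [| apply Rdiv_lt_0_compat; lra]. assert (0 < eps * tau) by nra. lra. }
  assert (he1a : e1 <= eps * tau / 2) by apply Rmin_l.
  assert (he1b : kap * e1 <= eps / 2).
  { replace (eps / 2) with (kap * (eps / (2 * kap))) by (field; lra). apply Rmult_le_compat_l;
      [lra | apply Rmin_r]. }
  set (e2 := eps / (4 * nd)). assert (he2 : 0 < e2) by (apply Rdiv_lt_0_compat; lra).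
  assert (he2' : e2 * nd = eps / 4) by (unfold e2; field; lra).
  destruct (contraction_taylor f I a b r t s d hI hr ltac:(lra) ltac:(lra) hd e1 he1) as (d1 & p1 & T).
  destruct (circle_derivative I r s hI hr e2 he2) as (d2 & p2 & C).
  fold g in T. fold w in C. clearbody e1 e2.
  (* The last bound serves the cross term (t' - t) (w(s') - w(s)) d of the second estimate, where
     |w(s') - w(s)| <= 4 |s' - s|. *)
  exists (Rmin d1 (Rmin d2 (eps / (16 * nd)))).
  assert (he3 : 0 < eps / (16 * nd)) by (apply Rdiv_lt_0_compat; lra).
  split; [repeat apply Rmin_pos; assumption |].
  intros t' s' ht' hdt hds.
  set (m := Rmin d2 (eps / (16 * nd))) in *.
  pose proof (Rmin_l d1 m) as m1. pose proof (Rmin_r d1 m) as m2.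
  assert (m3 : m <= d2) by apply Rmin_l. assert (m4 : m <= eps / (16 * nd)) by apply Rmin_r.
  assert (T' := T t' s' ltac:(lra) ltac:(lra)). fold f0 in T'.
  destruct (C s') as (C1 & C2 & C3); [lra |]. clear T C hd.
  set (u := Rabs (t' - t)) in *. set (v := Rabs (s' - s)) in *.
  assert (hu : 0 <= u) by apply Rabs_pos. assert (hv : 0 <= v) by apply Rabs_pos.
  set (err := f (g t' s') -h f0 -h (g t' s' -h g t s) *h d) in *.
  set (ew := w s' -h w s -h scal (s' - s) (I *h w s)) in *.
  assert (hdw : norm (w s' -h w s) <= 4 * v).
  { unfold w, circle. rewrite slice_minus. eapply Rle_trans; [apply norm_slice_le, hI |]. lra. }
  assert (NI : norm (opp I : H) = 1).
  { rewrite (@norm_opp R_AbsRing H). apply sphere_spec, hI. }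
  assert (prm : forall p q : H, pr (p -h q) = pr p - pr q) by (intros; unfold minus; rewrite pr2, pr4; ring).
  split.
  - assert (E : pr (scal (/ t') (opp I *h f (g t' s')) : H) - pr (scal (/ t') (opp I *h (f0 +h
      (g t' s -h g t s) *h d)) : H)
                  - pr (w s *h d) * (s' - s)
                = pr (scal (/ t') (opp I *h err) +h opp I *h ew *h d)).
    { rewrite Rmult_comm, <- pr3, <- !prm. f_equal.
      assert (Ew : opp I *h ew = opp I *h (w s' -h w s) -h scal (s' - s) (w s)).
      { unfold ew. replace (opp I *h (w s' -h w s -h scal (s' - s) (I *h w s)))
          with (opp I *h (w s' -h w s) +h scal (s' - s) (I *h I *h w s)) by quat.
        rewrite hI. quat. }
      assert (Eg : g t' s' = g t' s +h scal t' (w s' -h w s)) by apply contraction_diff_s.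
      rewrite Ew. unfold err. generalize (f (g t' s')). rewrite Eg.
      generalize (w s') (w s) (g t' s) (g t s). clearbody f0. intros.
      apply H_ext; coord; field; lra. }
    rewrite E. eapply Rle_trans; [apply pr1 |]. eapply Rle_trans; [apply norm_plus_le |].
    rewrite norm_scal_H, !norm_Hmult, NI, !Rmult_1_l.
    rewrite (Rabs_pos_eq (/ t')) by (left; apply Rinv_0_lt_compat; lra).
    assert (A1 : / t' * norm err <= eps / 2 * (u + v)).
    { apply Rmult_le_reg_l with t'; [lra |]. rewrite <- Rmult_assoc, Rinv_r, Rmult_1_l by lra.
      apply Rle_trans with (eps * tau / 2 * (u + v)).
      - eapply Rle_trans; [exact T' |]. apply Rmult_le_compat_r; lra.
      - replace (t' * (eps / 2 * (u + v))) with (eps * t' / 2 * (u + v)) by field.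
        apply Rmult_le_compat_r; [lra |]. nra. }
    assert (A2 : norm ew * norm d <= e2 * v * nd).
    { apply Rmult_le_compat; try apply norm_nonneg; [exact C1 | unfold nd; lra]. }
    replace (e2 * v * nd) with (eps / 4 * v) in A2 by (rewrite <- he2'; ring).
    assert (0 <= eps * v) by nra. assert (0 <= eps * u) by nra. lra.
  - assert (E : pr (K s' *h f (g t' s')) - pr (K s' *h (f0 +h (g t s' -h g t s) *h d)) - pr (w s *h
      d) * (t' - t)
                = pr (K s' *h err +h scal (t' - t) ((w s' -h w s) *h d))).
    { rewrite (Rmult_comm _ (t' - t)), <- pr3, <- !prm. f_equal.
      destruct (cauchy_kernel_spec I a b r s' hI hz) as (Ek & _). fold K w in Ek.
      set (z := slice I a b) in *.
      assert (Eg : g t' s' = g t s' +h scal (t' - t) (w s' -h z)) by apply contraction_diff_t.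
      unfold err. generalize (f (g t' s')). rewrite Eg. intros X.
      replace (scal (t' - t) ((w s' -h w s) *h d) : H)
        with (scal (t' - t) ((K s' *h (w s' -h z) -h w s) *h d) : H) by (rewrite Ek; reflexivity).
      generalize (K s') (w s') (w s) (g t s') (g t s). clearbody f0 z. intros. quat. }
    rewrite E. eapply Rle_trans; [apply pr1 |]. eapply Rle_trans; [apply norm_plus_le |].
    rewrite norm_scal_H, !norm_Hmult. fold u.
    assert (hK : norm (K s') <= kap).
    { destruct (cauchy_kernel_spec I a b r s' hI hz) as (_ & _ & _ & h). unfold kap. fold K in h. lra. }
    assert (A1 : norm (K s') * norm err <= kap * (e1 * (u + v)))
      by (apply Rmult_le_compat; try apply norm_nonneg; assumption).
    assert (A2 : norm (w s' -h w s) * norm d <= 4 * v * nd).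
    { apply Rmult_le_compat; try apply norm_nonneg; [exact hdw | unfold nd; lra]. }
    assert (A3 : 4 * v * nd <= eps / 4).
    { replace (eps / 4) with (4 * (eps / (16 * nd)) * nd) by (field; lra).
      apply Rmult_le_compat_r; lra. }
    assert (A4 : u * (norm (w s' -h w s) * norm d) <= u * (eps / 4)) by (apply Rmult_le_compat_l; lra).
    assert (A5 : kap * (e1 * (u + v)) <= eps / 2 * (u + v)).
    { rewrite <- Rmult_assoc. apply Rmult_le_compat_r; lra. }
    assert (0 <= eps * v) by nra. assert (0 <= eps * u) by nra. lra.
Qed.

Lemma contraction_2PI (I : H) (a b r t : R) : contraction I a b r t (2 * PI) = contraction I a b r t 0.
Proof. unfold contraction. rewrite cos_2PI, sin_2PI, cos_0, sin_0. reflexivity. Qed.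

(** The closed form has zero circulation around [tau, 1] x [0, 2 pi]. The contraction is periodic in
    s, so the sides s = 0 and s = 2 pi cancel and the sides t = 1 and t = tau agree. The coefficient
    1 / t requires tau > 0. *)
Lemma cauchy_homotopy (f : H -> H) (I : H) (a b r tau : R) (pr : H -> R) :
  sphere I -> 0 <= r < 1 -> norm (slice I a b) < r -> 0 < tau <= 1 -> lipschitz_linear pr ->
  (forall x y, ball1 (slice I x y) -> exists d, slice_diff f I x y d) ->
  RInt (fun s => pr (cauchy_kernel I a b r s *h f (contraction I a b r 1 s))) 0 (2 * PI) =
  RInt (fun s => pr (cauchy_kernel I a b r s *h f (contraction I a b r tau s))) 0 (2 * PI).
Proof.
  intros hI hr hz ht hpr hf. pose proof PI_RGT_0 as hpi.
  pose (P := fun t s => pr (scal (/ t) (opp I *h f (contraction I a b r t s)) : H)).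
  pose (Q := fun t s => pr (cauchy_kernel I a b r s *h f (contraction I a b r t s))).
  assert (G : circulation P Q tau 1 0 (2 * PI) = 0).
  { apply goursat; [lra | lra | | |].
    - intros t s h1 h2. unfold P.
      apply continuous_ext with (fun t => / t * pr (opp I *h f (contraction I a b r t s))).
      { intros t'. destruct hpr as (_ & _ & p3 & _). rewrite p3. reflexivity. }
      apply (@continuous_mult R_UniformSpace R_AbsRing).
      + apply (ex_derive_continuous (fun t : R => / t) t). auto_derive. lra.
      + destruct hpr as (p1 & p2 & _ & p4). apply continuous_of_bound. intros eps heps.
        destruct (contraction_continuous f I a b r t s hI hr ltac:(lra) ltac:(lra) hf eps heps) as (dl
          & p & h).
        exists dl. split; [exact p |]. intros t' ht'.
        replace (pr (opp I *h f (contraction I a b r t' s)) - pr (opp I *h f (contraction I a b r t s)))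
          with (pr (opp I *h (f (contraction I a b r t' s) -h f (contraction I a b r t s)))).
        * eapply Rle_trans; [apply p1 |]. rewrite norm_Hmult, (@norm_opp R_AbsRing H).
          rewrite (proj2 (sphere_spec I hI)), Rmult_1_l. apply h; [exact ht' |].
          rewrite Rminus_diag, Rabs_R0. exact p.
        * replace (opp I *h (f (contraction I a b r t' s) -h f (contraction I a b r t s)))
            with (opp I *h f (contraction I a b r t' s) -h opp I *h f (contraction I a b r t s)) by quat.
          unfold minus. rewrite p2, p4. ring.
    - intros t s h1 h2. unfold Q. apply (Hcont_coord (fun s => cauchy_kernel I a b r s *h
        f (contraction I a b r t s))); [exact hpr |].
      apply Hcont_mult; [apply Hcont_cauchy_kernel; assumption |].
      apply Hcont_contraction; try assumption; lra.
    - intros t s h1 h2.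
      destruct (hf (a + t * (r * cos s - a)) (b + t * (r * sin s - b))) as [d hd].
      { unfold ball1. pose proof (norm_contraction I a b r t s hI ltac:(lra) ltac:(lra)).
          unfold contraction in *. lra. }
      destruct (cauchy_form_closed f I a b r tau t s pr d hI ltac:(lra) hz ltac:(lra) ltac:(lra) hpr hd)
        as (b0 & chi & psi & h).
      exists b0, chi, psi. intros eps heps. destruct (h eps heps) as (dl & p & k).
      exists dl. split; [exact p |]. intros t' s' k1 k2 k3 k4. apply k; assumption. }
  unfold circulation in G.
  assert (E : RInt (fun t => P t (2 * PI)) tau 1 = RInt (fun t => P t 0) tau 1).
  { apply RInt_ext. intros t _. unfold P. rewrite contraction_2PI. reflexivity. }
  rewrite E in G. unfold Q in G. lra.
Qed.

(** By [cauchy_homotopy] the circle may be replaced by its contraction at any small tau, where f is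
    uniformly close to f(z), while the kernel keeps a bound independent of tau. The integral of the
    kernel is left unevaluated here; [HInt_cauchy_kernel] computes it. *)
Lemma cauchy_formula (f : H -> H) (I : H) (a b r : R) :
  sphere I -> 0 <= r < 1 -> norm (slice I a b) < r ->
  (forall x y, ball1 (slice I x y) -> exists d, slice_diff f I x y d) ->
  HInt (fun s => cauchy_kernel I a b r s *h f (circle I r s)) = HInt (cauchy_kernel I a b r) *h
    f (slice I a b).
Proof.
  intros hI hr hz hf.
  pose proof (Hcont_cauchy_kernel I a b r hI hz) as cK.
  assert (cG : forall t, 0 <= t <= 1 -> Hcont (fun s => f (contraction I a b r t s)))
    by (intros; apply Hcont_contraction; try assumption; lra).
  assert (E : forall tau, 0 < tau <= 1 ->
     HInt (fun s => cauchy_kernel I a b r s *h f (circle I r s)) =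
     HInt (fun s => cauchy_kernel I a b r s *h f (contraction I a b r tau s))).
  { intros tau ht. destruct coord_lipschitz_linear as (l1 & l2 & l3 & l4).
    rewrite (HInt_ext _ (fun s => cauchy_kernel I a b r s *h f (contraction I a b r 1 s)))
      by (intros; rewrite contraction_1; reflexivity).
    unfold HInt. apply H_ext; coord; apply cauchy_homotopy; assumption. }
  set (L := HInt (fun s => cauchy_kernel I a b r s *h f (circle I r s))) in *.
  set (z := slice I a b) in *. set (kap := r / (r - norm z)).
  pose proof (norm_nonneg z) as hz0. pose proof PI_RGT_0 as hpi.
  assert (hk : 0 < kap) by (unfold kap; apply Rdiv_lt_0_compat; lra).
  assert (B : forall eps, 0 < eps -> norm (L -h HInt (cauchy_kernel I a b r) *h f z) <= eps).
  { intros eps heps. set (e := eps / (4 * PI * kap)).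
    assert (h4 : 0 < 4 * PI * kap) by (apply Rmult_lt_0_compat; lra).
    assert (he : 0 < e) by (apply Rdiv_lt_0_compat; lra).
    destruct (hf a b) as [d hd]; [unfold ball1; fold z; lra |].
    destruct (slice_diff_continuous f I a b d hI hd e he) as (dl & p & h).
    (* Each coordinate of the contracted point differs from that of z by at most 2 tau <= dl / 2. *)
    set (tau := Rmin 1 (dl / 4)). assert (ht : 0 < tau <= 1).
    { split; [apply Rmin_pos; lra | apply Rmin_l]. }
    assert (ht' : tau <= dl / 4) by apply Rmin_r.
    set (Y := HInt (fun s => cauchy_kernel I a b r s *h (f (contraction I a b r tau s) -h f z))).
    set (X := HInt (cauchy_kernel I a b r) *h f z).
    assert (S : L = Y +h X).
    { unfold X. rewrite <- HInt_mult_r by exact cK. unfold Y. rewrite (E tau ht), <- HInt_plus.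
      - apply HInt_ext. intros s. generalize (f (contraction I a b r tau s)) (f z) (cauchy_kernel I a b
          r s). intros; quat.
      - apply Hcont_mult; [exact cK |]. unfold minus. apply Hcont_plus; [apply cG; lra | apply Hcont_const].
      - apply Hcont_mult; [exact cK | apply Hcont_const]. }
    replace (L -h X) with Y by (rewrite S; clearbody X Y; quat).
    unfold Y.
    replace eps with (4 * PI * (kap * e)) by (unfold e; field; lra).
    apply norm_HInt_le.
    - apply Hcont_mult; [exact cK |]. unfold minus. apply Hcont_plus; [apply cG; lra | apply Hcont_const].
    - intros s. rewrite norm_Hmult. apply Rmult_le_compat; try apply norm_nonneg.
      + apply cauchy_kernel_spec; assumption.
      + destruct (slice_coord_le I a b hI) as [ha hb]. fold z in ha, hb.
        assert (T : forall x, -1 <= x <= 1 -> Rabs (r * x) <= 1).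
        { intros x hx. rewrite Rabs_mult, (Rabs_pos_eq r) by lra.
          assert (Rabs x <= 1) by (apply Rabs_le; lra). pose proof (Rabs_pos x). nra. }
        assert (T' : forall x u, -1 <= x <= 1 -> Rabs u < 1 -> Rabs (u + tau * (r * x - u) - u) < dl).
        { intros x u hx hu. replace (u + tau * (r * x - u) - u) with (tau * (r * x - u)) by ring.
          rewrite Rabs_mult, (Rabs_pos_eq tau) by lra.
          assert (Rabs (r * x - u) <= 2).
          { eapply Rle_trans; [apply Rabs_triang |]. rewrite Rabs_Ropp. specialize (T x hx). lra. }
          pose proof (Rabs_pos (r * x - u)). nra. }
        apply h; apply T'; try apply COS_bound; try apply SIN_bound; lra. }
  assert (N : norm (L -h HInt (cauchy_kernel I a b r) *h f z) = 0).
  { apply Rle_antisym; [| apply norm_nonneg]. apply le_epsilon. intros eps heps. rewrite Rplus_0_l.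
      apply B, heps. }
  apply norm_eq0 in N. revert N. generalize (HInt (cauchy_kernel I a b r) *h f z) L. intros u v N.
  replace v with (v -h u +h u) by quat. rewrite N. quat.
Qed.

(** * Power series expansion of regular functions *)

Lemma RInt_cos_sin_multiple (k : nat) (x y : R) :
  (1 <= k)%nat -> RInt (fun s => x * cos (INR k * s) + y * sin (INR k * s)) 0 (2 * PI) = 0.
Proof.
  intros hk. assert (hk' : INR k <> 0) by (apply not_0_INR; lia).
  pose (F := fun s => x * sin (INR k * s) / INR k - y * cos (INR k * s) / INR k).
  apply is_RInt_unique.
  replace 0 with (minus (F (2 * PI)) (F 0)) at 2.
  - apply (is_RInt_derive F).
    + intros s _. unfold F. auto_derive; [exact Logic.I | field; exact hk'].
    + intros s _. apply (ex_derive_continuous (fun s : R => x * cos (INR k * s) + y * sin (INR k * s)) s).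
      auto_derive. exact Logic.I.
  - assert (E : F (2 * PI) = F 0).
    { unfold F. replace (INR k * (2 * PI)) with (0 + 2 * INR k * PI) by ring.
      rewrite sin_period, cos_period, Rmult_0_r. reflexivity. }
    change (F (2 * PI) - F 0 = 0). lra.
Qed.

(* The inverse of [circle I r s]. *)
Definition inv_circle (I : H) (r s : R) : H := slice I (cos s / r) (- sin s / r).

Lemma inv_circle_mult (I : H) (r s : R) : sphere I -> 0 < r -> inv_circle I r s *h circle I r s = Hone.
Proof.
  intros hI hr. unfold inv_circle, circle, slice.
  rewrite !Hmult_plus_l, !Hmult_plus_r, !Hmult_scal_l, !Hmult_scal_r, hI.
  pose proof (sin2_cos2 s) as e. unfold Rsqr in e.
  apply H_ext; coord; field_simplify; try lra.
Qed.

(** De Moivre's formula in the plane of I, for the angle -s. *)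
Lemma inv_circle_pow (I : H) (r s : R) (k : nat) : sphere I -> 0 < r ->
  Hpow (inv_circle I r s) k = slice I (cos (INR k * s) / r ^ k) (- sin (INR k * s) / r ^ k).
Proof.
  intros hI hr. induction k as [| k IH].
  - cbn [Hpow INR pow]. rewrite Rmult_0_l, cos_0, sin_0. unfold slice. apply H_ext; coord; field.
  - cbn [Hpow]. rewrite IH, S_INR. replace ((INR k + 1) * s) with (s + INR k * s) by ring.
    rewrite cos_plus, sin_plus. unfold inv_circle, slice.
    rewrite !Hmult_plus_l, !Hmult_plus_r, !Hmult_scal_l, !Hmult_scal_r, hI. cbn [pow].
    assert (r ^ k <> 0) by (apply pow_nonzero; lra).
    apply H_ext; coord; field; lra.
Qed.

Lemma norm_inv_circle (I : H) (r s : R) : sphere I -> 0 < r -> norm (inv_circle I r s) = / r.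
Proof.
  intros hI hr. pose proof (f_equal (@norm R_AbsRing H) (inv_circle_mult I r s hI hr)) as e.
  rewrite norm_Hmult, norm_circle, norm_Hone in e by (try assumption; lra).
  apply Rmult_eq_reg_r with r; [rewrite Rinv_l by lra; exact e | lra].
Qed.

Lemma Hcont_inv_circle (I : H) (r : R) : sphere I -> 0 < r -> Hcont (inv_circle I r).
Proof.
  intros hI hr. apply Hcont_slice; [exact hI | |]; intros t.
  - apply (ex_derive_continuous (fun s : R => cos s / r) t). auto_derive; lra.
  - apply (ex_derive_continuous (fun s : R => - sin s / r) t). auto_derive; lra.
Qed.

Lemma HInt_inv_circle_pow (I : H) (r : R) (k : nat) :
  sphere I -> 0 < r -> (1 <= k)%nat -> HInt (fun s => Hpow (inv_circle I r s) k) = zero.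
Proof.
  intros hI hr hk.
  rewrite (HInt_ext _ (fun s => slice I (cos (INR k * s) / r ^ k) (- sin (INR k * s) / r ^ k)))
    by (intros; apply inv_circle_pow; assumption).
  assert (Z : forall x y (v : R -> R), (forall s, v s = x * cos (INR k * s) + y * sin (INR k * s)) ->
     RInt v 0 (2 * PI) = 0).
  { intros x y v hv. rewrite (RInt_ext v (fun s => x * cos (INR k * s) + y * sin (INR k * s)))
      by (intros s _; apply hv).
    apply RInt_cos_sin_multiple, hk. }
  unfold HInt, slice. apply H_ext; coord.
  - apply (Z (/ r ^ k) (- re I / r ^ k)). intros s. coord. unfold Rdiv; ring.
  - apply (Z 0 (- im_i I / r ^ k)). intros s. coord. unfold Rdiv; ring.
  - apply (Z 0 (- im_j I / r ^ k)). intros s. coord. unfold Rdiv; ring.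
  - apply (Z 0 (- im_k I / r ^ k)). intros s. coord. unfold Rdiv; ring.
Qed.

Lemma HInt_one : HInt (fun _ => Hone) = Hreal (2 * PI).
Proof.
  assert (C : forall c, RInt (fun _ => c) 0 (2 * PI) = (2 * PI - 0) * c)
    by (intros c; apply (@RInt_const R_CompleteNormedModule)).
  unfold HInt. apply H_ext; coord; (erewrite RInt_ext; [rewrite C |]);
    try (intros s _; coord; reflexivity); ring.
Qed.

(** For K = w / (w - z) and u = 1 / w this is one step of the geometric series. Multiplied on the
    right by w - z, the difference of the two sides becomes w - (w - z) - z u w = 0, and [H] has no
    zero divisors. *)
Lemma geometric_step (K w z u : H) :
  K *h (w -h z) = w -> u *h w = Hone -> w -h z <> zero -> K = Hone +h z *h u *h K.
Proof.
  intros E1 E3 W.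
  assert (P : (K -h Hone -h z *h u *h K) *h (w -h z) = zero).
  { transitivity (K *h (w -h z) -h w +h z -h z *h u *h (K *h (w -h z))); [quat |].
    rewrite E1, <- Hmult_assoc, E3. quat. }
  apply Hmult_integral in P. destruct P as [P | P]; [| contradiction].
  transitivity (K -h Hone -h z *h u *h K +h (Hone +h z *h u *h K)); [quat |]. rewrite P. quat.
Qed.

Lemma cauchy_kernel_step (I : H) (a b r s : R) :
  sphere I -> norm (slice I a b) < r ->
  cauchy_kernel I a b r s = Hone +h slice I a b *h inv_circle I r s *h cauchy_kernel I a b r s.
Proof.
  intros hI hz. assert (hr : 0 < r) by (pose proof (norm_nonneg (slice I a b)); lra).
  destruct (cauchy_kernel_spec I a b r s hI hz) as (E1 & _ & D & _).
  pose proof (inv_circle_mult I r s hI hr) as E3.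
  assert (W : circle I r s -h slice I a b <> zero).
  { intros e. unfold circle in e. rewrite slice_minus in e.
    assert (n : norm (slice I (r * cos s - a) (r * sin s - b)) = 0) by (rewrite e; apply norm_zero_H).
    rewrite norm_slice in n by exact hI. apply sqrt_eq_0 in n; lra. }
  apply geometric_step with (circle I r s); assumption.
Qed.

(** Iterating [cauchy_kernel_step] under the integral gives a finite geometric sum with an exact
    remainder, so no series is ever exchanged with an integral. *)
Lemma cauchy_kernel_expansion (g : R -> H) (I : H) (a b r : R) (n : nat) :
  sphere I -> norm (slice I a b) < r -> Hcont g ->
  HInt (fun s => cauchy_kernel I a b r s *h g s) =
  sum_n (fun k => Hpow (slice I a b) k *h HInt (fun s => Hpow (inv_circle I r s) k *h g s)) n +h
  Hpow (slice I a b) (S n) *h HInt (fun s => Hpow (inv_circle I r s) (S n) *h (cauchy_kernel I a b r s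
    *h g s)).
Proof.
  intros hI hz hg. assert (hr : 0 < r) by (pose proof (norm_nonneg (slice I a b)); lra).
  assert (cK := Hcont_cauchy_kernel I a b r hI hz).
  assert (cu := Hcont_inv_circle I r hI hr).
  assert (step : forall k, Hpow (slice I a b) k *h HInt (fun s => Hpow (inv_circle I r s) k *h
    (cauchy_kernel I a b r s *h g s)) =
     Hpow (slice I a b) k *h HInt (fun s => Hpow (inv_circle I r s) k *h g s) +h
     Hpow (slice I a b) (S k) *h HInt (fun s => Hpow (inv_circle I r s) (S k) *h (cauchy_kernel I a b r
       s *h g s))).
  { intros k. assert (E : Hpow (slice I a b) (S k) = Hpow (slice I a b) k *h slice I a b).
    { cbn [Hpow]. apply Hpow_comm. reflexivity. }
    assert (J : slice I a b *h HInt (fun s => Hpow (inv_circle I r s) (S k) *h (cauchy_kernel I a b r s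
      *h g s)) =
      HInt (fun s => slice I a b *h (Hpow (inv_circle I r s) (S k) *h (cauchy_kernel I a b r s *h g s)))).
    { symmetry. apply HInt_mult_l. apply Hcont_mult; [apply Hcont_pow, cu |]. apply Hcont_mult; assumption. }
    rewrite E, <- Hmult_assoc, J, <- Hmult_plus_r, <- HInt_plus.
    - f_equal. apply HInt_ext. intros s. rewrite (cauchy_kernel_step I a b r s hI hz) at 1.
      assert (E' : Hpow (inv_circle I r s) k *h slice I a b = slice I a b *h Hpow (inv_circle I r s) k).
      { symmetry. apply Hpow_comm. apply slice_comm. }
      assert (E'' : Hpow (inv_circle I r s) (S k) = Hpow (inv_circle I r s) k *h inv_circle I r s).
      { cbn [Hpow]. apply Hpow_comm. reflexivity. }
      rewrite E''. set (U := Hpow (inv_circle I r s) k) in *.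
      rewrite !Hmult_plus_l, !Hmult_plus_r, Hmult_one_l, !Hmult_assoc, E'. reflexivity.
    - apply Hcont_mult; [apply Hcont_pow, cu | exact hg].
    - apply Hcont_mult; [apply Hcont_const |]. apply Hcont_mult; [apply Hcont_pow, cu |].
      apply Hcont_mult; assumption. }
  assert (base : HInt (fun s => cauchy_kernel I a b r s *h g s) =
     Hpow (slice I a b) 0 *h HInt (fun s => Hpow (inv_circle I r s) 0 *h (cauchy_kernel I a b r s *h g s))).
  { cbn [Hpow]. rewrite Hmult_one_l. apply HInt_ext. intros s. rewrite Hmult_one_l. reflexivity. }
  rewrite base. induction n as [| n IH].
  - rewrite sum_O. apply step.
  - rewrite IH, sum_Sn, (step (S n)). apply (@plus_assoc H).
Qed.

Lemma cauchy_remainder_bound (g : R -> H) (I : H) (a b r M : R) (n : nat) :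
  sphere I -> norm (slice I a b) < r -> Hcont g -> (forall s, norm (g s) <= M) ->
  norm (Hpow (slice I a b) n *h HInt (fun s => Hpow (inv_circle I r s) n *h (cauchy_kernel I a b r s *h g s)))
    <= 4 * PI * (r / (r - norm (slice I a b)) * M) * (norm (slice I a b) / r) ^ n.
Proof.
  intros hI hz hg hM. pose proof (norm_nonneg (slice I a b)) as h0. assert (hr : 0 < r) by lra.
  set (z := slice I a b) in *. set (kap := r / (r - norm z)).
  assert (hk : 0 < kap) by (apply Rdiv_lt_0_compat; lra).
  assert (hM0 : 0 <= M) by (eapply Rle_trans; [apply norm_nonneg | apply (hM 0)]).
  rewrite norm_Hmult, Hpow_norm.
  assert (hi : 0 < (/ r) ^ n) by (apply pow_lt, Rinv_0_lt_compat; exact hr).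
  assert (B : norm (HInt (fun s => Hpow (inv_circle I r s) n *h (cauchy_kernel I a b r s *h g s)))
              <= 4 * PI * ((/ r) ^ n * (kap * M))).
  { apply norm_HInt_le.
    - apply Hcont_mult; [apply Hcont_pow, Hcont_inv_circle; assumption |].
      apply Hcont_mult; [apply Hcont_cauchy_kernel; assumption | exact hg].
    - intros s. rewrite !norm_Hmult, Hpow_norm, norm_inv_circle by assumption.
      apply Rmult_le_compat_l; [lra |]. apply Rmult_le_compat; try apply norm_nonneg.
      + apply cauchy_kernel_spec; assumption.
      + apply hM. }
  replace (4 * PI * (kap * M) * (norm z / r) ^ n)
    with (norm z ^ n * (4 * PI * ((/ r) ^ n * (kap * M)))) by (unfold Rdiv; rewrite Rpow_mult_distr; ring).
  apply Rmult_le_compat_l; [apply pow_le; exact h0 | exact B].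
Qed.

Lemma geometric_vanishing (C x : R) :
  0 <= x < 1 -> forall eps, 0 < eps -> exists N, forall n, (N <= n)%nat -> C * x ^ n < eps.
Proof.
  intros hx eps heps. destruct (pow_lt_1_zero x) with (y := eps / (Rabs C + 1)) as [N hN].
  - rewrite Rabs_pos_eq; lra.
  - apply Rdiv_lt_0_compat; [lra |]. pose proof (Rabs_pos C). lra.
  - exists N. intros n hn. specialize (hN n hn).
    pose proof (Rabs_pos C) as hC. pose proof (Rle_abs C) as hC'.
    assert (hp : 0 <= x ^ n) by (apply pow_le; lra). rewrite Rabs_pos_eq in hN by exact hp.
    apply Rle_lt_trans with ((Rabs C + 1) * x ^ n); [nra |].
    replace eps with ((Rabs C + 1) * (eps / (Rabs C + 1))) by (field; lra).
    apply Rmult_lt_compat_l; lra.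
Qed.

Lemma is_series_of_geometric_error (u : nat -> H) (l : H) (C x : R) :
  0 <= x < 1 -> (forall n, norm (sum_n u n -h l) <= C * x ^ n) -> is_series u l.
Proof.
  intros hx h. unfold is_series. apply (@filterlim_locally_ball_norm R_AbsRing nat H).
  - apply eventually_filter.
  - intros eps. destruct (geometric_vanishing C x hx eps (cond_pos eps)) as [N hN].
    exists N. intros n hn. unfold ball_norm. eapply Rle_lt_trans; [apply h | apply hN, hn].
Qed.

Lemma zero_of_geometric_bound (p : H) (C x : R) : 0 <= x < 1 -> (forall n, norm p <= C * x ^ n) -> p = zero.
Proof.
  intros hx h. apply norm_eq0. apply Rle_antisym; [| apply norm_nonneg].
  apply le_epsilon. intros eps heps. destruct (geometric_vanishing C x hx eps heps) as [N hN].
  specialize (hN N (Nat.le_refl N)). specialize (h N). lra.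
Qed.

(** Expanding against the constant 1 leaves only the term k = 0, since the negative powers of the
    circle have mean zero, and the remainder tends to 0 geometrically. *)
Lemma HInt_cauchy_kernel (I : H) (a b r : R) :
  sphere I -> norm (slice I a b) < r -> HInt (cauchy_kernel I a b r) = Hreal (2 * PI).
Proof.
  intros hI hz. pose proof (norm_nonneg (slice I a b)) as h0. assert (hr : 0 < r) by lra.
  set (x := norm (slice I a b) / r).
  assert (hx : 0 <= x < 1) by (apply ratio_lt_1; lra).
  set (C := 4 * PI * (r / (r - norm (slice I a b)) * 1) * x).
  assert (E : HInt (cauchy_kernel I a b r) -h Hreal (2 * PI) = zero).
  { apply zero_of_geometric_bound with C x; [exact hx |]. intros n.
    rewrite (HInt_ext (cauchy_kernel I a b r) (fun s => cauchy_kernel I a b r s *h Hone))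
      by (intros; rewrite Hmult_one_r; reflexivity).
    rewrite (cauchy_kernel_expansion (fun _ => Hone) I a b r n hI hz (Hcont_const Hone)).
    assert (SE : sum_n (fun k => Hpow (slice I a b) k *h HInt (fun s => Hpow (inv_circle I r s) k *h
      Hone)) n = Hreal (2 * PI)).
    { assert (T : forall k, HInt (fun s => Hpow (inv_circle I r s) k *h Hone) =
        HInt (fun s => Hpow (inv_circle I r s) k))
        by (intros k; apply HInt_ext; intros; apply Hmult_one_r).
      induction n as [| n IH].
      - rewrite sum_O, T. cbn [Hpow]. rewrite HInt_one. apply Hmult_one_l.
      - rewrite sum_Sn, IH, T, HInt_inv_circle_pow by (try assumption; lia). rewrite Hmult_zero_r.
          apply (@plus_zero_r H). }
    rewrite SE.
    assert (P : forall X : H, Hreal (2 * PI) +h X -h Hreal (2 * PI) = X) by (intros; quat).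
    rewrite P.
    replace (C * x ^ n) with (4 * PI * (r / (r - norm (slice I a b)) * 1) * x ^ S n) by (unfold C;
      cbn [pow]; ring).
    apply cauchy_remainder_bound; try assumption; [apply Hcont_const | intros; rewrite norm_Hone; lra]. }
  revert E. generalize (HInt (cauchy_kernel I a b r)). intros p E.
  transitivity (p -h Hreal (2 * PI) +h Hreal (2 * PI)); [quat |]. rewrite E. quat.
Qed.

(** Cauchy's integral of w^(-k-1) dw f(w) over 2 pi I, written with dw = I w ds. *)
Definition cauchy_coef (f : H -> H) (I : H) (r : R) (k : nat) : H :=
  scal (/ (2 * PI)) (HInt (fun s => Hpow (inv_circle I r s) k *h f (circle I r s))).

Lemma slice_expansion (f : H -> H) (I : H) (r M : R) :
  sphere I -> 0 < r < 1 ->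
  (forall x y, ball1 (slice I x y) -> exists d, slice_diff f I x y d) ->
  (forall q : H, norm q = r -> norm (f q) <= M) ->
  (forall n, norm (cauchy_coef f I r n) * r ^ n <= 2 * M) /\
  (forall a b, norm (slice I a b) < r ->
     is_series (fun n => Hpow (slice I a b) n *h cauchy_coef f I r n) (f (slice I a b))).
Proof.
  intros hI hr hf hM. pose proof PI_RGT_0 as hpi.
  assert (hM' : forall s, norm (f (circle I r s)) <= M) by (intros s; apply hM, norm_circle;
    [exact hI | lra]).
  assert (cf : Hcont (fun s => f (circle I r s))).
  { assert (c := Hcont_contraction f I 0 0 r 1 hI ltac:(lra)).
    assert (n0 : norm (slice I 0 0) <= r).
    { rewrite norm_slice by exact hI. replace (0 ^ 2 + 0 ^ 2) with 0 by ring. rewrite sqrt_0. lra. }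
    specialize (c n0 ltac:(lra) hf). intros s eps heps. destruct (c s eps heps) as (dl & p & h).
    exists dl. split; [exact p |]. intros s' hs'. specialize (h s' hs'). rewrite !contraction_1 in h.
      exact h. }
  assert (cu := Hcont_inv_circle I r hI ltac:(lra)).
  split.
  - intros n. unfold cauchy_coef. rewrite norm_scal_H, Rabs_pos_eq by (left; apply Rinv_0_lt_compat; lra).
    assert (hrn : 0 < r ^ n) by (apply pow_lt; lra).
    assert (B : norm (HInt (fun s => Hpow (inv_circle I r s) n *h f (circle I r s))) <=
      4 * PI * ((/ r) ^ n * M)).
    { apply norm_HInt_le; [apply Hcont_mult; [apply Hcont_pow, cu | exact cf] |].
      intros s. rewrite norm_Hmult, Hpow_norm, norm_inv_circle by (try assumption; lra).
      apply Rmult_le_compat_l; [| apply hM']. left. apply pow_lt, Rinv_0_lt_compat; lra. }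
    rewrite pow_inv in B.
    replace (2 * M) with (/ (2 * PI) * (4 * PI * (/ r ^ n * M)) * r ^ n) by (field; split; lra).
    apply Rmult_le_compat_r; [lra |]. apply Rmult_le_compat_l; [left; apply Rinv_0_lt_compat; lra | exact B].
  - intros a b hz. pose proof (norm_nonneg (slice I a b)) as h0.
    set (z := slice I a b) in *. set (x := norm z / r).
    assert (hx : 0 <= x < 1) by (apply ratio_lt_1; lra).
    apply is_series_of_geometric_error with (/ (2 * PI) * (4 * PI * (r / (r - norm z) * M) * x)) x;
      [exact hx |].
    intros n.
    assert (E := cauchy_formula f I a b r hI ltac:(lra) hz hf).
    rewrite HInt_cauchy_kernel, (cauchy_kernel_expansion _ I a b r n hI hz cf), Hmult_real_l in E
      by assumption.
    assert (B := cauchy_remainder_bound _ I a b r M (S n) hI hz cf hM'). fold z x in B, E.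
    set (Rm := Hpow z (S n) *h HInt (fun s => Hpow (inv_circle I r s) (S n) *h (cauchy_kernel I a b r s
      *h f (circle I r s)))) in *.
    assert (SE : sum_n (fun k => Hpow z k *h cauchy_coef f I r k) n =
       scal (/ (2 * PI)) (sum_n (fun k => Hpow z k *h HInt (fun s => Hpow (inv_circle I r s) k *h
         f (circle I r s))) n)).
    { rewrite <- Hmult_real_l, <- sum_n_Hmult_l. apply sum_n_ext. intros k. unfold cauchy_coef.
      rewrite Hmult_scal_r, Hmult_real_l. reflexivity. }
    rewrite SE. revert E.
    generalize (sum_n (fun k => Hpow z k *h HInt (fun s => Hpow (inv_circle I r s) k *h f (circle I r s))) n).
    intros X E.
    assert (D : scal (/ (2 * PI)) X -h f z = scal (- / (2 * PI)) Rm).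
    { transitivity (scal (/ (2 * PI)) (X -h scal (2 * PI) (f z)) : H).
      - generalize (f z). intros; apply H_ext; coord; field; lra.
      - rewrite <- E. clearbody Rm. quat. }
    rewrite D, norm_scal_H, Rabs_Ropp, Rabs_pos_eq by (left; apply Rinv_0_lt_compat; lra).
    rewrite Rmult_assoc. apply Rmult_le_compat_l; [left; apply Rinv_0_lt_compat; lra |].
    cbn [pow] in B. lra.
Qed.

(** Each slice and each radius has its own Cauchy coefficients. They all expand f on a real interval
    around 0, so they coincide, and one sequence serves the whole ball. The second conclusion is
    Cauchy's estimate for that sequence, its constant 2 coming from the coordinatewise integral. *)
Lemma regular_expansion (f : H -> H) :
  slice_regular ball1 f ->
  (forall r, 0 < r < 1 -> exists M, forall q : H, norm q = r -> norm (f q) <= M) ->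
  exists a, expansion f a /\
    forall r M, 0 < r < 1 -> (forall q : H, norm q = r -> norm (f q) <= M) ->
      forall n, norm (a n) * r ^ n <= 2 * M.
Proof.
  intros hf bd.
  assert (hd : forall I, sphere I -> forall x y, ball1 (slice I x y) -> exists d, slice_diff f I x y d).
  { intros I hI x y hq. destruct (hf I x y hI hq) as [h1 h2].
    apply filterdiff_slice_diff; assumption. }
  assert (U : forall I J r s, sphere I -> sphere J -> 0 < r < 1 -> 0 < s < 1 -> cauchy_coef f I r =
    cauchy_coef f J s).
  { intros I J r s hI hJ hr hs.
    destruct (bd r hr) as [M hM]. destruct (bd s hs) as [N hN].
    destruct (slice_expansion f I r M hI hr (hd I hI) hM) as [_ e1].
    destruct (slice_expansion f J s N hJ hs (hd J hJ) hN) as [_ e2].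
    apply power_series_unique with (Rmin r s); [apply Rmin_pos; lra |]. intros x hx.
    pose proof (Rmin_l r s) as m1. pose proof (Rmin_r r s) as m2.
    assert (EI : Hreal x = slice I x 0) by (unfold slice; quat).
    assert (EJ : Hreal x = slice J x 0) by (unfold slice; quat).
    exists (f (Hreal x)). split.
    - rewrite EI. apply e1. rewrite <- EI, norm_Hreal. lra.
    - rewrite EJ. apply e2. rewrite <- EJ, norm_Hreal. lra. }
  set (i0 := mkH 0 1 0 0). assert (hi : sphere i0) by (unfold sphere, i0; quat).
  exists (cauchy_coef f i0 (1 / 2)). split.
  - intros q hq. unfold ball1 in hq. pose proof (norm_nonneg q) as h0.
    destruct (slice_decomposition q) as [hI E].
    set (r := (1 + norm q) / 2). assert (hr : 0 < r < 1 /\ norm q < r) by (unfold r; lra).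
    rewrite (U i0 (dir q) (1 / 2) r) by (try assumption; lra).
    destruct (bd r) as [M hM]; [lra |].
    destruct (slice_expansion f (dir q) r M hI ltac:(lra) (hd _ hI) hM) as [_ e].
    replace (f q) with (f (slice (dir q) (re q) (norm (vec q)))) by (rewrite <- E; reflexivity).
    eapply is_series_ext; [| apply e; rewrite <- E; lra].
    intros n. cbv beta. rewrite <- E. reflexivity.
  - intros r M hr hM. rewrite (U i0 i0 (1 / 2) r) by (try assumption; lra).
    apply (slice_expansion f i0 r M hi hr (hd i0 hi) hM).
Qed.

(** The sum of the series is itself regular, and by uniqueness its Cauchy coefficients are the given
    ones. *)
Lemma cauchy_estimate (a : nat -> H) (r M : R) :
  tame a -> 0 < r < 1 -> (forall q : H, norm q = r -> norm (HPSeries a q) <= M) ->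
  forall n, norm (a n) * r ^ n <= 2 * M.
Proof.
  intros ha hr hM.
  destruct (regular_expansion (HPSeries a)) as (b & hb & est).
  - apply expansion_slice_regular with a. apply tame_expansion, ha.
  - intros s hs. destruct (tame_geom a s ha ltac:(lra)) as (C & x & hC & hx & h).
    exists (2 * (C / (1 - x))). intros q hq. apply norm_HSeries_le; [exact hx |].
    intros n. rewrite norm_Hmult, Hpow_norm, hq, Rmult_comm. apply h.
  - rewrite (expansion_unique _ _ _ (tame_expansion a ha) hb). apply est; assumption.
Qed.

(** * Maximum principle, spheres and reciprocals *)

Fixpoint spow (a : nat -> H) (n : nat) : nat -> H :=
  match n with O => one | S m => conv a (spow a m) end.

Lemma tame_spow (a : nat -> H) (n : nat) : tame a -> tame (spow a n).
Proof. intros ha. induction n as [| n IH]; [apply tame_lin | apply tame_conv; assumption]. Qed.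

Lemma spow_S_r (a : nat -> H) (n : nat) : spow a (S n) = conv (spow a n) a.
Proof.
  induction n as [| n IH]; [cbn [spow]; rewrite conv_one_l, conv_one_r; reflexivity |].
  change (conv a (spow a (S n)) = conv (conv a (spow a n)) a). rewrite IH. symmetry. apply conv_assoc.
Qed.

Lemma eval_one (q : H) : HPSeries one q = Hone.
Proof. unfold one. rewrite eval_lin. quat. Qed.

Lemma eval_conv_exists (a b : nat -> H) (q : H) :
  tame a -> tame b -> norm q < 1 ->
  exists p, norm p = norm q /\ HPSeries (conv a b) q = HPSeries a q *h HPSeries b p.
Proof.
  intros ha hb hq. destruct (conjugate_exists (HPSeries a q) q) as (p & hp & E).
  exists p. split; [exact hp |]. apply eval_conv; try assumption. lra.
Qed.

(** In a regular product the second factor is evaluated at another point of the same modulus; a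
    bound on the whole sphere |q| = r is therefore stable under regular powers. *)
Lemma norm_eval_spow_le (a : nat -> H) (r K : R) (n : nat) :
  tame a -> r < 1 -> (forall q : H, norm q = r -> norm (HPSeries a q) <= K) ->
  forall q : H, norm q = r -> norm (HPSeries (spow a n) q) <= K ^ n.
Proof.
  intros ha hr hK. induction n as [| n IH]; intros q hq; cbn [spow pow].
  - rewrite eval_one, norm_Hone. lra.
  - destruct (eval_conv_exists a (spow a n) q) as (p & hp & ->); [exact ha | apply tame_spow, ha | lra |].
    rewrite norm_Hmult. apply Rmult_le_compat; try apply norm_nonneg; [apply hK, hq | apply IH; lra].
Qed.

Lemma le_of_pow_le (x K C : R) : 0 <= K -> (forall n, x ^ n <= C * K ^ n) -> x <= K.
Proof.
  intros hK h. destruct (Rle_lt_dec x K) as [k | k]; [exact k | exfalso].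
  assert (hx : 0 <= K / x < 1) by (apply ratio_lt_1; lra).
  destruct (geometric_vanishing C (K / x) hx 1 Rlt_0_1) as [N hN].
  specialize (hN N (Nat.le_refl N)). specialize (h N).
  assert (hp : 0 < x ^ N) by (apply pow_lt; lra).
  replace (K ^ N) with ((K / x) ^ N * x ^ N) in h by (rewrite <- Rpow_mult_distr; f_equal; field; lra).
  nra.
Qed.

(* Landau's trick: after multiplication by a constant e on the right, the value at p is the real number
   |g(p)|, so it is multiplicative for *-powers; the bound K C^(1/N) of the N-th power tends to K. *)
Lemma maximum_principle (g : nat -> H) (r K : R) (p : H) :
  tame g -> 0 < r < 1 -> (forall q : H, norm q = r -> norm (HPSeries g q) <= K) -> norm p < r ->
  norm (HPSeries g p) <= K.
Proof.
  intros hg hr hK hp. pose proof (norm_nonneg p) as hp0.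
  assert (hK0 : 0 <= K).
  { eapply Rle_trans; [apply norm_nonneg | apply (hK (Hreal r))]. rewrite norm_Hreal, Rabs_pos_eq; lra. }
  destruct (classic (HPSeries g p = zero)) as [e0 | e0]; [rewrite e0, norm_zero_H; exact hK0 |].
  pose proof (norm_pos _ e0) as hal. set (al := norm (HPSeries g p)) in *.
  set (e := scal (/ al) (Hconj (HPSeries g p)) : H).
  assert (ne : norm e = 1).
  { unfold e. rewrite norm_scal_H, norm_Hconj, Rabs_pos_eq by (left; apply Rinv_0_lt_compat, hal).
    fold al. field. lra. }
  set (h := conv g (lin e zero)).
  assert (th : tame h) by (apply tame_conv; [exact hg | apply tame_lin]).
  assert (eh : forall q : H, norm q < 1 -> HPSeries h q = HPSeries g q *h e).
  { intros q hq. destruct (eval_conv_exists g (lin e zero) q hg (tame_lin _ _) hq) as (p' & _ & E).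
    unfold h. rewrite E, eval_lin. quat. }
  assert (hp1 : HPSeries h p = Hreal al).
  { rewrite eh by lra. unfold e. rewrite Hmult_scal_r, Hmult_conj_r. fold al. quat. field. lra. }
  assert (hN : forall n, HPSeries (spow h n) p = Hreal (al ^ n)).
  { induction n as [| n IH]; cbn [spow pow]; [apply eval_one |].
    rewrite (eval_conv h (spow h n) p p); [| exact th | apply tame_spow, th | lra | lra |].
    - rewrite hp1, IH. quat.
    - rewrite hp1. quat. }
  assert (hx : 0 <= norm p / r < 1) by (apply ratio_lt_1; lra).
  (* One factor 2 comes from Cauchy's estimate, the other from the norm of the sum; the constant
     does not depend on n. *)
  apply le_of_pow_le with (4 / (1 - norm p / r)); [exact hK0 |]. intros n.
  assert (est : forall m, norm (spow h n m) * r ^ m <= 2 * K ^ n).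
  { apply cauchy_estimate; [apply tame_spow, th | exact hr |].
    apply norm_eval_spow_le; [exact th | lra |]. intros q hq.
    rewrite eh, norm_Hmult, ne, Rmult_1_r by lra. apply hK, hq. }
  replace (al ^ n) with (norm (HPSeries (spow h n) p)).
  2: { rewrite hN, norm_Hreal. apply Rabs_pos_eq, pow_le. lra. }
  replace (4 / (1 - norm p / r) * K ^ n) with (2 * (2 * K ^ n / (1 - norm p / r))) by (field; lra).
  apply norm_HSeries_le; [exact hx |]. intros m. rewrite norm_Hmult, Hpow_norm.
  replace (norm p ^ m) with (r ^ m * (norm p / r) ^ m) by (rewrite <- Rpow_mult_distr; f_equal; field; lra).
  specialize (est m). assert (0 <= (norm p / r) ^ m) by (apply pow_le; lra). nra.
Qed.

(** * Values on the spheres x + y S *)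

Lemma Hpow_slice (x y : R) (n : nat) :
  exists u v, forall J, sphere J -> Hpow (slice J x y) n = slice J u v.
Proof.
  induction n as [| n (u & v & IH)].
  - exists 1, 0. intros J _. cbn [Hpow]. unfold slice. quat.
  - exists (x * u - y * v), (x * v + y * u). intros J hJ. cbn [Hpow]. rewrite IH by exact hJ.
    unfold slice. rewrite !Hmult_plus_l, !Hmult_plus_r, !Hmult_scal_l, !Hmult_scal_r, hJ. quat.
Qed.

Lemma sphere_opp (J : H) : sphere J -> sphere (opp J).
Proof. unfold sphere. intros hJ. rewrite <- hJ. quat. Qed.

(** The representation formula: (x + y J)^n = u + v J with real u and v that do not depend on J, so
    the values are affine in J. The constants are found from the two values at I and -I. *)
Lemma eval_on_sphere (b : nat -> H) (x y : R) (I : H) :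
  tame b -> sphere I -> norm (slice I x y) < 1 ->
  exists A B : H, forall J, sphere J -> HPSeries b (slice J x y) = A +h J *h B.
Proof.
  intros hb hI hq.
  assert (nJ : forall J, sphere J -> norm (slice J x y) < 1).
  { intros J hJ. rewrite norm_slice in * by assumption. exact hq. }
  pose proof (sphere_opp I hI) as hI'.
  pose proof (tame_eval b _ hb (nJ I hI)) as s1. pose proof (tame_eval b _ hb (nJ _ hI')) as s2.
  exists (scal (/ 2) (HPSeries b (slice I x y) +h HPSeries b (slice (opp I) x y)) : H).
  exists (opp I *h scal (/ 2) (HPSeries b (slice I x y) +h scal (-1) (HPSeries b (slice (opp I) x y)))).
  intros J hJ. apply HSeries_unique.
  pose proof (is_series_scal_H (/ 2) _ _ (is_series_plus_H _ _ _ _ s1 s2)) as t1.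
  pose proof (is_series_Hmult_l J _ _ (is_series_Hmult_l (opp I) _ _ (is_series_scal_H (/ 2) _ _
    (is_series_plus_H _ _ _ _ s1 (is_series_scal_H (-1) _ _ s2))))) as t2.
  pose proof (is_series_plus_H _ _ _ _ t1 t2) as t.
  eapply is_series_ext; [| exact t]. intros n. cbv beta.
  destruct (Hpow_slice x y n) as (u & v & P).
  rewrite !P by assumption. generalize (b n). intros c. unfold slice.
  assert (E : opp I *h (scal (/ 2) ((Hreal u +h scal v I) *h c +h scal (-1) ((Hreal u +h
    scal v (opp I)) *h c)))
              = scal v c).
  { transitivity (scal (- v) (I *h I *h c) : H).
    - apply H_ext; coord; field.
    - rewrite hI. quat. }
  rewrite E. apply H_ext; coord; field.
Qed.

(** Converse to [conjugate_exists]: here the point of the second factor is prescribed and that of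
    the first is sought. With the values A + J B, the equation J (A + J B) = (A + J B) I is linear
    in J because J J = -1: it reads J (A - B I) = (A - B I) I. *)
Lemma conjugate_on_sphere (b : nat -> H) (q : H) :
  tame b -> norm q < 1 -> (forall p : H, norm p = norm q -> HPSeries b p <> zero) ->
  exists p, norm p = norm q /\ p *h HPSeries b p = HPSeries b p *h q.
Proof.
  intros hb hq hz. destruct (slice_decomposition q) as [hI E].
  set (I := dir q) in *. set (x := re q) in *. set (y := norm (vec q)) in *. clearbody I x y. subst q.
  destruct (eval_on_sphere b x y I hb hI hq) as (A & B & R).
  assert (nJ : forall J, sphere J -> norm (slice J x y) = norm (slice I x y)).
  { intros J hJ. rewrite !norm_slice by assumption. reflexivity. }
  assert (conjI : forall k : H, k <> zero -> sphere (k *h I *h Hinv k)).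
  { intros k hk. unfold sphere. transitivity (k *h I *h (Hinv k *h k) *h (I *h Hinv k));
      [rewrite !Hmult_assoc; reflexivity |].
    rewrite Hinv_l, Hmult_one_r by exact hk. rewrite Hmult_assoc, <- (Hmult_assoc k I I), hI.
    transitivity (opp (k *h Hinv k) : H); [quat |]. rewrite Hinv_r by exact hk. reflexivity. }
  (* If A = B I, then b has a zero on the sphere: at J = -B I B^-1 when B is nonzero, and at I
     itself when A = B = 0. *)
  destruct (classic (A -h B *h I = zero)) as [k0 | k0].
  - exfalso. assert (EA : A = B *h I) by (transitivity (A -h B *h I +h B *h I); [quat | rewrite k0; quat]).
    destruct (classic (B = zero)) as [hB | hB].
    + apply (hz (slice I x y)); [reflexivity |]. rewrite (R I hI), EA, hB. quat.
    + pose proof (sphere_opp _ (conjI B hB)) as hJ. apply (hz (slice (opp (B *h I *h Hinv B)) x y)).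
      * apply nJ, hJ.
      * rewrite (R _ hJ), EA.
        transitivity (B *h I -h B *h I *h (Hinv B *h B)); [rewrite Hmult_assoc;
          generalize (B *h I *h Hinv B); intros; quat |].
        rewrite Hinv_l by exact hB. quat.
  - (* The solution of J (A + J B) = (A + J B) I is J = k I k^-1 with k = A - B I. *)
    set (k := A -h B *h I) in *. set (J := k *h I *h Hinv k). pose proof (conjI k k0) as hJ. fold J in hJ.
    exists (slice J x y). split; [apply nJ, hJ |]. rewrite (R J hJ).
    assert (Jk : J *h k = k *h I).
    { unfold J. rewrite <- Hmult_assoc, Hinv_l by exact k0. apply Hmult_one_r. }
    assert (C : J *h (A +h J *h B) = (A +h J *h B) *h I).
    { transitivity (J *h k +h J *h B *h I +h J *h J *h B).
      - unfold k. quat.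
      - rewrite Jk, hJ. unfold k. transitivity (A *h I -h B *h (I *h I) +h J *h B *h I -h B); [quat |].
        rewrite hI. quat. }
    generalize dependent (A +h J *h B). intros V C. unfold slice.
    transitivity (scal x V +h scal y (J *h V)); [quat |]. rewrite C. quat.
Qed.

(** * Regular reciprocals *)

Definition sneg (a : nat -> H) : nat -> H := fun n => opp (a n).

Lemma sneg_conv (a b : nat -> H) : conv (sneg a) b = sneg (conv a b) /\ conv a (sneg b) = sneg (conv a b).
Proof.
  split; apply functional_extensionality; intros n; unfold sneg, conv.
  - transitivity (Hreal (-1) *h sum_n (fun k => a k *h b (n - k)%nat) n).
    + rewrite <- sum_n_Hmult_l. apply sum_n_ext. intros k. quat.
    + generalize (sum_n (fun k => a k *h b (n - k)%nat) n). intros; quat.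
  - transitivity (Hreal (-1) *h sum_n (fun k => a k *h b (n - k)%nat) n).
    + rewrite <- sum_n_Hmult_l. apply sum_n_ext. intros k. quat.
    + generalize (sum_n (fun k => a k *h b (n - k)%nat) n). intros; quat.
Qed.

Lemma tame_sneg (a : nat -> H) : tame a -> tame (sneg a).
Proof.
  apply tame_norm_le with 1; [lra |]. intros n. unfold sneg. rewrite (@norm_opp R_AbsRing H). lra.
Qed.

Lemma eval_sneg (a : nat -> H) (q : H) : tame a -> norm q < 1 -> HPSeries (sneg a) q = opp (HPSeries a q).
Proof.
  intros ha hq. apply HSeries_unique.
  pose proof (is_series_scal_H (-1) _ _ (tame_eval a q ha hq)) as s.
  replace (opp (HPSeries a q) : H) with (scal (-1) (HPSeries a q) : H) by (generalize (HPSeries a q);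
    intros; quat).
  eapply is_series_ext; [| exact s]. intros n. unfold sneg. quat.
Qed.

Lemma is_series_conv_l (a : nat -> H) (w : nat -> nat -> H) (l : nat -> H) (n : nat) :
  (forall m, is_series (fun N => w N m) (l m)) -> is_series (fun N => conv a (w N) n) (conv a l n).
Proof.
  intros h. unfold conv.
  assert (P : forall j, (j <= n)%nat -> is_series (fun N => sum_n (fun k => a k *h w N (n - k)%nat) j)
     (sum_n (fun k => a k *h l (n - k)%nat) j)).
  { induction j as [| j IH]; intros hj.
    - rewrite sum_O. apply is_series_ext with (fun N => a 0%nat *h w N (n - 0)%nat).
      + intros N. rewrite sum_O. reflexivity.
      + apply (is_series_Hmult_l (a 0%nat) (fun N => w N (n - 0)%nat)), h.
    - rewrite sum_Sn. apply is_series_ext with (fun N => sum_n (fun k => a k *h w N (n - k)%nat) j +h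
        a (S j) *h w N (n - S j)%nat).
      + intros N. rewrite sum_Sn. reflexivity.
      + apply is_series_plus_H; [apply IH; lia |].
        apply (is_series_Hmult_l (a (S j)) (fun N => w N (n - S j)%nat)), h. }
  apply P. lia.
Qed.

Lemma is_series_conv_r (a : nat -> H) (w : nat -> nat -> H) (l : nat -> H) (n : nat) :
  (forall m, is_series (fun N => w N m) (l m)) -> is_series (fun N => conv (w N) a n) (conv l a n).
Proof.
  intros h. unfold conv.
  assert (P : forall j, (j <= n)%nat -> is_series (fun N => sum_n (fun k => w N k *h a (n - k)%nat) j)
     (sum_n (fun k => l k *h a (n - k)%nat) j)).
  { induction j as [| j IH]; intros hj.
    - rewrite sum_O. apply is_series_ext with (fun N => w N 0%nat *h a (n - 0)%nat).
      + intros N. rewrite sum_O. reflexivity.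
      + apply (is_series_Hmult_r (a (n - 0)%nat) (fun N => w N 0%nat)), h.
    - rewrite sum_Sn. apply is_series_ext with (fun N => sum_n (fun k => w N k *h a (n - k)%nat) j +h
        w N (S j) *h a (n - S j)%nat).
      + intros N. rewrite sum_Sn. reflexivity.
      + apply is_series_plus_H; [apply IH; lia |].
        apply (is_series_Hmult_r (a (n - S j)%nat) (fun N => w N (S j))), h. }
  apply P. lia.
Qed.

(** The inverse is the sum v of the regular powers of u, formed coefficient by coefficient: Cauchy's
    estimate bounds the n-th coefficient of the N-th power by a constant times rho^N. Each
    coefficient of a product is a finite sum, so v = 1 + u * v = 1 + v * u follows termwise. *)
Lemma neumann_series (u : nat -> H) (rho : R) :
  tame u -> 0 <= rho < 1 -> (forall q : H, norm q < 1 -> norm (HPSeries u q) <= rho) ->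
  exists v, tame v /\ conv (splus one (sneg u)) v = one /\ conv v (splus one (sneg u)) = one.
Proof.
  intros hu hr hb.
  assert (est : forall r N n, 0 < r < 1 -> norm (spow u N n) * r ^ n <= 2 * rho ^ N).
  { intros r N n h. apply cauchy_estimate; [apply tame_spow, hu | exact h |].
    apply norm_eval_spow_le; [exact hu | lra |]. intros q hq. apply hb. lra. }
  assert (est' : forall r n, 0 < r < 1 -> forall N, norm (spow u N n) <= 2 / r ^ n * rho ^ N).
  { intros r n h N. assert (hrn : 0 < r ^ n) by (apply pow_lt; lra).
    apply Rmult_le_reg_r with (r ^ n); [exact hrn |].
    replace (2 / r ^ n * rho ^ N * r ^ n) with (2 * rho ^ N) by (field; lra). apply est, h. }
  set (v := fun n => HSeries (fun N => spow u N n)).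
  assert (sv : forall n, is_series (fun N => spow u N n) (v n)).
  { intros n. apply is_series_geom_dominated with (2 / (1 / 2) ^ n) rho; [exact hr |]. apply est'. lra. }
  assert (tv : tame v).
  { intros r h. set (s := (1 + r) / 2). assert (hs : r <= s /\ 0 < s < 1) by (unfold s; lra).
    exists (2 * (2 / (1 - rho))). intros n.
    assert (B : norm (v n) <= 2 * (2 / s ^ n / (1 - rho))) by (apply norm_HSeries_le;
      [exact hr | apply est'; lra]).
    assert (hsn : 0 < s ^ n) by (apply pow_lt; lra).
    apply Rle_trans with (norm (v n) * s ^ n).
    - apply Rmult_le_compat_l; [apply norm_nonneg | apply pow_incr; lra].
    - replace (2 * (2 / (1 - rho))) with (2 * (2 / s ^ n / (1 - rho)) * s ^ n) by (field; lra).
      apply Rmult_le_compat_r; lra. }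
  assert (L : splus one (conv u v) = v).
  { apply functional_extensionality. intros n.
    apply (is_series_unique_H (fun N => spow u N n)); [| apply sv].
    pose proof (is_series_conv_l u (spow u) v n sv) as c.
    exact (is_series_cons (fun N => spow u N n) _ c). }
  assert (R : splus one (conv v u) = v).
  { apply functional_extensionality. intros n.
    apply (is_series_unique_H (fun N => spow u N n)); [| apply sv].
    pose proof (is_series_conv_r u (spow u) v n sv) as c.
    assert (c' : is_series (fun N => spow u (S N) n) (conv v u n)).
    { eapply is_series_ext; [| exact c]. intros N. rewrite spow_S_r. reflexivity. }
    exact (is_series_cons (fun N => spow u N n) _ c'). }
  exists v. split; [exact tv |].
  assert (F : forall a b : nat -> H, splus one a = b -> splus b (sneg a) = one).
  { intros a b <-. apply functional_extensionality. intros n. unfold splus, sneg.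
    generalize (one n) (a n). intros. quat. }
  split.
  - rewrite conv_splus_l, conv_one_l, (proj1 (sneg_conv u v)). apply F, L.
  - rewrite conv_splus_r, conv_one_r, (proj2 (sneg_conv v u)). apply F, R.
Qed.

Lemma eval_central (s : nat -> H) (q : H) :
  tame s -> norm q < 1 -> (forall n p, s n *h p = p *h s n) -> q *h HPSeries s q = HPSeries s q *h q.
Proof.
  intros hs hq hc. pose proof (tame_eval s q hs hq) as e.
  apply (is_series_unique_H (fun n => q *h (Hpow q n *h s n))).
  - apply is_series_Hmult_l, e.
  - eapply is_series_ext; [| apply is_series_Hmult_r, e]. intros n. cbv beta.
    rewrite <- Hmult_assoc, hc, !Hmult_assoc, Hpow_comm by reflexivity. reflexivity.
Qed.

(** The symmetrization s = w * w^c is its own conjugate, so its coefficients are real and its values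
    multiply pointwise. From s * v = v * w * w^c = w^c, the quotient s(q)^-1 w^c(q) is v(q); and s
    has no zero because s * (v^c * v) = 1. *)
Lemma expansion_star_inv (g : H -> H) (w v : nat -> H) :
  expansion g w -> tame v -> conv w v = one -> conv v w = one -> expansion (star_inv g) v.
Proof.
  intros hg tv wv vw. pose proof (expansion_tame g w hg) as tw.
  pose proof (tame_sconj w tw) as twc. pose proof (tame_sconj v tv) as tvc.
  assert (erc : expansion (reg_conj g) (sconj w)).
  { unfold reg_conj. rewrite (coef_expansion g w hg). apply (tame_expansion (sconj w) twc). }
  set (s := conv w (sconj w)). assert (ts : tame s) by (apply tame_conv; assumption).
  assert (es : expansion (symm g) s) by exact (expansion_star g (reg_conj g) w (sconj w) hg erc).
  assert (sr : forall n p, s n *h p = p *h s n).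
  { intros n p. assert (E : Hconj (s n) = s n).
    { change (sconj s n = s n). unfold s. rewrite sconj_conv, sconj_sconj. reflexivity. }
    pose proof (f_equal im_i E) as e1. pose proof (f_equal im_j E) as e2. pose proof (f_equal im_k E) as e3.
    revert e1 e2 e3. generalize (s n). intros z. coord. intros e1 e2 e3.
    assert (z1 : im_i z = 0) by lra. assert (z2 : im_j z = 0) by lra. assert (z3 : im_k z = 0) by lra.
    apply H_ext; coord; rewrite z1, z2, z3; ring. }
  assert (sv : conv s v = sconj w).
  { rewrite conv_comm by (intros; apply sr). unfold s. rewrite <- conv_assoc, vw. apply conv_one_l. }
  assert (sx : conv s (conv (sconj v) v) = one).
  { unfold s. rewrite conv_assoc, <- (conv_assoc (sconj w)), <- sconj_conv, vw, sconj_one, conv_one_l.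
      exact wv. }
  assert (tx : tame (conv (sconj v) v)) by (apply tame_conv; assumption).
  apply expansion_ext with (HPSeries v); [| apply tame_expansion, tv].
  intros q hq. pose proof (eval_central s q ts hq sr) as cq.
  assert (E1 : HPSeries s q *h HPSeries v q = HPSeries (sconj w) q)
    by (rewrite <- sv; symmetry; apply eval_conv; assumption).
  assert (E2 : HPSeries s q *h HPSeries (conv (sconj v) v) q = Hone)
    by (rewrite <- (eval_one q), <- sx; symmetry; apply eval_conv; assumption).
  assert (nz : HPSeries s q <> zero).
  { intros e. rewrite e, Hmult_zero_l in E2. apply (f_equal re) in E2. revert E2. coord. lra. }
  unfold star_inv. rewrite <- (expansion_eval _ _ q es hq), <- (expansion_eval _ _ q erc hq), <- E1.
  rewrite Hmult_assoc, Hinv_l, Hmult_one_l by exact nz. reflexivity.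
Qed.

(** * The Schwarz lemma *)

Definition scale (x : R) (a : nat -> H) : nat -> H := fun n => scal x (a n).

(* The coefficients of q - z. *)
Definition factor (z : H) : nat -> H := lin (opp z) Hone.

Lemma tame_scale (x : R) (a : nat -> H) : tame a -> tame (scale x a).
Proof.
  apply tame_norm_le with (Rabs x); [apply Rabs_pos |]. intros n. unfold scale. rewrite norm_scal_H. lra.
Qed.

Lemma eval_scale (x : R) (a : nat -> H) (q : H) :
  tame a -> norm q < 1 -> HPSeries (scale x a) q = scal x (HPSeries a q).
Proof.
  intros ha hq. apply HSeries_unique.
  eapply is_series_ext; [| apply is_series_scal_H, (tame_eval a q ha hq)].
  intros n. unfold scale. symmetry. apply Hmult_scal_r.
Qed.

Lemma conv_scale_real (x : R) (a b : nat -> H) :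
  conv (scale x a) b = scale x (conv a b) /\ conv a (scale x b) = scale x (conv a b).
Proof.
  split; apply functional_extensionality; intros n; unfold scale, conv.
  - rewrite <- (Hmult_real_l x (sum_n _ _)), <- sum_n_Hmult_l. apply sum_n_ext. intros k. quat.
  - rewrite <- (Hmult_real_l x (sum_n _ _)), <- sum_n_Hmult_l. apply sum_n_ext. intros k. quat.
Qed.

(** * Zeros, derivatives and division by q - z *)

Lemma eval_factor_mult (z : H) (k : nat -> H) : tame k -> norm z < 1 -> HPSeries (conv (factor z) k) z = zero.
Proof.
  intros hk hz. destruct (eval_conv_exists (factor z) k z (tame_lin _ _) hk hz) as (p & _ & ->).
  unfold factor. rewrite eval_lin. replace (opp z +h z *h Hone) with (zero : H) by quat. apply Hmult_zero_l.
Qed.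

(** Comparing coefficients, b_(n+1) = k_n - z k_(n+1) and b_0 = -z k_0. The first relation is solved
    by k_n = sum over m of z^m b_(n+1+m); the second then says that b(z) = 0. *)
Lemma factor_of_zero (b : nat -> H) (z : H) :
  tame b -> norm z < 1 -> HPSeries b z = zero -> exists k, tame k /\ b = conv (factor z) k.
Proof.
  intros hb hz h0. pose proof (norm_nonneg z) as hz0.
  assert (D : forall s, norm z < s < 1 -> exists C, forall n m,
     norm (Hpow z m *h b (S n + m)%nat) <= C / s ^ n * (norm z / s) ^ m).
  { intros s hs. destruct (hb s) as [M hM]; [lra |]. exists (M / s). intros n m.
    rewrite norm_Hmult, Hpow_norm. specialize (hM (S n + m)%nat).
    assert (hp : 0 < s ^ (S n + m)) by (apply pow_lt; lra).
    assert (h1 : 0 < s ^ n) by (apply pow_lt; lra). assert (h2 : 0 < s ^ m) by (apply pow_lt; lra).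
    replace (norm z ^ m) with ((norm z / s) ^ m * s ^ m) by (rewrite <- Rpow_mult_distr; f_equal; field; lra).
    replace (M / s / s ^ n * (norm z / s) ^ m) with ((norm z / s) ^ m * (M / s / s ^ n)) by ring.
    rewrite Rmult_assoc. apply Rmult_le_compat_l.
    - apply pow_le. apply Rmult_le_pos; [lra | left; apply Rinv_0_lt_compat; lra].
    - apply Rmult_le_reg_r with (s * s ^ n); [nra |].
      replace (M / s / s ^ n * (s * s ^ n)) with M by (field; lra).
      rewrite pow_add in hM. cbn [pow] in hM.
      replace (s ^ m * norm (b (S n + m)%nat) * (s * s ^ n))
        with (norm (b (S n + m)%nat) * (s * s ^ n * s ^ m)) by ring.
      exact hM. }
  assert (hx : forall s, norm z < s < 1 -> 0 <= norm z / s < 1) by (intros; apply ratio_lt_1; lra).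
  set (k := fun n => HSeries (fun m => Hpow z m *h b (S n + m)%nat)).
  assert (sk : forall n, is_series (fun m => Hpow z m *h b (S n + m)%nat) (k n)).
  { intros n. set (s := (1 + norm z) / 2). assert (hs : norm z < s < 1) by (unfold s; lra).
    destruct (D s hs) as [C hC].
    apply is_series_geom_dominated with (C / s ^ n) (norm z / s); [apply hx, hs | apply hC]. }
  exists k. split.
  - intros r hr. set (s := (1 + Rmax r (norm z)) / 2).
    assert (hm : Rmax r (norm z) < 1) by (apply Rmax_lub_lt; lra).
    pose proof (Rmax_l r (norm z)) as m1. pose proof (Rmax_r r (norm z)) as m2.
    assert (hs : norm z < s < 1) by (unfold s; lra). assert (hrs : r < s) by (unfold s; lra).
    destruct (D s hs) as [C hC]. exists (2 * (C / (1 - norm z / s))). intros n.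
    assert (B : norm (k n) <= 2 * (C / s ^ n / (1 - norm z / s)))
      by (apply norm_HSeries_le; [apply hx, hs | apply hC]).
    assert (hsn : 0 < s ^ n) by (apply pow_lt; lra). pose proof (hx s hs) as hx'.
    apply Rle_trans with (norm (k n) * s ^ n).
    + apply Rmult_le_compat_l; [apply norm_nonneg | apply pow_incr; lra].
    + apply Rle_trans with (2 * (C / s ^ n / (1 - norm z / s)) * s ^ n); [apply Rmult_le_compat_r; lra |].
      right. field. repeat split; lra.
  - assert (sh : forall n, is_series (fun m => Hpow z m *h b (n + m)%nat) (b n +h z *h k n)).
    { intros n. replace (b n) with (Hpow z 0 *h b (n + 0)%nat).
      - apply (is_series_cons (fun m => Hpow z m *h b (n + m)%nat)).
        eapply is_series_ext; [| apply (is_series_Hmult_l z _ _ (sk n))].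
        intros m. cbn [Hpow]. rewrite Hmult_assoc, Nat.add_succ_r. reflexivity.
      - cbn [Hpow]. rewrite Nat.add_0_r. apply Hmult_one_l. }
    apply functional_extensionality. intros [| n].
    + unfold factor. rewrite conv_lin_0.
      assert (E : b 0%nat +h z *h k 0%nat = zero).
      { rewrite <- h0. apply (is_series_unique_H _ _ _ (sh 0%nat)). apply (tame_eval b z hb hz). }
      transitivity (b 0%nat +h z *h k 0%nat +h opp z *h k 0%nat); [quat |]. rewrite E. quat.
    + unfold factor. rewrite conv_lin_S.
      assert (E : k n = b (S n) +h z *h k (S n)) by (apply (is_series_unique_H _ _ _ (sk n)), sh).
      rewrite E. quat.
Qed.

Lemma der_factor_mult (z : H) (k : nat -> H) :
  der (conv (factor z) k) = splus k (conv (factor z) (der k)).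
Proof.
  apply functional_extensionality. intros n. unfold der at 1, splus, factor. rewrite conv_lin_S.
  destruct n as [| n].
  - rewrite conv_lin_0. unfold der. cbn [INR]. quat.
  - rewrite conv_lin_S. unfold der. rewrite !S_INR. quat.
Qed.

Lemma der_factor_pow_mult (z : H) (n : nat) (k : nat -> H) :
  der (conv (spow (factor z) (S n)) k) =
  conv (spow (factor z) n) (splus (scale (INR (S n)) k) (conv (factor z) (der k))).
Proof.
  induction n as [| n IH].
  - cbn [spow]. rewrite conv_one_r, conv_one_l, der_factor_mult. f_equal.
    apply functional_extensionality. intros m. unfold scale. cbn [INR]. quat.
  - change (spow (factor z) (S (S n))) with (conv (factor z) (spow (factor z) (S n))).
    rewrite conv_assoc, der_factor_mult, IH, <- conv_assoc.
    change (conv (factor z) (spow (factor z) n)) with (spow (factor z) (S n)).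
    rewrite <- conv_splus_r. f_equal.
    apply functional_extensionality. intros m. unfold splus, scale. rewrite (S_INR (S n)).
    generalize (conv (factor z) (der k) m). intros. quat.
Qed.

Lemma der_n_S (n : nat) (a : nat -> H) : der_n (S n) a = der_n n (der a).
Proof. induction n as [| n IH]; [reflexivity |]. cbn [der_n] in *. rewrite IH. reflexivity. Qed.

(** Each derivative removes one factor q - z and multiplies the cofactor by the exponent, up to a
    left multiple of q - z; the exponents accumulate to n!. The second summand vanishes at z, so the
    n-th derivative has the value n! k(z) there. *)
Lemma der_n_factor_pow_mult (z : H) (n : nat) (k : nat -> H) :
  tame k -> exists s, tame s /\
    der_n n (conv (spow (factor z) n) k) = splus (scale (INR (fact n)) k) (conv (factor z) s).
Proof.
  revert k. induction n as [| n IH]; intros k hk.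
  - exists (fun _ => zero). split.
    + intros r _. exists 0. intros n. rewrite norm_zero_H. lra.
    + cbn [der_n spow]. rewrite conv_one_l. apply functional_extensionality. intros m.
      unfold splus, scale. cbn [fact INR].
      assert (E : conv (factor z) (fun _ => zero) m = zero).
      { unfold factor. destruct m; [rewrite conv_lin_0 | rewrite conv_lin_S]; quat. }
      rewrite E. quat.
  - rewrite der_n_S, der_factor_pow_mult.
    destruct (IH (splus (scale (INR (S n)) k) (conv (factor z) (der k)))) as (s & hs & E).
    { apply tame_splus; [apply tame_scale, hk | apply tame_conv; [apply tame_lin | apply tame_der, hk]]. }
    exists (splus (scale (INR (fact n)) (der k)) s). split.
    + apply tame_splus; [apply tame_scale, tame_der, hk | exact hs].
    + rewrite E, conv_splus_r, (proj2 (conv_scale_real _ (factor z) (der k))).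
      apply functional_extensionality. intros m. unfold splus, scale.
      change (fact (S n)) with (S n * fact n)%nat. rewrite mult_INR.
      generalize (conv (factor z) (der k) m) (conv (factor z) s m). intros. quat.
Qed.

(** Once b = (q - z)^n * k, the n-th derivative at z is n! k(z); its vanishing gives k(z) = 0 and
    one more factor. *)
Lemma factor_pow_of_flat (b : nat -> H) (z : H) (n : nat) :
  tame b -> norm z < 1 -> (forall m, (m < n)%nat -> HPSeries (der_n m b) z = zero) ->
  exists k, tame k /\ b = conv (spow (factor z) n) k.
Proof.
  intros hb hz. induction n as [| n IH]; intros h.
  - exists b. split; [exact hb |]. cbn [spow]. symmetry. apply conv_one_l.
  - destruct IH as (k & hk & E); [intros m hm; apply h; lia |].
    destruct (der_n_factor_pow_mult z n k hk) as (s & hs & Ed).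
    assert (h0 := h n (Nat.lt_succ_diag_r n)). rewrite E, Ed in h0.
    assert (hls : tame (conv (factor z) s)) by (apply tame_conv; [apply tame_lin | exact hs]).
    rewrite (eval_splus _ _ z (tame_scale _ k hk) hls hz), (eval_scale _ k z hk hz),
      (eval_factor_mult z s hs hz) in h0.
    assert (k0 : HPSeries k z = zero).
    { pose proof (INR_fact_neq_0 n) as hf. transitivity (scal (/ INR (fact n)) (scal (INR (fact n))
        (HPSeries k z) +h zero) : H).
      - generalize (HPSeries k z). intros. apply H_ext; coord; field; exact hf.
      - rewrite h0. quat. }
    destruct (factor_of_zero k z hk hz k0) as (k' & hk' & E').
    exists k'. split; [exact hk' |]. rewrite spow_S_r, conv_assoc, <- E'. exact E.
Qed.

(** * Blaschke factors *)

Lemma blaschke_disc (x c : H) : norm x <= 1 -> norm c <= 1 -> norm (x -h c) <= norm (Hone -h x *h Hconj c).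
Proof.
  intros hx hc. apply norm_le_sqr; [apply norm_nonneg |]. rewrite norm_sqr.
  pose proof (norm_sqr x) as nx. pose proof (norm_sqr c) as nc.
  assert (h1 : norm x ^ 2 <= 1) by (pose proof (norm_nonneg x); nra).
  assert (h2 : norm c ^ 2 <= 1) by (pose proof (norm_nonneg c); nra).
  rewrite nx in h1. rewrite nc in h2. coord.
  (* The difference of the squared moduli is (1 - |x|^2) (1 - |c|^2). *)
  match goal with |- ?A <= ?B =>
    assert (E : B - A = (1 - (re x ^ 2 + im_i x ^ 2 + im_j x ^ 2 + im_k x ^ 2)) *
                        (1 - (re c ^ 2 + im_i c ^ 2 + im_j c ^ 2 + im_k c ^ 2))) by ring end.
  assert (P : 0 <= (1 - (re x ^ 2 + im_i x ^ 2 + im_j x ^ 2 + im_k x ^ 2)) *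
                   (1 - (re c ^ 2 + im_i c ^ 2 + im_j c ^ 2 + im_k c ^ 2))) by (apply Rmult_le_pos; lra).
  lra.
Qed.

(** The exact form is kept because the Schwarz step needs the rate at which the two moduli approach
    each other as |q| tends to 1. *)
Lemma blaschke_identity (q z : H) :
  norm (Hone -h q *h Hconj z) ^ 2 = norm (q -h z) ^ 2 + (1 - norm q ^ 2) * (1 - norm z ^ 2).
Proof. rewrite !norm_sqr. coord. ring. Qed.

Definition blaschke_denominator (z : H) : nat -> H := lin Hone (opp (Hconj z)).

Lemma factor_denominator_comm (z : H) :
  conv (blaschke_denominator z) (factor z) = conv (factor z) (blaschke_denominator z).
Proof.
  apply conv_comm. intros [| [| m]] [| [| n]]; cbn [blaschke_denominator factor lin]; quat.
Qed.

(* On |q| = r the Blaschke factor of z has modulus close to 1 as r -> 1, so dividing by it does not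
   increase the bound, by the maximum principle. *)
Lemma schwarz_step (z : H) (k : nat -> H) :
  norm z < 1 -> tame k ->
  (forall q : H, norm q < 1 -> norm (HPSeries (conv (factor z) k) q) <= 1) ->
  forall q : H, norm q < 1 -> norm (HPSeries (conv (blaschke_denominator z) k) q) <= 1.
Proof.
  intros hz hk hb p hp. pose proof (norm_nonneg z) as hz0.
  set (E := blaschke_denominator z). set (L := factor z) in *. set (g := conv E k).
  assert (tE : tame E) by apply tame_lin. assert (tL : tame L) by apply tame_lin.
  assert (tg : tame g) by (apply tame_conv; assumption).
  assert (th : tame (conv L k)) by (apply tame_conv; assumption).
  assert (EL : conv E (conv L k) = conv L g).
  { unfold g. rewrite <- !conv_assoc. unfold E, L. rewrite factor_denominator_comm. reflexivity. }
  assert (eL : forall q, HPSeries L q = q -h z) by (intros q; unfold L, factor; rewrite eval_lin; quat).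
  assert (eE : forall q, HPSeries E q = Hone -h q *h Hconj z)
    by (intros q; unfold E, blaschke_denominator; rewrite eval_lin; quat).
  assert (ring_bound : forall r, norm z < r < 1 -> forall q : H, norm q = r ->
     norm (HPSeries g q) <= 1 + (1 - r ^ 2) / (r - norm z) ^ 2).
  { intros r hr q hq.
    assert (far : forall p' : H, norm p' = norm q -> r - norm z <= norm (p' -h z)).
    { intros p' hp'. rewrite <- hq, <- hp'. apply norm_minus_ge. }
    (* L * g = E * (L * k) is evaluated at p', chosen so that g is evaluated at q. Both L and E are
       then evaluated at this same p', which yields |p' - z| |g(q)| <= |1 - p' z'| with z' the
       conjugate of z. *)
    destruct (conjugate_on_sphere L q tL ltac:(lra)) as (p' & hp' & C).
    { intros p' hp'. rewrite eL. intros e. specialize (far p' hp'). rewrite e, norm_zero_H in far. lra. }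
    assert (E1 : HPSeries (conv L g) p' = HPSeries L p' *h HPSeries g q) by (apply eval_conv;
      try assumption; lra).
    destruct (eval_conv_exists E (conv L k) p' tE th ltac:(lra)) as (p'' & hp'' & E2).
    rewrite EL, E1 in E2. apply (f_equal (@norm R_AbsRing H)) in E2. rewrite !norm_Hmult, eL, eE in E2.
    assert (b1 := hb p'' ltac:(lra)). specialize (far p' hp').
    pose proof (blaschke_identity p' z) as id. rewrite hp', hq in id.
    set (X := norm (p' -h z)) in *. set (Y := norm (Hone -h p' *h Hconj z)) in *.
    set (G := norm (HPSeries g q)) in *.
    assert (hG : 0 <= G) by apply norm_nonneg. assert (hY : 0 <= Y) by apply norm_nonneg.
    assert (XG : X * G <= Y) by (rewrite E2; rewrite <- (Rmult_1_r Y) at 2; apply Rmult_le_compat_l;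
      assumption).
    (* By [blaschke_identity], Y^2 exceeds X^2 by at most 1 - r^2, and X >= r - |z|; hence Y^2 <= (1
       + t) X^2. The bound G^2 <= 1 + t is then weakened to G <= 1 + t. *)
    set (t := (1 - r ^ 2) / (r - norm z) ^ 2).
    assert (hd : 0 < (r - norm z) ^ 2) by (apply pow_lt; lra).
    assert (ht : 0 <= t).
    { unfold t. apply Rmult_le_pos; [nra | left; apply Rinv_0_lt_compat, hd]. }
    assert (et : t * (r - norm z) ^ 2 = 1 - r ^ 2) by (unfold t; field; lra).
    assert (hX : (r - norm z) ^ 2 <= X ^ 2) by (apply pow_incr; lra).
    assert (hY2 : Y ^ 2 <= X ^ 2 * (1 + t)).
    { rewrite id. assert ((1 - r ^ 2) * (1 - norm z ^ 2) <= t * X ^ 2); [| lra].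
      assert (z2 : 0 <= norm z ^ 2) by apply pow2_ge_0.
      assert (r2 : 0 <= 1 - r ^ 2) by nra.
      apply Rle_trans with (t * (r - norm z) ^ 2); [| apply Rmult_le_compat_l; assumption].
      rewrite et. pose proof (Rmult_le_pos _ _ r2 z2) as rz. lra. }
    assert (hXp : 0 < X ^ 2) by lra.
    assert (hG2 : G ^ 2 <= 1 + t).
    { apply Rmult_le_reg_l with (X ^ 2); [exact hXp |]. apply Rle_trans with (Y ^ 2); [| exact hY2].
      rewrite <- Rpow_mult_distr. apply pow_incr. split; [apply Rmult_le_pos; [| exact hG]; lra | exact XG]. }
    apply Rsqr_incr_0_var; [| lra]. unfold Rsqr.
    assert (t2 : 0 <= t * t) by (apply Rmult_le_pos; exact ht). lra. }
  destruct (Rle_lt_dec (norm (HPSeries g p)) 1) as [ok | bad]; [exact ok | exfalso].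
  set (eta := norm (HPSeries g p) - 1) in *. assert (heta : 0 < eta) by (unfold eta; lra).
  set (d := (1 - norm z) / 2). assert (hd : 0 < d) by (unfold d; lra).
  (* For the radius r = 1 - dl, the three bounds give r - |z| >= d, |p| < r, and an excess over 1 of
     at most eta / 2 in the bound on |q| = r. *)
  set (dl := Rmin d (Rmin ((1 - norm p) / 2) (eta * d ^ 2 / 4))).
  assert (hdl : 0 < dl).
  { unfold dl. repeat apply Rmin_pos; try lra. assert (0 < eta * d ^ 2) by (apply Rmult_lt_0_compat;
      nra). lra. }
  assert (l1 : dl <= d) by apply Rmin_l.
  assert (l2 : dl <= (1 - norm p) / 2) by (eapply Rle_trans; [apply Rmin_r | apply Rmin_l]).
  assert (l3 : dl <= eta * d ^ 2 / 4) by (eapply Rle_trans; [apply Rmin_r | apply Rmin_r]).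
  clearbody dl. pose proof (norm_nonneg p) as hp0.
  set (r := 1 - dl). assert (hr : norm z < r < 1) by (unfold r, d in *; lra).
  assert (hr0 : norm p < r) by (unfold r; lra).
  pose proof (maximum_principle g r _ p tg ltac:(lra) (ring_bound r hr) hr0) as m.
  assert (hrd : d <= r - norm z) by (unfold r, d in *; lra).
  assert (hd2 : 0 < d ^ 2 <= (r - norm z) ^ 2) by (split; [apply pow_lt; lra | apply pow_incr; lra]).
  assert (bound : (1 - r ^ 2) / (r - norm z) ^ 2 <= eta / 2).
  { apply Rmult_le_reg_r with ((r - norm z) ^ 2); [lra |].
    replace ((1 - r ^ 2) / (r - norm z) ^ 2 * (r - norm z) ^ 2) with (1 - r ^ 2) by (field; lra).
    apply Rle_trans with (2 * dl); [unfold r; nra |].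
    apply Rle_trans with (eta / 2 * d ^ 2); [lra |]. apply Rmult_le_compat_l; lra. }
  unfold eta in *. lra.
Qed.

Lemma conv_spow_comm (a b : nat -> H) (n : nat) : conv a b = conv b a -> conv a (spow b n) =
  conv (spow b n) a.
Proof.
  intros E. induction n as [| n IH]; cbn [spow]; [rewrite conv_one_l, conv_one_r; reflexivity |].
  rewrite <- conv_assoc, E, conv_assoc, IH, conv_assoc. reflexivity.
Qed.

(** One factor q - z is exchanged at a time. [schwarz_step] acts on the leftmost factor; the
    denominator it produces commutes with q - z and is moved past the remaining factors onto k,
    where the induction hypothesis takes over. *)
Lemma schwarz_steps (z : H) (n : nat) (k : nat -> H) :
  norm z < 1 -> tame k ->
  (forall q : H, norm q < 1 -> norm (HPSeries (conv (spow (factor z) n) k) q) <= 1) ->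
  forall q : H, norm q < 1 -> norm (HPSeries (conv (spow (blaschke_denominator z) n) k) q) <= 1.
Proof.
  intros hz. revert k. induction n as [| n IH]; intros k hk hb q hq; [apply hb, hq |].
  rewrite spow_S_r, conv_assoc.
  apply IH; [apply tame_conv; [apply tame_lin | exact hk] | | exact hq].
  rewrite <- conv_assoc, <- (conv_spow_comm _ _ n (factor_denominator_comm z)), conv_assoc.
  apply schwarz_step; [exact hz | apply tame_conv; [apply tame_spow, tame_lin | exact hk] |].
  intros p hp. rewrite <- conv_assoc. apply hb, hp.
Qed.

Lemma spow_inverse (a b : nat -> H) (n : nat) : conv b a = one -> conv (spow b n) (spow a n) = one.
Proof.
  intros E. induction n as [| n IH]; [apply conv_one_l |].
  rewrite spow_S_r. cbn [spow]. rewrite conv_assoc, <- (conv_assoc b), E, conv_one_l. exact IH.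
Qed.

(** * Coefficients of the functions in the statement *)

Lemma expansion_cst (c : H) : expansion (cst c) (lin c zero).
Proof.
  intros q _. replace (cst c q) with (c +h q *h (zero : H)) by (unfold cst; quat). apply is_series_lin.
Qed.

Lemma expansion_id : expansion (fun p => p) (lin zero Hone).
Proof.
  intros q _. pose proof (is_series_lin zero Hone q) as s.
  replace ((zero : H) +h q *h Hone) with q in s by quat. exact s.
Qed.

Lemma expansion_minus_cst (g : H -> H) (a : nat -> H) (c : H) :
  expansion g a -> expansion (fun p => minus (g p) c) (splus a (sneg (lin c zero))).
Proof.
  intros hg q hq.
  assert (E : minus (g q) c = g q +h scal (-1) (c +h q *h (zero : H))) by (generalize (g q); intros; quat).
  rewrite E. eapply is_series_ext; [| apply is_series_plus_H; [apply hg, hq | apply is_series_scal_H,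
    is_series_lin]].
  intros n. cbv beta. unfold splus, sneg. quat.
Qed.

Lemma expansion_one_minus (g : H -> H) (a : nat -> H) :
  expansion g a -> expansion (one_minus g) (splus one (sneg a)).
Proof.
  intros hg q hq. unfold one_minus.
  assert (E : minus Hone (g q) = (Hone +h q *h (zero : H)) +h scal (-1) (g q)) by (generalize (g q);
    intros; quat).
  rewrite E. eapply is_series_ext; [| apply is_series_plus_H;
    [apply is_series_lin | apply is_series_scal_H, hg, hq]].
  intros n. cbv beta. unfold splus, sneg, one. quat.
Qed.

Lemma expansion_star_pow (g : H -> H) (a : nat -> H) (n : nat) :
  expansion g a -> expansion (star_pow g n) (spow a n).
Proof.
  intros hg. induction n as [| n IH].
  - apply (expansion_cst Hone).
  - cbn [star_pow spow]. exact (expansion_star g (star_pow g n) a (spow a n) hg IH).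
Qed.

(** The function c g is bounded by |c| < 1 on the ball, so the Neumann series applies. This serves
    both denominators: that of f, and with g the identity that of q0. *)
Lemma one_minus_cst_star_inverse (g : H -> H) (a : nat -> H) (c : H) :
  expansion g a -> (forall q, ball1 q -> ball1 (g q)) -> norm c < 1 ->
  exists v, tame v /\ expansion (star_inv (one_minus (star (cst c) g))) v /\
    conv (splus one (sneg (conv (lin c zero) a))) v = one /\
    conv v (splus one (sneg (conv (lin c zero) a))) = one.
Proof.
  intros hg hb hc. pose proof (expansion_tame g a hg) as ta.
  set (u := conv (lin c zero) a).
  assert (tu : tame u) by (apply tame_conv; [apply tame_lin | exact ta]).
  destruct (neumann_series u (norm c) tu) as (v & tv & wv & vw).
  - split; [apply norm_nonneg | exact hc].
  - intros q hq. destruct (eval_conv_exists (lin c zero) a q (tame_lin _ _) ta hq) as (p & hp & E).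
    unfold u. rewrite E, norm_Hmult, eval_lin. replace (c +h q *h (zero : H)) with c by quat.
    assert (hp1 : norm p < 1) by lra.
    rewrite (expansion_eval g a p hg hp1). pose proof (hb p hp1) as b. unfold ball1 in b.
    pose proof (norm_nonneg c). pose proof (norm_nonneg (g p)). nra.
  - exists v. split; [exact tv |]. split; [| split; assumption].
    apply expansion_star_inv with (splus one (sneg u)); try assumption.
    apply expansion_one_minus, expansion_star; [apply expansion_cst | exact hg].
Qed.

Lemma conv_const_comm (c : H) (a : nat -> H) :
  conv (conv (lin (Hconj c) zero) (lin c zero)) a = conv a (conv (lin (Hconj c) zero) (lin c zero)) /\
  conv (lin (Hconj c) zero) (lin c zero) = conv (lin c zero) (lin (Hconj c) zero).
Proof.
  assert (E : forall x y : H, conv (lin x zero) (lin y zero) = lin (x *h y) zero).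
  { intros x y. rewrite conv_const_l. apply functional_extensionality. intros [| [| n]]; cbn [lin]; quat. }
  rewrite !E, Hmult_conj_l, Hmult_conj_r. split; [| reflexivity].
  apply conv_comm. intros [| [| m]] n; cbn [lin]; quat.
Qed.

(** Writing c' for the conjugate of c, both sides expand to a - c - a c' a + |c|^2 a, the last term
    because c c' = c' c is real and commutes with a. *)
Lemma blaschke_exchange (a : nat -> H) (c : H) :
  let C := lin c zero in let C' := lin (Hconj c) zero in
  conv (splus one (sneg (conv a C'))) (splus a (sneg C)) =
  conv (splus a (sneg C)) (splus one (sneg (conv C' a))).
Proof.
  intros C C'. destruct (conv_const_comm c a) as [E1 E2]. fold C C' in E1, E2.
  rewrite (conv_splus_l one), (conv_splus_r (splus a (sneg C)) one), conv_one_l, conv_one_r.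
  rewrite (proj1 (sneg_conv (conv a C') _)), (proj2 (sneg_conv _ (conv C' a))). do 2 f_equal.
  rewrite (conv_splus_r (conv a C')), (conv_splus_l a).
  rewrite (proj1 (sneg_conv C _)), (proj2 (sneg_conv _ C)), !conv_assoc. do 2 f_equal.
  rewrite <- (conv_assoc C), <- E2, E1. reflexivity.
Qed.

(* (1 - f cbar) * h = f - c for h = (f - c) * (1 - cbar f)^{-*}; at a suitable q this reads
   (1 - f(q) cbar) h(p) = f(q) - c, with p arbitrary in the ball. *)
Lemma blaschke_quotient_bound (g : H -> H) (a v : nat -> H) (c : H) :
  expansion g a -> (forall q, ball1 q -> ball1 (g q)) -> norm c < 1 -> tame v ->
  conv (splus one (sneg (conv (lin (Hconj c) zero) a))) v = one ->
  forall p : H, norm p < 1 -> norm (HPSeries (conv (splus a (sneg (lin c zero))) v) p) <= 1.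
Proof.
  intros hg hb hc tv wv p hp. pose proof (expansion_tame g a hg) as ta.
  set (b := splus a (sneg (lin c zero))). set (D := splus one (sneg (conv a (lin (Hconj c) zero)))).
  assert (tac : tame (conv a (lin (Hconj c) zero))) by (apply tame_conv; [exact ta | apply tame_lin]).
  assert (tD : tame D) by (apply tame_splus; [apply tame_lin | apply tame_sneg, tac]).
  assert (tb : tame b) by (apply tame_splus; [exact ta | apply tame_sneg, tame_lin]).
  assert (Dh : conv D (conv b v) = b).
  { rewrite <- conv_assoc. unfold D, b. rewrite (blaschke_exchange a c), conv_assoc, wv. apply conv_one_r. }
  assert (eD : forall q : H, norm q < 1 -> HPSeries D q = Hone -h g q *h Hconj c).
  { intros q hq. unfold D.
    rewrite (eval_splus one _ q (tame_lin _ _) (tame_sneg _ tac) hq), (eval_sneg _ q tac hq), eval_one.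
    destruct (eval_conv_exists a (lin (Hconj c) zero) q ta (tame_lin _ _) hq) as (q' & _ & ->).
    rewrite eval_lin, (expansion_eval g a q hg hq). generalize (g q). intros. quat. }
  assert (eb : forall q : H, norm q < 1 -> HPSeries b q = g q -h c).
  { intros q hq. apply (expansion_eval (fun p => minus (g p) c) b q); [| exact hq].
    apply expansion_minus_cst, hg. }
  assert (nz : forall q : H, norm q < 1 -> HPSeries D q <> zero).
  { intros q hq e. rewrite (eD q hq) in e. apply (f_equal (@norm R_AbsRing H)) in e. rewrite norm_zero_H in e.
    pose proof (norm_minus_ge Hone (g q *h Hconj c)) as n. rewrite norm_Hone, norm_Hmult, norm_Hconj, e in n.
    pose proof (hb q hq) as n'. unfold ball1 in n'.
    pose proof (norm_nonneg c). pose proof (norm_nonneg (g q)). nra. }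
  destruct (conjugate_on_sphere D p tD hp) as (q & hq & E).
  { intros q hq. apply nz. lra. }
  assert (hq1 : norm q < 1) by lra.
  pose proof (eval_conv D (conv b v) q p tD (tame_conv b v tb tv) hq1 hp E) as F.
  rewrite Dh, (eb q hq1) in F. pose proof (norm_pos _ (nz q hq1)) as np.
  apply (f_equal (@norm R_AbsRing H)) in F. rewrite norm_Hmult in F.
  pose proof (hb q hq1) as n'. unfold ball1 in n'.
  pose proof (blaschke_disc (g q) c ltac:(lra) ltac:(lra)) as B. rewrite <- (eD q hq1), F in B.
  apply Rmult_le_reg_l with (norm (HPSeries D q)); [exact np | lra].
Qed.

Lemma denominator_spec (z : H) :
  splus one (sneg (conv (lin (Hconj z) zero) (lin zero Hone))) = blaschke_denominator z.
Proof.
  rewrite conv_const_l. apply functional_extensionality.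
  intros [| [| n]]; unfold splus, sneg, one, blaschke_denominator; cbn [lin]; quat.
Qed.

(** The value of the base at z is real, so every factor of the regular power is evaluated at z
    itself. *)
Lemma eval_denominator_pow (z : H) (n : nat) :
  norm z < 1 -> HPSeries (spow (blaschke_denominator z) n) z = Hreal ((1 - norm z ^ 2) ^ n).
Proof.
  intros hz. assert (e : HPSeries (blaschke_denominator z) z = Hreal (1 - norm z ^ 2)).
  { unfold blaschke_denominator. rewrite eval_lin, norm_sqr. quat. }
  induction n as [| n IH]; cbn [spow]; [rewrite eval_one; reflexivity |].
  rewrite (eval_conv _ _ z z); [| apply tame_lin | apply tame_spow, tame_lin | exact hz | exact hz |].
  - rewrite e, IH. cbn [pow]. quat.
  - rewrite e. quat.
Qed.

Lemma der_minus_const (a : nat -> H) (c : H) : der (splus a (sneg (lin c zero))) = der a.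
Proof.
  apply functional_extensionality. intros n. unfold der, splus, sneg.
  assert (E : lin c zero (S n) = zero) by (destruct n; reflexivity). rewrite E. quat.
Qed.

Lemma factor_spec (z : H) : splus (lin zero Hone) (sneg (lin z zero)) = factor z.
Proof.
  apply functional_extensionality. intros [| [| n]]; unfold splus, sneg, factor; cbn [lin]; quat.
Qed.

Theorem theorem5p2 (f : H -> H) (q0 : H) (n : nat)
  (f_regular : slice_regular ball1 f)
  (f_ball : forall q : H, ball1 q -> ball1 (f q))
  (q0_ball : ball1 q0)
  (n_ge1 : (1 <= n)%nat)
  (f_flat : forall m : nat, (1 <= m <= n - 1)%nat -> cullen_n m f q0 = zero) :
  (forall q : H, ball1 q ->
     norm (star (fun p => minus (f p) (f q0))
                (star_inv (one_minus (star (cst (Hconj (f q0))) f))) q)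
     <= norm (star (star_pow (fun p => minus p q0) n)
                   (star_pow
                      (star_inv (one_minus (star (cst (Hconj q0)) (fun p => p)))) n)
                   q)) /\
  norm (star (cullen_n n f)
             (star_inv (one_minus (star (cst (Hconj (f q0))) f))) q0)
  <= INR (fact n) / (1 - norm q0 ^ 2) ^ n.
Proof.
  pose proof q0_ball as hq0. unfold ball1 in hq0.
  assert (hc : norm (f q0) < 1) by exact (f_ball q0 q0_ball). pose proof hc as hcc.
  rewrite <- norm_Hconj in hcc.
  destruct (regular_expansion f f_regular) as (a & ha & _).
  { intros r hr. exists 1. intros q hq. left. apply f_ball. unfold ball1. lra. }
  pose proof (expansion_tame f a ha) as ta.
  destruct (one_minus_cst_star_inverse f a (Hconj (f q0)) ha f_ball hcc) as (v & tv & ev & wv & _).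
  assert (hq0c : norm (Hconj q0) < 1) by (rewrite norm_Hconj; exact hq0).
  destruct (one_minus_cst_star_inverse (fun p => p) (lin zero Hone) (Hconj q0) expansion_id
    (fun q hq => hq) hq0c) as (d & td & ed & Ed & dE).
  rewrite denominator_spec in Ed, dE.
  set (c := f q0) in *. set (b := splus a (sneg (lin c zero))).
  assert (eb : expansion (fun p => minus (f p) c) b) by (apply expansion_minus_cst, ha).
  assert (tb : tame b) by (apply expansion_tame with (1 := eb)).
  assert (db : forall m, (1 <= m)%nat -> der_n m b = der_n m a).
  { intros [| m] hm; [lia |]. rewrite !der_n_S. unfold b. rewrite der_minus_const. reflexivity. }
  destruct (factor_pow_of_flat b q0 n tb hq0) as (k & tk & bk).
  (* Order zero vanishes because f(q0) has been subtracted; for the orders 1 to n - 1, b and f have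
     the same derivatives. *)
  { intros [| m] hm.
    - cbn [der_n]. rewrite (expansion_eval _ _ q0 eb hq0). apply (@minus_eq_zero H).
    - rewrite db by lia. rewrite (expansion_eval _ _ q0 (expansion_cullen_n f a (S m) ha) hq0).
      apply f_flat. lia. }
  set (kap := conv k v). assert (tkap : tame kap) by (apply tame_conv; assumption).
  assert (bv : conv b v = conv (spow (factor q0) n) kap) by (rewrite bk; apply conv_assoc).
  set (g := conv (spow (blaschke_denominator q0) n) kap).
  assert (tg : tame g) by (apply tame_conv; [apply tame_spow, tame_lin | exact tkap]).
  assert (hg : forall q : H, norm q < 1 -> norm (HPSeries g q) <= 1).
  { apply schwarz_steps; [exact hq0 | exact tkap |]. rewrite <- bv.
    apply blaschke_quotient_bound with f; assumption. }
  split.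
  - intros q hq.
    pose proof (expansion_star _ _ _ _ eb ev) as eL.
    assert (eX : expansion (fun p => minus p q0) (factor q0)).
    { rewrite <- factor_spec. apply (expansion_minus_cst (fun p => p)), expansion_id. }
    pose proof (expansion_star _ _ _ _ (expansion_star_pow _ _ n eX) (expansion_star_pow _ _ n ed)) as eR.
    rewrite <- (expansion_eval _ _ q eL hq), <- (expansion_eval _ _ q eR hq).
    set (M := conv (spow (factor q0) n) (spow d n)) in *.
    assert (tM : tame M) by (apply expansion_tame with (1 := eR)).
    (* Between the n-th powers of q - q0 and kappa, the powers of d and of the denominator cancel, d
       being a left inverse of the denominator. *)
    assert (E : conv b v = conv M g).
    { unfold M, g. rewrite conv_assoc, <- (conv_assoc (spow d n)), spow_inverse, conv_one_l
        by exact dE. exact bv. }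
    rewrite E. destruct (eval_conv_exists M g q tM tg hq) as (p & hp & ->).
    rewrite norm_Hmult. rewrite <- (Rmult_1_r (norm (HPSeries M q))) at 2.
    apply Rmult_le_compat_l; [apply norm_nonneg | apply hg]. unfold ball1 in hq. lra.
  - pose proof (expansion_star _ _ _ _ (expansion_cullen_n f a n ha) ev) as eD.
    rewrite <- (expansion_eval _ _ q0 eD hq0), <- (db n n_ge1), bk.
    (* Multiplying n! k + (q - q0) * s by the reciprocal v on the right gives n! kappa + (q - q0) *
       (s * v), whose second summand vanishes at q0. *)
    destruct (der_n_factor_pow_mult q0 n k tk) as (s & ts & Es).
    rewrite Es, conv_splus_l, (proj1 (conv_scale_real _ k v)), conv_assoc.
    pose proof (tame_conv s v ts tv) as tsv.
    rewrite (eval_splus _ _ q0 (tame_scale _ _ tkap) (tame_conv (factor q0) _ (tame_lin _ _) tsv) hq0).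
    rewrite (eval_scale _ _ q0 tkap hq0), (eval_factor_mult q0 _ tsv hq0).
    replace (scal (INR (fact n)) (HPSeries kap q0) +h zero) with (scal (INR (fact n)) (HPSeries kap q0) : H)
      by (generalize (HPSeries kap q0); intros; quat).
    rewrite norm_scal_H, Rabs_pos_eq by apply pos_INR. unfold Rdiv.
    apply Rmult_le_compat_l; [apply pos_INR |].
    (* The first factor of g has a real value at q0, so kappa is evaluated at q0 as well. *)
    assert (eg : HPSeries g q0 = Hreal ((1 - norm q0 ^ 2) ^ n) *h HPSeries kap q0).
    { rewrite <- (eval_denominator_pow q0 n hq0). apply eval_conv; try assumption.
      - apply tame_spow, tame_lin.
      - rewrite (eval_denominator_pow q0 n hq0). quat. }
    pose proof (hg q0 hq0) as B. rewrite eg, norm_Hmult, norm_Hreal in B.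
    assert (P : 0 < (1 - norm q0 ^ 2) ^ n).
    { apply pow_lt. pose proof (norm_nonneg q0) as h. nra. }
    rewrite Rabs_pos_eq in B by lra.
    apply Rmult_le_reg_l with ((1 - norm q0 ^ 2) ^ n); [exact P |]. rewrite Rinv_r by lra. exact B.
Qed.
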